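(* Let $G=(V,E,\bm{\pi})$ be a connected, locally uniformly finite and stochastically complete weighted graph (satisfying the standing assumptions in the context), and let $\bm{\Psi}$ be a potential on $V$ satisfying the assumptions in the context. Consider the Fokker-Planck equation on $G$ $$\frac{\mathrm{d}\bm{\rho}}{\mathrm{d}t}=\mathrm{div}_G(\bm{\rho}\nabla_G\bm{\Psi})+\Delta_G\bm{\rho},\qquad \bm{\rho}(0)=\bm{\rho}^0 .$$ Then the following hold. (1) If $\bm{\rho}^0\in\mathcal{P}_0^*(G)$, the Fokker-Planck equation is a gradient flow on the infinite-dimensional Riemannian manifold $(\mathcal{P}_0^*(G),\mathcal{W}_2)$, namely the gradient flow of the free energy functional $\mathcal{F}(\bm{\rho})=\sum_{i=1}^\infty\pi_i\Psi_i\rho_i+\sum_{i=1}^\infty\pi_i\rho_i\log\rho_i$. (2) If $\bm{\rho}^0\in\mathcal{P}_0^*(G)$, the Fokker-Planck equation has a unique global solution $\bm{\rho}:[0,\infty)\to\mathcal{P}_0^*(G)$ with $\bm{\rho}(0)=\bm{\rho}^0$. (3) For every $r\in[2,\infty]$, the unique global solution $\bm{\rho}$ converges to the Gibbs density $\bm{\rho}^*=(\rho_i^* )_{i=1}^\infty\in\mathcal{P}_0^*(G)$ in the $\ell^r(V,\bm{\pi})$ norm, i.e. $\lim_{t\to\infty}\|\bm{\rho}(t)-\bm{\rho}^*\|_{\ell^r(V,\bm{\pi})}=0$, where $\rho_i^*=\frac1Z e^{-\Psi_i}$ and $Z=\sum_{j=1}^\infty\pi_je^{-\Psi_j}$.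
   Context: **Graph.** $V=\{x_i\}_{i\in\mathbb{N}}$ is countably infinite, $\mathbb{N}=\{1,2,\dots\}$; the graph is undirected, without loops or multiple edges, and connected. Edge weights $\omega_{ij}=\omega_{ji}$ satisfy $\omega_{ij}>0$ if $\{x_i,x_j\}\in E$ and $\omega_{ij}=0$ otherwise, with $\inf_{i\sim j}\omega_{ij}>0$ and $\sup_{i,j}\omega_{ij}<\infty$. Put $N(i)=\{j:\{x_i,x_j\}\in E\}$. Locally uniformly finite means $|N(i)|\le C_V$ for all $i$, for a constant $C_V\ge1$. The vertex measure is $\pi_i=\pi(x_i)=\sum_{j\in N(i)}\omega_{ij}$ and satisfies $\sum_i\pi_i=\infty$, $\inf_i\pi_i>0$, and $\pi_j\le K_0\pi_i$ for all adjacent $x_i,x_j$, for a constant $K_0>0$. For a function $f$ on $V$ write $f_i=f(x_i)$. $C(V)$ and $C(V^2)$ are the real functions on $V$ and $V\times V$. $\ell^p(V,\bm{\pi})$, $1\le p<\infty$, is the space of $f$ with $\sum_i\pi_i|f_i|^p<\infty$, with its usual norm; for $p=\infty$ it is the space of bounded functions with the sup norm. $\langle f,g\rangle_{\bm{\pi}}=\sum_if_ig_i\pi_i$. $d(x_i,x_j)$ is the length (number of edges) of a shortest path. **Operators.** $\nabla_G\phi(x_i,x_j)=\phi(x_j)-\phi(x_i)$ if $\{x_i,x_j\}\in E$ and $0$ otherwise; $\Delta_G\phi(x_i)=\sum_{j\in N(i)}\frac{\omega_{ij}}{\pi_i}(\phi(x_j)-\phi(x_i))$. **Stochastic completeness.**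 A fundamental solution of the heat equation $u_t=\Delta_Gu$ is a function $h:(0,\infty)\times V\times V\to\mathbb{R}$ such that for every bounded $u^0\in C(V)$ the function $u(t,x_i)=\sum_jh(t,x_i,x_j)u^0(x_j)\pi_j$ is differentiable in $t$, satisfies the heat equation, and $u(t,x_i)\to u^0(x_i)$ as $t\to0^+$ for every $i$. $G$ is stochastically complete if $\sum_jh(t,x_i,x_j)\pi_j=1$ for all $t>0$ and all $i$. **Densities.** $\mathcal{P}(G)=\{\bm{\rho}=(\rho_i)_{i=1}^\infty:\rho_i\ge0,\ \sum_i\rho_i\pi_i=1\}$; $\mathcal{P}_0(G)$ is the set of $\bm{\rho}\in\mathcal{P}(G)$ with all $\rho_i>0$; $\mathcal{P}_0^*(G)=\{\bm{\rho}\in\mathcal{P}_0(G):\sum_id^2(x_1,x_i)\rho_i\pi_i<\infty\}$ with $x_1\in V$ fixed. The logarithmic mean is $\hat\rho(x_i,x_j)=\frac{\rho_i-\rho_j}{\log\rho_i-\log\rho_j}$ if $\{x_i,x_j\}\in E$ and $\rho_i,\rho_j>0$ (equal to $\rho_i$ when $\rho_i=\rho_j$), and $0$ otherwise. For $\Phi\in C(V^2)$, $\mathrm{div}_G(\bm{\rho}\Phi)(x_i)=\sum_{j\in N(i)}\frac{\omega_{ij}}{\pi_i}\Phi(x_i,x_j)\hat\rho(x_i,x_j)$. **Potential.** $\bm{\Psi}=(\Psi_i)_{i=1}^\infty\in C(V)$ satisfies: $\Psi_i\to\infty$ as $i\to\infty$; $\Psi_i$ increases rapidly enough that $Z=\sum_j\pi_je^{-\Psi_j}<\infty$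 and the Gibbs density $\bm{\rho}^*=(e^{-\Psi_i}/Z)_i$ lies in $\mathcal{P}_0^*(G)$; and $|\nabla_G\bm{\Psi}(x_i,x_j)|\le C_\Psi$ for all $i,j$, for a constant $C_\Psi>1$. **Metric $\mathcal{W}_2$.** For $\bm{\rho}\in\mathcal{P}_0(G)$ let $\mathcal{K}_{\bm{\rho}}=\{\bm{p}\in C(V):\mathrm{div}_G(\bm{\rho}\nabla_G\bm{p})\in\ell^1(V,\bm{\pi})\}$ and $B_{\bm{\rho}}:\mathcal{K}_{\bm{\rho}}\to\ell^1(V,\bm{\pi})$, $B_{\bm{\rho}}\bm{p}=-\mathrm{div}_G(\bm{\rho}\nabla_G\bm{p})$. The tangent space is $T_{\bm{\rho}}\mathcal{P}_0(G)=\{\bm{\sigma}\in\mathrm{Ran}(B_{\bm{\rho}}):\sum_i\sigma_i\pi_i=0\}$. $B_{\bm{\rho}}^{-1}$ is the pseudo-inverse: $B_{\bm{\rho}}^{-1}\bm{\sigma}=\bm{p}$ where $\bm{p}$ (determined up to an additive constant) satisfies $B_{\bm{\rho}}\bm{p}=\bm{\sigma}$. The inner product on $T_{\bm{\rho}}\mathcal{P}_0(G)$ is $$g^{(2)}_{\bm{\rho}}(\bm{\sigma}^1,\bm{\sigma}^2)=\langle\bm{\sigma}^1,B_{\bm{\rho}}^{-1}\bm{\sigma}^2\rangle_{\bm{\pi}}=\langle B_{\bm{\rho}}\bm{p}^1,\bm{p}^2\rangle_{\bm{\pi}}=\tfrac12\sum_i\sum_{j\in N(i)}\omega_{ij}\nabla_G\bm{p}^1(x_i,x_j)\nabla_G\bm{p}^2(x_i,x_j)\hat\rho(x_i,x_j),\quad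 \bm{\sigma}^k=B_{\bm{\rho}}\bm{p}^k,$$ and $\mathcal{W}_2^2(\bm{\rho}^1,\bm{\rho}^2)=\inf\int_0^1g^{(2)}_{\bm{\rho}}(\dot{\bm{\rho}},\dot{\bm{\rho}})\,\mathrm{d}t$ over continuously differentiable curves $\bm{\rho}:[0,1]\to\mathcal{P}_0(G)$ from $\bm{\rho}^1$ to $\bm{\rho}^2$. **Gradient flow.** For a functional $\mathcal{J}$, $\frac{\delta}{\delta\bm{\rho}}\mathcal{J}(\bm{\rho})\in C(V)$ denotes its derivative with respect to $\langle\cdot,\cdot\rangle_{\bm{\pi}}$; in particular $\frac{\delta}{\delta\bm{\rho}}\mathcal{F}(\bm{\rho})=(\Psi_i+1+\log\rho_i)_{i=1}^\infty$. The gradient flow of $\mathcal{J}$ is the evolution equation for $\bm{\rho}(t)$ determined by $$g^{(2)}_{\bm{\rho}}(\dot{\bm{\rho}},\bm{\sigma})=-\Big\langle\frac{\delta}{\delta\bm{\rho}}\mathcal{J}(\bm{\rho}),\bm{\sigma}\Big\rangle_{\bm{\pi}}\quad\text{for all }\bm{\sigma}\in T_{\bm{\rho}}\mathcal{P}_0(G),$$ that is, $\dot{\bm{\rho}}=-B_{\bm{\rho}}\frac{\delta}{\delta\bm{\rho}}\mathcal{J}(\bm{\rho})$. **Solution.** A global solution in $\mathcal{P}_0^*(G)$ is a curve $\bm{\rho}\in C^1([0,\infty);\mathcal{P}_0^*(G))$ satisfying the equation at every vertex and every time.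
   Formalization: The pseudo-inverse of B_ρ is taken to be the preimage with absolutely summable flux (it is not unique up to constants in general), and the gradient flow identity is required only for those tangent vectors σ for which this preimage exists and the series involved converge absolutely. *)

(* Defs.v *)
From HB Require Import structures.
From mathcomp Require Import all_boot all_order all_algebra.
From mathcomp Require Import all_classical all_reals all_analysis.

Set Implicit Arguments.
Unset Strict Implicit.
Unset Printing Implicit Defensive.

Import Order.TTheory GRing.Theory Num.Theory.
Import numFieldNormedType.Exports.

Local Open Scope classical_set_scope.
Local Open Scope ring_scope.

(* The vertex x_(i+1) is represented by i : nat, so x_1 is vertex 0.
   A function on V is a function nat -> R, written phi, rho, sigma, p, ... *)
Record wgraph (R : realType) := WGraph {
  adj : rel nat;
  wt : nat -> nat -> R }.

Section Graph.
Context {R : realType}.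
Variable G : wgraph R.
Implicit Types (rho sigma p phi f : nat -> R) (t : R).

Local Notation w := (wt G).

Definition nbr (i : nat) : set nat := [set j | adj G i j].

(* [\sum_(j \in nbr i)] is a sum over a finite set once [locally_unif_finite]
   holds; by library convention it is 0 on infinite supports. *)
Definition vmeas (i : nat) : R := \sum_(j \in nbr i) w i j.

Local Notation mu := vmeas.

(** Series of real numbers indexed by V *)

Definition vsum (u : nat -> R) : R := limn (series u).

Definition vsummable (u : nat -> R) : Prop :=
  (\sum_(i <oo) `|u i|%:E < +oo)%E.

Definition pairing f1 f2 : R := vsum (fun i => f1 i * f2 i * mu i).

Definition pairing_abs_cvg f1 f2 : Prop :=
  vsummable (fun i => f1 i * f2 i * mu i).

(* The norm of l^r(V, pi), equal to +oo outside that space; only used for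
   1 <= r. *)
Definition lnorm (r : \bar R) f : \bar R :=
  (match r with
   | q%:E => (\sum_(i <oo) (mu i * `|f i| `^ q)%:E) `^ q^-1
   | _ => ereal_sup (range (fun i => `|f i|%:E))
   end)%E.

Definition in_l1 f : Prop := (lnorm 1%:E f < +oo)%E.

(** Standing assumptions on the graph *)

Definition gpath (i j : nat) : set (seq nat) :=
  [set s | path (adj G) i s /\ last i s = j].

Definition gconnected : Prop := forall i j, gpath i j !=set0.

Definition gdist (i j : nat) : R := inf [set (size s)%:R | s in gpath i j].

Definition locally_unif_finite : Prop :=
  exists2 C : nat, (1 <= C)%N & forall i, (nbr i #<= `I_C)%card.

Record weighted_graph : Prop := WeightedGraph {
  adj_sym : symmetric (adj G);
  adj_irr : irreflexive (adj G);
  wt_sym : forall i j, w i j = w j i;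
  wt_pos : forall i j, adj G i j -> 0 < w i j;
  wt_zero : forall i j, ~~ adj G i j -> w i j = 0;
  wt_inf : (0 < ereal_inf [set (w x.1 x.2)%:E
                          | x in [set x : nat * nat | adj G x.1 x.2]])%E;
  wt_sup : (ereal_sup [set (w x.1 x.2)%:E | x in [set: nat * nat]] < +oo)%E;
  vmeas_infinite : (\sum_(i <oo) (mu i)%:E = +oo)%E;
  vmeas_inf : (0 < ereal_inf (range (fun i => (mu i)%:E)))%E;
  vmeas_adj : exists2 K0 : R, 0 < K0 &
    forall i j, adj G i j -> mu j <= K0 * mu i }.

(** Operators *)

Definition grad phi (i j : nat) : R := if adj G i j then phi j - phi i else 0.

Definition laplacian phi (i : nat) : R :=
  \sum_(j \in nbr i) w i j / mu i * (phi j - phi i).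

Definition lmean rho (i j : nat) : R :=
  if [&& adj G i j, 0 < rho i & 0 < rho j] then
    if rho i == rho j then rho i else (rho i - rho j) / (ln (rho i) - ln (rho j))
  else 0.

(* div_G (rho Phi) *)
Definition divG rho (Phi : nat -> nat -> R) (i : nat) : R :=
  \sum_(j \in nbr i) w i j / mu i * Phi i j * lmean rho i j.

(** Stochastic completeness *)

Definition heat_ext (h : R -> nat -> nat -> R) (u0 : nat -> R) t (i : nat) : R :=
  vsum (fun j => h t i j * u0 j * mu j).

Definition fundamental_solution (h : R -> nat -> nat -> R) : Prop :=
  forall u0 : nat -> R, (exists M, forall j, `|u0 j| <= M) ->
  [/\ forall t i, 0 < t -> vsummable (fun j => h t i j * u0 j * mu j),
      forall t i, 0 < t ->
        is_derive t 1 (fun s => heat_ext h u0 s i)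
                  (laplacian (heat_ext h u0 t) i)
    & forall i, heat_ext h u0 t i @[t --> 0^'+] --> u0 i].

Definition stochastically_complete : Prop :=
  exists2 h, fundamental_solution h &
    forall t i, 0 < t -> vsum (fun j => h t i j * mu j) = 1.

(** Densities *)

Definition dens : set (nat -> R) := [set rho |
  (forall i, 0 <= rho i) /\ (\sum_(i <oo) (rho i * mu i)%:E = 1)%E].

Definition dens0 : set (nat -> R) := [set rho |
  dens rho /\ forall i, 0 < rho i].

Definition dens0s : set (nat -> R) := [set rho |
  dens0 rho /\ (\sum_(i <oo) (gdist 0 i ^+ 2 * rho i * mu i)%:E < +oo)%E].

(* [rho : I -> l^1(V, pi)] is continuously differentiable with derivative
   [drho]; derivatives are one-sided at the endpoints of I. *)
Definition C1_curve (I : set R) (rho drho : R -> nat -> R) : Prop :=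
  forall t, I t ->
    lnorm 1%:E (fun i => (rho s i - rho t i) / (s - t) - drho t i)
      @[s --> within I t^'] --> 0%E /\
    lnorm 1%:E (fun i => drho s i - drho t i) @[s --> within I (nbhs t)] --> 0%E.

(** The Riemannian structure of dens0 *)

Definition Kdom rho : set (nat -> R) := [set p | in_l1 (divG rho (grad p))].

Definition Bop rho p (i : nat) : R := - divG rho (grad p) i.

Definition tangent rho : set (nat -> R) := [set sigma |
  (exists2 p, Kdom rho p & Bop rho p = sigma) /\
  vsum (fun i => sigma i * mu i) = 0].

(* On an infinite graph [Bop rho p = sigma] alone does not determine p up to a
   constant: on Z the function p with w_(i,i+1) (p_(i+1) - p_i) \hat\rho_(i,i+1)
   constant and nonzero is in the kernel of B_rho. The pseudo-inverse selects
   the preimage whose flux w_ij (p_j - p_i) \hat\rho_ij is absolutely summable,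
   which is unique up to a constant on a connected locally finite graph (test
   against cutoffs max(0, 1 - d(x_1, .)/k)); every p with finite energy
   \sum w_ij (p_j - p_i)^2 \hat\rho_ij has this property. *)
Definition is_Bpinv rho sigma : set (nat -> R) := [set p |
  [/\ Kdom rho p, Bop rho p = sigma &
      (\sum_(i <oo)
        (\sum_(j \in nbr i) w i j * `|grad p i j| * lmean rho i j)%:E < +oo)%E]].

Definition Bpinv rho sigma : nat -> R := xget (fun=> 0) (is_Bpinv rho sigma).

Definition g2 rho sigma1 sigma2 : R := pairing sigma1 (Bpinv rho sigma2).

(* The pseudo-inverses exist and the two series giving g2 sigma1 sigma2,
   <sigma1, B^-1 sigma2> and
   1/2 \sum_i \sum_j w_ij (p1_j - p1_i) (p2_j - p2_i) \hat\rho_ij,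
   converge absolutely. *)
Definition g2_defined rho sigma1 sigma2 : Prop :=
  [/\ is_Bpinv rho sigma1 !=set0, is_Bpinv rho sigma2 !=set0,
      pairing_abs_cvg sigma1 (Bpinv rho sigma2) &
      (\sum_(i <oo) (\sum_(j \in nbr i)
         w i j * `|grad (Bpinv rho sigma1) i j|
               * `|grad (Bpinv rho sigma2) i j| * lmean rho i j)%:E < +oo)%E].

(* The squared distance induced by g2. The gradient flow equation below only
   involves the metric tensor g2. *)
Definition W2_sq (rho1 rho2 : nat -> R) : \bar R :=
  ereal_inf [set a : \bar R | exists c dc : R -> nat -> R,
    [/\ C1_curve `[0, 1]%classic c dc,
        (forall t, 0 <= t <= 1 -> [/\ dens0 (c t), tangent (c t) (dc t) &
                                    g2_defined (c t) (dc t) (dc t)]),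
        c 0 = rho1, c 1 = rho2 &
        a = (\int[lebesgue_measure]_(t in `[0%R, 1%R])
               (g2 (c t) (dc t) (dc t))%:E)%E]].

(* D is the derivative of J at rho for the pairing <.,.>_pi; testing with
   finitely supported directions determines D in C(V). *)
Definition first_variation (J : (nat -> R) -> R) rho (D : nat -> R) : Prop :=
  forall sigma, finite_set [set i | sigma i != 0] ->
    is_derive (0 : R) 1 (fun s : R => J (fun i => rho i + s * sigma i))
              (pairing D sigma).

Definition gradient_flow_at (J : (nat -> R) -> R) rho (v : nat -> R) : Prop :=
  exists2 D, first_variation J rho D &
  [/\ tangent rho v, is_Bpinv rho v !=set0 &
      forall sigma, tangent rho sigma ->
        g2_defined rho v sigma -> pairing_abs_cvg D sigma ->
        g2 rho v sigma = - pairing D sigma].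

Definition gradient_flow (J : (nat -> R) -> R) (rho drho : R -> nat -> R) : Prop :=
  forall t, 0 <= t -> gradient_flow_at J (rho t) (drho t).

(** Potential, free energy and the Fokker-Planck equation *)

Variable Psi : nat -> R.

Definition partition_fun : R := vsum (fun j => mu j * expR (- Psi j)).

Definition gibbs (i : nat) : R := expR (- Psi i) / partition_fun.

Record potential : Prop := Potential {
  pot_infty : Psi i @[i --> \oo] --> +oo;
  pot_Z : (\sum_(j <oo) (mu j * expR (- Psi j))%:E < +oo)%E;
  pot_gibbs : dens0s gibbs;
  pot_grad : exists2 C : R, 1 < C & forall i j, `|grad Psi i j| <= C }.

Definition free_energy rho : R :=
  vsum (fun i => mu i * Psi i * rho i) +
  vsum (fun i => mu i * rho i * ln (rho i)).

Definition fp_rhs rho (i : nat) : R :=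
  divG rho (grad Psi) i + laplacian rho i.

Definition fp_equation (rho drho : R -> nat -> R) : Prop :=
  forall t i, 0 <= t -> drho t i = fp_rhs (rho t) i.

Definition curve_in_dens0s (rho drho : R -> nat -> R) : Prop :=
  C1_curve `[0, +oo[%classic rho drho /\ forall t, 0 <= t -> dens0s (rho t).

Definition global_solution (rho0 : nat -> R) (rho : R -> nat -> R) : Prop :=
  exists2 drho, curve_in_dens0s rho drho &
    fp_equation rho drho /\ rho 0 = rho0.

End Graph.

(* Main.v *)
(* Write D(a, b) = (a - b)^2 / (a + b), a convex function which is homogeneous of
   degree one, and let E(rho, rho') be the sum of pi_i D(rho_i, rho'_i).

   Well-posedness. The drift contains the logarithmic mean, which is not
   Lipschitz when neighbouring densities have unbounded ratio.  Along an edge,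
   however, diffusion contributes - (p - q)^2 (A + B) to dE/dt, with
   A = rho_i + rho'_i, p = (rho_i - rho'_i) / A and B, q likewise at j, whereas the
   drift contributes at most C logmean(A, B) (p - q)^2.  Since
   logmean(s, 1) -> 0 as s -> 0, diffusion absorbs the drift unless A and B are
   comparable, hence dE/dt <= K E.  As |rho - rho'|_1^2 <= 2 E, this gives
   uniqueness and also the convergence in l^1 of explicit Euler schemes; convexity
   of D makes the estimate exact for discrete steps.

   Convergence. For convex phi with bounded derivative, the sum of
   pi_i rho*_i phi(rho_i / rho*_i) is nonincreasing.  The choice phi(x) = (x - L)^+
   yields tightness and, with L = 1, monotonicity of |rho - rho*|_1; the choice
   phi(x) = 1 / (1 + x) has a dissipation that stays away from zero as long as
   |rho - rho*|_1 does.

   Gradient flow. If the fluxes of p and q are summable then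
   <B p, q> = <p, B q> follows by truncating one of the two functions, since the
   flux of the other one leaves no boundary term.  The converse direction tests
   with sigma = B delta_k. *)

Require Import Defs.
From HB Require Import structures.
From mathcomp Require Import all_boot all_order all_algebra.
From mathcomp Require Import all_classical all_reals all_analysis.
From mathcomp Require Import ring lra.

Set Implicit Arguments.
Unset Strict Implicit.
Unset Printing Implicit Defensive.

Import Order.TTheory GRing.Theory Num.Theory.
Import numFieldNormedType.Exports.

Local Open Scope classical_set_scope.
Local Open Scope ring_scope.

(** * The logarithmic mean *)

Section LogMean.
Context {R : realType}.
Implicit Types (a b c x y : R).

(** The equation is used in backward form: [rho (t + h) - rho t - h * F (rho (t + h))] has l^1 norm
    at most [e * h], for all [h] below a threshold that depends on [e] but not on [t]. Blocks of
    explicit Euler steps and C^1 solutions both have this property, and conversely it implies C^1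
    regularity, so one discrete Gronwall argument serves existence and uniqueness. The backward form
    is dictated by convexity: an increment of a convex functional is bounded from above by its
    linearisation at the new point. Relative entropy is avoided as a Lyapunov functional because its
    derivative [ln (rho / gibbs)] is unbounded, and on an infinite graph a summation by parts
    against it would need integrability that is not at hand. All functionals used have derivatives
    bounded by 3, so a derivative times an l^1 velocity remains summable and each dissipation
    estimate reduces to a sign condition on single edges. Convergence in l^1 suffices for every r >=
    2 since the vertex measure is bounded below. *)

Definition logmean a b : R := if a == b then a else (a - b) / (ln a - ln b).

Lemma logmeanC a b : logmean a b = logmean b a.
Proof.
rewrite /logmean eq_sym; case: eqP => [->//|_].
by rewrite -(opprB b) -(opprB (ln b)) invrN mulrNN.
Qed.

Lemma logmeanxx a : logmean a a = a.
Proof. by rewrite /logmean eqxx. Qed.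

Lemma ln_diff_le a b : 0 < a -> 0 < b -> ln a - ln b <= (a - b) / b.
Proof.
move=> a0 b0; rewrite -ln_div ?posrE//.
have -> : (a - b) / b = a / b - 1 by field; rewrite gt_eqF.
have h : expR (ln (a / b)) = a / b by rewrite lnK// posrE divr_gt0.
have := expR_ge1Dx (ln (a / b)); rewrite h; lra.
Qed.

Lemma ln_diff_ge a b : 0 < a -> 0 < b -> (a - b) / a <= ln a - ln b.
Proof.
move=> a0 b0; have := @ln_diff_le b a b0 a0.
have -> : (b - a) / a = - ((a - b) / a) by rewrite -mulNr opprB.
lra.
Qed.

Lemma ln_diff_gt0 a b : 0 < a -> a < b -> 0 < ln b - ln a.
Proof. by move=> a0 ab; rewrite subr_gt0 ltr_ln// posrE (lt_trans a0). Qed.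

Lemma logmeanE a b : 0 < a -> a < b -> logmean a b * (ln b - ln a) = b - a.
Proof.
move=> a0 ab; rewrite logmeanC /logmean gt_eqF// mulfVK// gt_eqF//.
exact: ln_diff_gt0.
Qed.

Lemma logmean_mul_ln a b : 0 < a -> 0 < b -> logmean a b * (ln b - ln a) = b - a.
Proof.
move=> a0 b0; case: (ltgtP a b) => [ab|ba|->]; last by rewrite !subrr mulr0.
  exact: logmeanE.
by rewrite logmeanC -(opprB (ln a)) mulrN logmeanE// opprB.
Qed.

Lemma logmean_gt0 a b : 0 < a -> 0 < b -> 0 < logmean a b.
Proof.
wlog: a b / a <= b => [hw a0 b0|].
  by case: (leP a b) => [/hw|/ltW /hw]; [exact|rewrite logmeanC; exact].
rewrite le_eqVlt => /predU1P[-> _|ab a0 b0]; first by rewrite logmeanxx.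
have := logmeanE a0 ab; have h := ln_diff_gt0 a0 ab.
rewrite -subr_gt0 in ab => E; rewrite -E in ab.
by rewrite (pmulr_lgt0 _ h) in ab.
Qed.

Lemma logmean_hom c a b : 0 < c -> 0 < a -> 0 < b ->
  logmean (c * a) (c * b) = c * logmean a b.
Proof.
move=> c0 a0 b0; rewrite /logmean.
rewrite (inj_eq (mulfI (lt0r_neq0 c0))); case: (a =P b) => // _.
rewrite !lnM ?posrE//.
have -> : ln c + ln a - (ln c + ln b) = ln a - ln b by ring.
by rewrite mulrA mulrBr.
Qed.

Lemma logmean_bounds a b : 0 < a -> a <= b -> a <= logmean a b <= b.
Proof.
move=> a0; rewrite le_eqVlt => /predU1P[->|ab]; first by rewrite logmeanxx lexx.
have h := ln_diff_gt0 a0 ab; have E := logmeanE a0 ab.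
have b0 : 0 < b by apply: lt_trans ab.
apply/andP; split.
  rewrite -(ler_pM2r h) E.
  have := @ln_diff_le b a b0 a0; rewrite ler_pdivlMr//; lra.
rewrite -(ler_pM2r h) E.
have := @ln_diff_ge b a b0 a0; rewrite ler_pdivrMr//; lra.
Qed.

Lemma logmean_le_add a b : 0 < a -> 0 < b -> logmean a b <= a + b.
Proof.
wlog: a b / a <= b => [hw a0 b0|].
  case: (leP a b) => [/hw|/ltW /hw]; first exact.
  by rewrite logmeanC addrC; exact.
by move=> ab a0 b0; have /andP[_ h] := logmean_bounds a0 ab; lra.
Qed.

(* Concavity of the logarithm: its chord slopes are nonincreasing. *)
Lemma logmean_homol a a' b : 0 < a -> 0 < b -> a <= a' ->
  logmean a b <= logmean a' b.
Proof.
move=> a0 b0; rewrite le_eqVlt => /predU1P[->//|aa'].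
have a'0 : 0 < a' by apply: lt_trans aa'.
case: (leP a b) => [ab|ba].
  have [a'b|ba'] := leP b a'.
    have /andP[_ h] := logmean_bounds a0 ab.
    have /andP[h' _] := logmean_bounds b0 a'b.
    by rewrite (logmeanC a'); apply: le_trans h h'.
  have ab' : a < b by apply: lt_trans ba'.
  have E := logmeanE a0 ab'; have E' := logmeanE a'0 ba'.
  have h1 := ln_diff_gt0 a0 ab'; have h2 := ln_diff_gt0 a'0 ba'.
  have t' := logmean_gt0 a'0 b0.
  rewrite -(ler_pM2r h1) E.
  have k1 := @ln_diff_ge a' a a'0 a0; rewrite ler_pdivrMr// in k1.
  have /andP[k2 _] := logmean_bounds a'0 (ltW ba').
  have : 0 <= (logmean a' b - a') * (ln a' - ln a).
    rewrite mulr_ge0// ?subr_ge0// ler_ln ?posrE// ltW//.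
  nra.
have ba' : b < a' by apply: lt_trans aa'.
rewrite (logmeanC a) (logmeanC a').
have E := logmeanE b0 ba; have E' := logmeanE b0 ba'.
have h1 := ln_diff_gt0 b0 ba; have h2 := ln_diff_gt0 b0 ba'.
rewrite -(ler_pM2r h2) E'.
have k1 := @ln_diff_le a' a a'0 a0; rewrite ler_pdivlMr// in k1.
have /andP[_ k2] := logmean_bounds b0 (ltW ba).
have : 0 <= (a - logmean b a) * (ln a' - ln a).
  rewrite mulr_ge0// ?subr_ge0// ler_ln ?posrE// ltW//.
nra.
Qed.

Lemma logmean_homo a a' b b' : 0 < a -> 0 < b -> a <= a' -> b <= b' ->
  logmean a b <= logmean a' b'.
Proof.
move=> a0 b0 aa' bb'; apply: (@le_trans _ _ (logmean a' b)).
  exact: logmean_homol.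
by rewrite logmeanC (logmeanC a') logmean_homol// (lt_le_trans a0).
Qed.

Lemma logmean_scale x y a b : 0 < x -> x <= y -> 0 < a -> 0 < b ->
  x * logmean a b <= logmean (x * a) (y * b) <= y * logmean a b.
Proof.
move=> x0 xy a0 b0; have y0 : 0 < y by apply: lt_le_trans xy.
by rewrite -!logmean_hom// !logmean_homo ?mulr_gt0// ler_wpM2r// ltW.
Qed.

Lemma logmean_scale' x y a b : 0 < y -> y <= x -> 0 < a -> 0 < b ->
  y * logmean a b <= logmean (x * a) (y * b) <= x * logmean a b.
Proof.
move=> x0 xy a0 b0; rewrite (logmeanC a) (logmeanC (x * a)).
exact: logmean_scale.
Qed.

(* [logmean s 1 <= 1 / ln (1 / s)] tends to 0 with s. *)
Lemma logmean_dichotomy (e : R) : 0 < e -> exists2 M : R, 0 < M &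
  forall a b, 0 < a -> 0 < b ->
    logmean a b <= e * (a + b) \/ logmean a b <= M * a /\ logmean a b <= M * b.
Proof.
(* The threshold is the ratio [expR e^-1]: beyond it [ln b - ln a] is at least [e^-1], so the mean
   is at most [e * (b - a)]; below it [a] and [b] are comparable. *)
move=> e0; exists (1 + expR e^-1); first by rewrite addr_gt0// expR_gt0.
wlog: / True => [hw|_ a b]; first exact: hw.
wlog: a b / a <= b => [hw a0 b0|ab a0 b0].
  case: (leP a b) => [/hw|/ltW /hw]; first exact.
  by rewrite logmeanC (addrC a) => /(_ b0 a0)[|[]]; [left|right].
have /andP[l1 l2] := logmean_bounds a0 ab.
have [h|h] := leP b (expR e^-1 * a).
  right; split; first by apply: (le_trans l2); nra.
  by apply: (le_trans l2); rewrite ler_peMl ?(ltW b0)// lerDl expR_ge0.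
left.
have E1 : 1 < expR e^-1 by rewrite expR_gt1 invr_gt0.
have ab' : a < b by apply: lt_trans h; rewrite ltr_pMl.
have k : e^-1 <= ln b - ln a.
  rewrite -ln_div ?posrE// -ler_expR lnK ?posrE ?divr_gt0//.
  by rewrite ler_pdivlMr// ltW.
have k0 : 0 < ln b - ln a by exact: ln_diff_gt0.
rewrite -(ler_pM2r k0) logmeanE//.
have : 1 <= e * (ln b - ln a) by rewrite mulrC -ler_pdivrMr// mul1r.
nra.
Qed.

End LogMean.

(** * Stability inequality along an edge *)

Section Edge.
Context {R : realType}.
Implicit Types (a b c p q A B : R).

(** The triangular (Vincze-Le Cam) discrimination. For positive arguments its partial derivatives
    lie between -3 and 1, so they can multiply l^1 functions. *)
Definition tri a b : R := (a - b) ^+ 2 / (a + b).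

Definition dtri a b : R := 1 - 4 * b ^+ 2 / (a + b) ^+ 2.

Lemma tri_ge0 a b : 0 < a -> 0 < b -> 0 <= tri a b.
Proof. by move=> a0 b0; rewrite divr_ge0 ?sqr_ge0// addr_ge0// ltW. Qed.

Lemma dtri_bound a b : 0 < a -> 0 < b -> `|dtri a b| <= 3.
Proof.
move=> a0 b0; have s0 : 0 < (a + b) ^+ 2 by rewrite exprn_gt0// addr_gt0.
have h : 0 <= 4 * b ^+ 2 / (a + b) ^+ 2 <= 4.
  apply/andP; split; last by rewrite ler_pdivrMr//; nra.
  by rewrite divr_ge0 ?(ltW s0)// mulr_ge0 ?sqr_ge0.
by rewrite /dtri ler_norml; lra.
Qed.

(* [tri] is convex and homogeneous of degree one with partial derivatives
   [dtri a b] and [dtri b a], so it is the supremum of its tangent maps. *)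
Lemma tri_tangent a b a' b' : 0 < a -> 0 < b -> 0 < a' -> 0 < b' ->
  tri a' b' <= tri a b + dtri a' b' * (a' - a) + dtri b' a' * (b' - b).
Proof.
move=> a0 b0 a'0 b'0; rewrite -subr_ge0.
have -> : tri a b + dtri a' b' * (a' - a) + dtri b' a' * (b' - b) - tri a' b'
  = (a + b) * ((a - b) / (a + b) - (a' - b') / (a' + b')) ^+ 2.
  rewrite /tri /dtri; field; rewrite ?(addrC b' a') !gt_eqF ?addr_gt0//.
by rewrite mulr_ge0 ?sqr_ge0// addr_ge0// ltW.
Qed.

(** Sum and relative difference as coordinates: by homogeneity [tri] becomes [A * p ^+ 2] and its
    derivatives depend on [p] alone. *)
Lemma half_polar a b : 0 < a -> 0 < b ->
  exists A p, [/\ 0 < A, -1 < p < 1, a = (1 + p) / 2 * A & b = (1 - p) / 2 * A].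
Proof.
move=> a0 b0; exists (a + b), ((a - b) / (a + b)).
have s0 : 0 < a + b by rewrite addr_gt0.
split=> //.
- by rewrite ltr_pdivlMr// ltr_pdivrMr//; lra.
- by field; rewrite gt_eqF.
- by field; rewrite gt_eqF.
Qed.

Lemma tri_polar A p : 0 < A -> tri ((1 + p) / 2 * A) ((1 - p) / 2 * A) = A * p ^+ 2.
Proof. by move=> A0; rewrite /tri; field; rewrite gt_eqF//; lra. Qed.

Lemma dtri_polar A p : 0 < A ->
  dtri ((1 + p) / 2 * A) ((1 - p) / 2 * A) = 2 * p - p ^+ 2.
Proof. by move=> A0; rewrite /dtri; field; rewrite gt_eqF//; lra. Qed.

Lemma dtri_polar' A p : 0 < A ->
  dtri ((1 - p) / 2 * A) ((1 + p) / 2 * A) = - 2 * p - p ^+ 2.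
Proof. by move=> A0; rewrite /dtri; field; rewrite gt_eqF//; lra. Qed.

(** Monotonicity and homogeneity trap each mean between multiples of [logmean A B]; the order of [p]
    and [q] decides which factor is the smaller one. *)
Lemma logmean_polar A B p q : 0 < A -> 0 < B -> -1 < p < 1 -> -1 < q < 1 ->
  let T1 := logmean ((1 + p) / 2 * A) ((1 + q) / 2 * B) in
  let T2 := logmean ((1 - p) / 2 * A) ((1 - q) / 2 * B) in
  (p <= q /\
    [/\ (1 + p) / 2 * logmean A B <= T1, T1 <= (1 + q) / 2 * logmean A B,
      (1 - q) / 2 * logmean A B <= T2 & T2 <= (1 - p) / 2 * logmean A B])
  \/ (q <= p /\
    [/\ (1 + q) / 2 * logmean A B <= T1, T1 <= (1 + p) / 2 * logmean A B,
      (1 - p) / 2 * logmean A B <= T2 & T2 <= (1 - q) / 2 * logmean A B]).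
Proof.
move=> A0 B0 /andP[p1 p2] /andP[q1 q2] T1 T2.
have [pq|/ltW qp] := leP p q; [left|right]; split=> //.
  have /andP[] : (1 + p) / 2 * logmean A B <= T1 <= (1 + q) / 2 * logmean A B.
    by apply: logmean_scale => //; lra.
  have /andP[] : (1 - q) / 2 * logmean A B <= T2 <= (1 - p) / 2 * logmean A B.
    by apply: logmean_scale' => //; lra.
  by [].
have /andP[] : (1 + q) / 2 * logmean A B <= T1 <= (1 + p) / 2 * logmean A B.
  by apply: logmean_scale' => //; lra.
have /andP[] : (1 - p) / 2 * logmean A B <= T2 <= (1 - q) / 2 * logmean A B.
  by apply: logmean_scale => //; lra.
by [].
Qed.

Lemma polar_dichotomy (A B p q M T : R) : 0 < A -> 0 < B -> 0 < M -> 0 <= T ->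
  T <= M * A -> T <= M * B ->
  T * (p - q) ^+ 2 <= 2 * M * (A * p ^+ 2 + B * q ^+ 2).
Proof.
move=> A0 B0 M0 T0 h1 h2.
have : T * p ^+ 2 <= M * A * p ^+ 2 by rewrite ler_wpM2r ?sqr_ge0.
have : T * q ^+ 2 <= M * B * q ^+ 2 by rewrite ler_wpM2r ?sqr_ge0.
have : 0 <= T * (p + q) ^+ 2 by rewrite mulr_ge0 ?sqr_ge0.
nra.
Qed.

(* In the variables [A = a + a'], [p = (a - a') / A] and [B], [q] likewise, the
   diffusion part equals [- (p - q)^2 (A + B)], while the drift part is at most
   [C logmean A B (p - q)^2]; the latter is absorbed by the former unless [A]
   and [B] are comparable. *)
Lemma edge_stability (C : R) : 0 <= C -> exists2 K : R, 0 < K &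
  forall a a' b b' c, 0 < a -> 0 < a' -> 0 < b -> 0 < b' -> `|c| <= C ->
  (dtri a a' - dtri b b') * (b - a + c * logmean a b) +
  (dtri a' a - dtri b' b) * (b' - a' + c * logmean a' b')
    <= K * (tri a a' + tri b b').
Proof.
(* This tolerance gives [C * logmean A B <= A + B] in the first alternative: diffusion then absorbs
   the whole drift. *)
move=> C0; have e0 : 0 < (C + 1)^-1 by rewrite invr_gt0; lra.
have [M M0 hM] := logmean_dichotomy e0; exists (2 * C * M + 1).
  by rewrite ltr_wpDl// !mulr_ge0// ltW.
move=> a a' b b' c a0 a'0 b0 b'0 hc.
have [A [p [A0 hp ea ea']]] := half_polar a0 a'0.
have [B [q [B0 hq eb eb']]] := half_polar b0 b'0.
rewrite ea ea' eb eb' !dtri_polar ?dtri_polar' ?tri_polar//.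
have := logmean_polar A0 B0 hp hq; rewrite /=.
set T1 := logmean (_ * A) ((1 + q) / 2 * B).
set T2 := logmean (_ * A) ((1 - q) / 2 * B); set T := logmean A B => hT.
have T0 : 0 < T by exact: logmean_gt0.
have hMT := hM A B A0 B0; rewrite -/T in hMT; clearbody T T1 T2.
(* The drift contributes exactly [2 * c * (p - q) * Q]; the bounds on [T1] and [T2] extract a second
   factor [p - q] from [Q]. *)
set Q := (1 - (p + q) / 2) * T1 - (1 + (p + q) / 2) * T2.
have hQ : `|Q| <= T * `|p - q| / 2.
  rewrite /Q ler_norml; move: hp hq => /andP[p1 p2] /andP[q1 q2].
  case: hT => -[pq [h1 h2 h3 h4]].
    rewrite ler0_norm ?subr_le0//.
    have m1 : 0 <= 1 - (p + q) / 2 by lra.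
    have m2 : 0 <= 1 + (p + q) / 2 by lra.
    move/(ler_wpM2l m1): h1; move/(ler_wpM2l m1): h2.
    move/(ler_wpM2l m2): h3; move/(ler_wpM2l m2): h4.
    rewrite -![_ * _ <= _]subr_ge0 => ? ? ? ?.
    by apply/andP; split; rewrite -subr_ge0; lra.
  rewrite ger0_norm ?subr_ge0//.
  have m1 : 0 <= 1 - (p + q) / 2 by lra.
  have m2 : 0 <= 1 + (p + q) / 2 by lra.
  move/(ler_wpM2l m1): h1; move/(ler_wpM2l m1): h2.
  move/(ler_wpM2l m2): h3; move/(ler_wpM2l m2): h4.
  rewrite -![_ * _ <= _]subr_ge0 => ? ? ? ?.
  by apply/andP; split; rewrite -subr_ge0; lra.
rewrite [leLHS](_ : _ = - (A + B) * (p - q) ^+ 2 + 2 * (c * (p - q) * Q)); last first.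
  by rewrite /Q; field.
have hd : c * (p - q) * Q <= C * T * (p - q) ^+ 2 / 2.
  apply: (le_trans (ler_norm _)); rewrite !normrM.
  rewrite -(real_normK (num_real (p - q))).
  have : `|c| * (`|p - q| * `|Q|) <= C * (`|p - q| * (T * `|p - q| / 2)).
    by rewrite ler_pM ?mulr_ge0// ler_wpM2l.
  lra.
have hE : 0 <= A * p ^+ 2 + B * q ^+ 2.
  by rewrite addr_ge0// mulr_ge0 ?sqr_ge0// ltW.
have hs : 0 <= (p - q) ^+ 2 by exact: sqr_ge0.
case: hMT => [h|[h1 h2]].
  have h' : C * T <= A + B.
    have : (C + 1) * T <= (A + B).
      by rewrite mulrC -ler_pdivlMr; [rewrite mulrC|lra].
    by apply: le_trans; rewrite mulrDl mul1r lerDl ltW.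
  have := ler_wpM2r hs h'.
  have : 0 <= (2 * C * M + 1) * (A * p ^+ 2 + B * q ^+ 2).
    by rewrite mulr_ge0// addr_ge0// !mulr_ge0// ltW.
  lra.
have := polar_dichotomy p q A0 B0 M0 (ltW T0) h1 h2.
move=> /(ler_wpM2l C0).
have : 0 <= (A + B) * (p - q) ^+ 2 by rewrite mulr_ge0// addr_ge0// ltW.
lra.
Qed.

(** Replaces a Lipschitz bound, which fails near the axes. By the dichotomy at [A = a + a'],
    [B = b + b'], either the mean is negligible against [A + B], or it is at most [M * A] and
    [M * B] and its variation is controlled by the differences. *)
Lemma logmean_modulus (e : R) : 0 < e -> exists2 M : R, 0 < M &
  forall a a' b b', 0 < a -> 0 < a' -> 0 < b -> 0 < b' ->
  `|logmean a b - logmean a' b'| <=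
    e * (a + a' + (b + b')) + M * (`|a - a'| + `|b - b'|).
Proof.
move=> e0; have [M M0 hM] := logmean_dichotomy e0; exists M => //.
move=> a a' b b' a0 a'0 b0 b'0.
have [A [p [A0 hp ea ea']]] := half_polar a0 a'0.
have [B [q [B0 hq eb eb']]] := half_polar b0 b'0.
have -> : a + a' + (b + b') = A + B by rewrite ea ea' eb eb'; field.
have -> : `|a - a'| = A * `|p|.
  by rewrite -[X in X * _](gtr0_norm A0) -normrM; congr (`|_|); rewrite ea ea'; field.
have -> : `|b - b'| = B * `|q|.
  by rewrite -[X in X * _](gtr0_norm B0) -normrM; congr (`|_|); rewrite eb eb'; field.
rewrite ea ea' eb eb'.
have := logmean_polar A0 B0 hp hq; rewrite /=.
set T1 := logmean (_ * A) ((1 + q) / 2 * B).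
set T2 := logmean (_ * A) ((1 - q) / 2 * B); set T := logmean A B => hT.
have T0 : 0 < T by exact: logmean_gt0.
have hMT := hM A B A0 B0; rewrite -/T in hMT; clearbody T T1 T2.
move: hp hq => /andP[p1 p2] /andP[q1 q2].
have hd : `|T1 - T2| <= T /\ `|T1 - T2| <= T * (`|p| + `|q|).
  have n1 := ler_norm p; have n2 := ler_norm q.
  have n3 := ler_norm (- p); have n4 := ler_norm (- q).
  rewrite !normrN in n3 n4.
  have d1 : `|p| < 1 by rewrite ltr_norml p1 p2.
  have d2 : `|q| < 1 by rewrite ltr_norml q1 q2.
  have n5 : 0 <= `|p| by []. have n6 : 0 <= `|q| by [].
  rewrite !ler_norml.
  case: hT => -[pq [h1 h2 h3 h4]]; split; apply/andP; split; nra.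
case: hd => hd1 hd2.
case: hMT => [h|[h1 h2]].
  have : 0 <= M * (A * `|p| + B * `|q|).
    by rewrite mulr_ge0 ?addr_ge0// ?mulr_ge0// ltW.
  by lra.
have : 0 <= e * (A + B) by rewrite mulr_ge0 ?addr_ge0// ltW.
have := ler_wpM2r (normr_ge0 p) h1; have := ler_wpM2r (normr_ge0 q) h2.
lra.
Qed.

End Edge.

(** * Absolutely convergent sums over vertices and edges *)

Section Series.
Context {R : realType}.
Implicit Types (u v f : nat -> R) (c e : R).

(** Absolute summability with an explicit bound, so that estimates stay inequalities between
    reals. *)
Definition absum_le u c := forall N, \sum_(0 <= i < N) `|u i| <= c.

Lemma le_sum_nat f g m n : (forall i, (m <= i < n)%N -> f i <= g i) ->
  \sum_(m <= i < n) f i <= \sum_(m <= i < n) g i :> R.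
Proof. by move=> h; rewrite big_nat [leRHS]big_nat; exact: ler_sum. Qed.

Lemma norm_sum_nat f m n :
  `|\sum_(m <= i < n) f i| <= \sum_(m <= i < n) `|f i| :> R.
Proof. exact: ler_norm_sum. Qed.

Lemma le_sum_widen f m n : (m <= n)%N -> (forall i, 0 <= f i) ->
  \sum_(0 <= i < m) f i <= \sum_(0 <= i < n) f i.
Proof.
move=> mn h; rewrite (big_cat_nat (leq0n _) mn)//= lerDl.
by apply: sumr_ge0 => i _; exact: h.
Qed.

Lemma nneseries_leP f c : (forall i, 0 <= f i) ->
  (\sum_(i <oo) (f i)%:E <= c%:E)%E <-> forall N, \sum_(0 <= i < N) f i <= c.
Proof.
move=> f0; split=> [h N|h].
  rewrite -lee_fin; apply: le_trans h; rewrite -sumEFin.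
  by apply: nneseries_lim_ge => i _ _; rewrite lee_fin.
apply: lime_le; first by apply: is_cvg_nneseries => i _ _; rewrite lee_fin.
by apply: nearW => N; rewrite sumEFin lee_fin.
Qed.

Lemma nneseries_finP f : (forall i, 0 <= f i) ->
  (\sum_(i <oo) (f i)%:E < +oo)%E <->
  exists c, forall N, \sum_(0 <= i < N) f i <= c.
Proof.
move=> f0; split=> [h|[c] /(nneseries_leP c f0) h].
  exists (fine (\sum_(i <oo) (f i)%:E)%E); apply/(nneseries_leP _ f0).
  rewrite fineK// ge0_fin_numE//.
  by apply: nneseries_ge0 => i _ _; rewrite lee_fin.
by apply: le_lt_trans h _; rewrite ltry.
Qed.

Lemma vsummableP u : vsummable u <-> exists c, absum_le u c.
Proof. exact: nneseries_finP. Qed.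

Lemma absum_le_le u v c : (forall i, `|u i| <= `|v i|) ->
  absum_le v c -> absum_le u c.
Proof.
by move=> h hv N; apply: le_trans (hv N); apply: le_sum_nat => i _; exact: h.
Qed.

Lemma absum_leW u c c' : c <= c' -> absum_le u c -> absum_le u c'.
Proof. by move=> h hu N; exact: le_trans (hu N) h. Qed.

Lemma absum_leD u v c c' : absum_le u c -> absum_le v c' ->
  absum_le (fun i => u i + v i) (c + c').
Proof.
move=> hu hv N; apply: le_trans (lerD (hu N) (hv N)).
by rewrite -big_split/=; apply: le_sum_nat => i _; exact: ler_normD.
Qed.

Lemma absum_leN u c : absum_le u c -> absum_le (fun i => - u i) c.
Proof. by apply: absum_le_le => i; rewrite normrN. Qed.

Lemma absum_leB u v c c' : absum_le u c -> absum_le v c' ->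
  absum_le (fun i => u i - v i) (c + c').
Proof. by move=> hu /absum_leN; exact: absum_leD. Qed.

Lemma absum_leZ u c k : absum_le u c -> absum_le (fun i => k * u i) (`|k| * c).
Proof.
move=> hu N; apply: le_trans (ler_wpM2l (normr_ge0 k) (hu N)).
by rewrite mulr_sumr; apply: le_sum_nat => i _; rewrite normrM.
Qed.

Lemma absum_le_ge0 u c : absum_le u c -> 0 <= c.
Proof. by move=> /(_ 0%N); rewrite big_geq. Qed.

Lemma cvg_psum (T : Type) (F : set_system T) (u : T -> nat -> R) v N : Filter F ->
  (forall i, u t i @[t --> F] --> v i) ->
  \sum_(0 <= i < N) u t i @[t --> F] --> \sum_(0 <= i < N) v i.
Proof.
move=> FF h; elim: N => [|N IH].
  rewrite big_geq//; under eq_cvg do rewrite big_geq//; exact: cvg_cst.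
by rewrite big_nat_recr//=; under eq_cvg do rewrite big_nat_recr//=; exact: cvgD.
Qed.

(** Fatou's lemma in its simplest form: finite partial sums pass to pointwise limits. *)
Lemma absum_lim (u : nat -> nat -> R) v c :
  (forall i, u n i @[n --> \oo] --> v i) ->
  (\forall n \near \oo, absum_le (u n) c) -> absum_le v c.
Proof.
move=> uv hu N.
have : \sum_(0 <= i < N) `|u n i| @[n --> \oo] --> \sum_(0 <= i < N) `|v i|.
  by apply: (@cvg_psum _ _ (fun n i => `|u n i|)) => i; exact: cvg_norm.
move=> h; apply: (cvgr_to_le h); near=> n.
by have /(_ N) : absum_le (u n) c by near: n.
Unshelve. all: by end_near. Qed.

Lemma absum_le_cvg u c : absum_le u c -> cvgn (series u).
Proof.
move=> h; apply: normed_cvg; apply: nondecreasing_is_cvgn.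
  by move=> m n mn; rewrite /series/= le_sum_widen.
by exists c => _ [N _ <-]; exact: h.
Qed.

Lemma vsum_lim u c : absum_le u c -> series u @ \oo --> vsum u.
Proof. by move=> /absum_le_cvg. Qed.

Lemma vsum_ext u v : (forall i, u i = v i) -> vsum u = vsum v.
Proof. by move=> h; congr vsum; apply/funext. Qed.

Lemma vsumD u v c c' : absum_le u c -> absum_le v c' ->
  vsum (fun i => u i + v i) = vsum u + vsum v.
Proof. by move=> /absum_le_cvg hu /absum_le_cvg hv; exact: lim_seriesD. Qed.

Lemma vsumZ u c k : absum_le u c -> vsum (fun i => k * u i) = k * vsum u.
Proof. by move=> /absum_le_cvg hu; exact: lim_seriesZ. Qed.

Lemma vsumN u c : absum_le u c -> vsum (fun i => - u i) = - vsum u.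
Proof. by move=> /absum_le_cvg hu; exact: lim_seriesN. Qed.

Lemma vsumB u v c c' : absum_le u c -> absum_le v c' ->
  vsum (fun i => u i - v i) = vsum u - vsum v.
Proof. by move=> /absum_le_cvg hu /absum_le_cvg hv; exact: lim_seriesB. Qed.

Lemma vsum_le u v c c' : absum_le u c -> absum_le v c' ->
  (forall i, u i <= v i) -> vsum u <= vsum v.
Proof.
move=> /absum_le_cvg hu /absum_le_cvg hv h; apply: lim_series_le => //.
Qed.

Lemma vsum_le_near u c k : absum_le u c ->
  (\forall N \near \oo, \sum_(0 <= i < N) u i <= k) -> vsum u <= k.
Proof. by move=> /vsum_lim h1 h2; exact: cvgr_to_le h1 h2. Qed.

Lemma vsum_ge_near u c k : absum_le u c ->
  (\forall N \near \oo, k <= \sum_(0 <= i < N) u i) -> k <= vsum u.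
Proof. by move=> /vsum_lim h1 h2; exact: cvgr_to_ge h1 h2. Qed.

Lemma vsum_norm_le u c : absum_le u c -> `|vsum u| <= c.
Proof.
move=> h; rewrite ler_norml; apply/andP; split.
  apply: (vsum_ge_near h); apply: nearW => N.
  have := le_trans (norm_sum_nat u 0 N) (h N).
  by rewrite ler_norml => /andP[].
apply: (vsum_le_near h); apply: nearW => N.
by have := le_trans (norm_sum_nat u 0 N) (h N); rewrite ler_norml => /andP[].
Qed.

Lemma sum_le_vsum u c N : absum_le u c -> (forall i, 0 <= u i) ->
  \sum_(0 <= i < N) u i <= vsum u.
Proof.
move=> h u0; apply: (vsum_ge_near h); near=> M; apply: le_sum_widen => //.
by near: M; exists N.
Unshelve. all: by end_near. Qed.

Lemma absum_le_vsum u c : absum_le u c -> (forall i, 0 <= u i) ->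
  absum_le u (vsum u).
Proof.
move=> h u0 N; rewrite (eq_bigr u); last by move=> i _; rewrite ger0_norm.
exact: sum_le_vsum h u0.
Qed.

Lemma vsum_ge0 u : (forall i, 0 <= u i) -> 0 <= vsum u.
Proof.
move=> u0; have [h|h] := pselect (cvgn (series u)).
  by apply: (cvgr_to_ge h); apply: nearW => N; exact: sumr_ge0.
by rewrite /vsum dvgP.
Qed.

Lemma sum_fin_support u N M : (N <= M)%N ->
  (forall i, (N <= i)%N -> u i = 0) ->
  \sum_(0 <= i < M) u i = \sum_(0 <= i < N) u i.
Proof.
move=> NM h; rewrite (big_cat_nat (leq0n _) NM)/= [X in _ + X]big_nat [X in _ + X]big1 ?addr0//.
by move=> i /andP[/h].
Qed.

Lemma absum_fin_support u N : (forall i, (N <= i)%N -> u i = 0) ->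
  absum_le u (\sum_(0 <= i < N) `|u i|).
Proof.
move=> h M; have [MN|/ltnW NM] := leqP M N; first exact: le_sum_widen.
by rewrite (sum_fin_support NM)// => i /h ->; rewrite normr0.
Qed.

Lemma vsum_fin_support u N : (forall i, (N <= i)%N -> u i = 0) ->
  vsum u = \sum_(0 <= i < N) u i.
Proof.
move=> h; have hs := absum_fin_support h.
apply/eqP; rewrite eq_le; apply/andP; split.
  by apply: (vsum_le_near hs); exists N => // M /= NM; rewrite (sum_fin_support NM).
by apply: (vsum_ge_near hs); exists N => // M /= NM; rewrite (sum_fin_support NM).
Qed.

Lemma absum_tail u c e : absum_le u c -> 0 < e ->
  exists N, forall M, \sum_(N <= i < M) `|u i| <= e.
Proof.
move=> h e0; have hv := @absum_le_vsum (fun i => `|u i|) c.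
have h' : absum_le (fun i => `|u i|) c by apply: absum_le_le h => i; rewrite normr_id.
have := vsum_lim h' => /cvgrPdist_le/(_ _ e0)[N _ hN].
exists N => M; have [MN|/ltnW NM] := leqP M N; first by rewrite big_geq// ltW.
have h2 := sum_le_vsum M h' (fun i => normr_ge0 (u i)).
rewrite (big_cat_nat (leq0n _) NM)//= in h2.
have := hN N (leqnn N); rewrite /series/= => /(le_trans (ler_norm _)).
lra.
Qed.

Lemma sum_cut u N M : (N <= M)%N ->
  \sum_(0 <= i < M) u i = \sum_(0 <= i < N) u i + \sum_(N <= i < M) u i.
Proof. by move=> NM; rewrite (big_cat_nat (leq0n _) NM). Qed.

(** Dominated convergence when every term is eventually equal to its limit, as happens for
    truncations at growing heights. *)
Lemma vsum_eventually (u : nat -> nat -> R) v d c e : absum_le d c -> 0 < e ->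
  (forall M i, `|u M i| <= `|d i|) ->
  (forall i, \forall M \near \oo, u M i = v i) ->
  \forall M \near \oo, `|vsum (u M) - vsum v| <= e.
Proof.
move=> hd e0 hud hev.
have hvd i : `|v i| <= `|d i|.
  by have [M _ /(_ M (leqnn M)) <-] := hev i.
have e20 : 0 < e / 2 by rewrite divr_gt0.
have [N hN] := absum_tail hd e20.
have hfin : \forall M \near \oo, forall i, (i < N)%N -> u M i = v i.
  elim: N {hN} => [|N IH]; first by apply: nearW.
  near=> M => i; rewrite ltnS leq_eqVlt => /predU1P[->|].
    by near: M; exact: hev.
  by move: i; near: M.
near=> M.
have hM : forall i, (i < N)%N -> u M i = v i by near: M.
have hu : absum_le (u M) c by apply: absum_le_le hd.
rewrite -(vsumB hu (absum_le_le hvd hd)); apply: vsum_norm_le => K.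
have [KN|/ltnW NK] := leqP K N.
  rewrite big_nat big1 ?ltW// => i /andP[_ iK].
  by rewrite hM ?subrr ?normr0// (leq_trans iK).
rewrite (sum_cut _ NK) big_nat big1 ?add0r; last first.
  by move=> i /andP[_ iN]; rewrite hM// subrr normr0.
apply: (@le_trans _ _ (\sum_(N <= i < K) (2 * `|d i|))).
  apply: le_sum_nat => i _; apply: le_trans (ler_normB _ _) _.
  by have := hud M i; have := hvd i; lra.
by rewrite -mulr_sumr; have := hN K; lra.
Unshelve. all: by end_near. Qed.

End Series.

(** * Sums over the oriented edges of a locally finite weighted graph *)

Section EdgeSum.
Context {R : realType}.
Variables (w : nat -> nat -> R) (b : nat -> nat).
Hypotheses (w_sym : forall i j, w i j = w j i) (w_ge0 : forall i j, 0 <= w i j)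
  (w_row : forall i j, (b i <= j)%N -> w i j = 0).
Implicit Types (X : nat -> nat -> R) (c : R).

(** [b i] lies beyond all neighbours of [i], so the range covers the neighbourhood; the other
    indices in it carry weight zero. *)
Definition rowsum X i := \sum_(0 <= j < b i) w i j * X i j.

Definition flux_le X c := absum_le (rowsum (fun i j => `|X i j|)) c.

Lemma rowsum_widen X i M : (b i <= M)%N ->
  rowsum X i = \sum_(0 <= j < M) w i j * X i j.
Proof.
move=> h; rewrite [RHS](sum_fin_support h)// => j /w_row ->.
by rewrite mul0r.
Qed.

Lemma rowsum_ge0 X i : (forall j, 0 <= X i j) -> 0 <= rowsum X i.
Proof. by move=> h; apply: sumr_ge0 => j _; rewrite mulr_ge0. Qed.

Lemma rowsum_le X Y i : (forall j, 0 < w i j -> X i j <= Y i j) ->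
  rowsum X i <= rowsum Y i.
Proof.
move=> h; apply: le_sum_nat => j _.
have := w_ge0 i j; rewrite le_eqVlt => /predU1P[<-|wp]; first by rewrite !mul0r.
by rewrite ler_pM2l// h.
Qed.

Lemma rowsum_ext X Y i : (forall j, 0 < w i j -> X i j = Y i j) ->
  rowsum X i = rowsum Y i.
Proof.
by move=> h; apply/eqP; rewrite eq_le !rowsum_le// => j /h ->.
Qed.

Lemma rowsumD X Y i :
  rowsum (fun i j => X i j + Y i j) i = rowsum X i + rowsum Y i.
Proof. by rewrite -big_split/=; apply: eq_bigr => j _; rewrite mulrDr. Qed.

Lemma rowsumB X Y i :
  rowsum (fun i j => X i j - Y i j) i = rowsum X i - rowsum Y i.
Proof.
by rewrite /rowsum -sumrB; apply: eq_bigr => j _; rewrite mulrBr.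
Qed.

Lemma rowsumZ k X i : rowsum (fun i j => k i * X i j) i = k i * rowsum X i.
Proof. by rewrite mulr_sumr; apply: eq_bigr => j _; rewrite mulrCA. Qed.

Lemma rowsum_norm X i : `|rowsum X i| <= rowsum (fun i j => `|X i j|) i.
Proof.
apply: le_trans (norm_sum_nat _ _ _) _; apply: le_sum_nat => j _.
by rewrite normrM ger0_norm.
Qed.

Lemma absum_rowsum X c : flux_le X c -> absum_le (rowsum X) c.
Proof.
apply: absum_le_le => i; rewrite [leRHS]ger0_norm ?rowsum_ge0//.
exact: rowsum_norm.
Qed.

Lemma flux_le_le X Y c : (forall i j, 0 < w i j -> `|X i j| <= `|Y i j|) ->
  flux_le Y c -> flux_le X c.
Proof.
move=> h; apply: absum_le_le => i.
by rewrite !ger0_norm ?rowsum_ge0// rowsum_le// => j /h.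
Qed.

Lemma flux_leD X Y c c' : flux_le X c -> flux_le Y c' ->
  flux_le (fun i j => X i j + Y i j) (c + c').
Proof.
move=> hX hY; apply: absum_le_le (absum_leD hX hY) => i.
rewrite -rowsumD !ger0_norm ?rowsum_ge0//.
by apply: rowsum_le => j _; exact: ler_normD.
Qed.

Lemma flux_leN X c : flux_le X c -> flux_le (fun i j => - X i j) c.
Proof. by apply: flux_le_le => i j _; rewrite normrN. Qed.

Lemma flux_leB X Y c c' : flux_le X c -> flux_le Y c' ->
  flux_le (fun i j => X i j - Y i j) (c + c').
Proof. by move=> hX /flux_leN; exact: flux_leD. Qed.

Lemma flux_leZ k X c : flux_le X c -> flux_le (fun i j => k * X i j) (`|k| * c).
Proof.
move=> /(absum_leZ k); apply: absum_le_le => i.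
rewrite normrM !(@ger0_norm _ (rowsum _ _)) ?rowsum_ge0//.
rewrite -(rowsumZ (fun=> `|k|)); apply: rowsum_le => j _.
by rewrite normrM.
Qed.

Lemma flux_le_mul (g : nat -> nat -> R) X c k : (forall i j, `|g i j| <= k) ->
  flux_le X c -> flux_le (fun i j => g i j * X i j) (k * c).
Proof.
move=> h /(flux_leZ k); have k0 : 0 <= k by apply: le_trans (h 0%N 0%N).
rewrite (ger0_norm k0); apply: flux_le_le => i j _.
by rewrite !normrM (ger0_norm k0) ler_wpM2r.
Qed.

(** The first [N] rows meet finitely many columns, so the order of summation is exchanged within a
    finite block. *)
Lemma flux_le_sym X c : flux_le X c -> flux_le (fun i j => X j i) c.
Proof.
move=> h N.
rewrite (eq_bigr (fun i => rowsum (fun i j => `|X j i|) i)); last first.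
  by move=> i _; rewrite ger0_norm ?rowsum_ge0.
pose M := \max_(i < N) b i.
rewrite big_nat (eq_bigr (fun i => \sum_(0 <= j < M) w i j * `|X j i|)); last first.
  move=> i /andP[_ iN]; apply: rowsum_widen.
  exact: (leq_bigmax (Ordinal iN)).
rewrite -big_nat exchange_big/=; apply: le_trans (h M).
apply: le_sum_nat => j _; rewrite ger0_norm ?rowsum_ge0//.
rewrite (@rowsum_widen _ _ (maxn N (b j))) ?leq_maxr//.
rewrite (eq_bigr (fun i => w j i * `|X j i|)); last by move=> i _; rewrite w_sym.
apply: le_sum_widen; first exact: leq_maxl.
by move=> i; rewrite mulr_ge0.
Qed.

(** Summation by parts without boundary term. On a square block the two orientations of each edge
    are paired and give a nonpositive sum; only rows of large index are cut by the block, and the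
    tail of the absolutely convergent series bounds them. *)
Lemma edge_sum_le0 X c : flux_le X c ->
  (forall i j, 0 < w i j -> X i j + X j i <= 0) -> vsum (rowsum X) <= 0.
Proof.
move=> hX hs; apply/ler_addgt0Pl => e e0; rewrite addr0.
have [N hN] := absum_tail hX e0.
apply: (vsum_le_near (absum_rowsum hX)).
(* [B] exceeds every neighbour of the first [N] vertices, so those rows lie entirely inside the
   block. *)
pose B := maxn N (\max_(i < N) b i); exists B => // M /= BM.
have NM : (N <= M)%N by apply: leq_trans BM; exact: leq_maxl.
have bM i : (i < N)%N -> (b i <= M)%N.
  move=> iN; apply: leq_trans BM; apply: leq_trans (leq_maxr _ _).
  exact: (leq_bigmax (Ordinal iN)).
pose Z i j := w i j * X i j.
have sq : \sum_(0 <= i < M) \sum_(0 <= j < M) Z i j <= 0.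
  have : \sum_(0 <= i < M) \sum_(0 <= j < M) Z i j +
         \sum_(0 <= i < M) \sum_(0 <= j < M) Z j i <= 0.
    rewrite -big_split/=; apply: sumr_le0 => i _.
    rewrite -big_split/=; apply: sumr_le0 => j _.
    rewrite /Z (w_sym j i) -mulrDr.
    have := w_ge0 i j; rewrite le_eqVlt => /predU1P[<-|wp]; first by rewrite mul0r.
    by rewrite pmulr_rle0// hs.
  by rewrite [X in _ + X]exchange_big/=; lra.
have row i : rowsum X i <= \sum_(0 <= j < M) Z i j +
    (if (i < N)%N then 0 else rowsum (fun i j => `|X i j|) i).
  case: ifPn => iN; first by rewrite addr0 (rowsum_widen _ (bM _ iN)).
  have [biM|/ltnW Mb] := leqP (b i) M.
    by rewrite (rowsum_widen _ biM) lerDl rowsum_ge0.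
  rewrite /rowsum (sum_cut _ Mb) lerD2l (sum_cut _ Mb).
  have h : \sum_(M <= j < b i) w i j * X i j <= \sum_(M <= j < b i) w i j * `|X i j|.
    by apply: le_sum_nat => j _; rewrite ler_wpM2l// ler_norm.
  apply: (le_trans h); rewrite lerDr; apply: sumr_ge0 => j _.
  by rewrite mulr_ge0.
apply: le_trans (le_sum_nat (fun i _ => row i)) _.
rewrite big_split/= -[leRHS]add0r; apply: lerD => //.
rewrite (sum_cut _ NM) big_nat big1 ?add0r; last first.
  by move=> i /andP[_ ->].
apply: le_trans (hN M); rewrite big_nat [leRHS]big_nat; apply: ler_sum => i /andP[Ni _].
by rewrite ltnNge Ni/= ler_norm.
Qed.

Lemma edge_sum_eq0 X c : flux_le X c ->
  (forall i j, 0 < w i j -> X i j + X j i = 0) -> vsum (rowsum X) = 0.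
Proof.
move=> hX hs; apply/eqP; rewrite eq_le (edge_sum_le0 hX)/=; last first.
  by move=> i j /hs ->.
rewrite -oppr_le0 -(vsumN (absum_rowsum hX)).
have -> : (fun i => - rowsum X i) = rowsum (fun i j => - X i j).
  apply/funext => i; rewrite /rowsum -sumrN; apply: eq_bigr => j _.
  by rewrite mulrN.
apply: (edge_sum_le0 (flux_leN hX)) => i j /hs; lra.
Qed.

End EdgeSum.

(** * The Fokker-Planck equation in l^1 *)

Section Graph.
Context {R : realType}.
Variable G : wgraph R.
Hypothesis hG : weighted_graph G.

Local Notation w := (wt G).
Local Notation mu := (vmeas G).

Lemma exists_row_bound : locally_unif_finite G ->
  exists b : nat -> nat, forall i j, adj G i j -> (j < b i)%N.
Proof.
move=> [C _ hC].
have h i : exists b : nat, forall j, adj G i j -> (j < b)%N.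
  have : finite_set (nbr G i) by apply: card_le_finite (hC i) _; exact: finite_II.
  move=> /finite_seqP[s hs]; exists (\max_(j <- s) j).+1 => j ij.
  have : nbr G i j by [].
  rewrite hs/= => js; rewrite ltnS; exact: leq_bigmax_seq.
by exists (fun i => projT1 (cid (h i))) => i j; case: cid => /= b; exact.
Qed.

Variable b : nat -> nat.
Hypothesis hb : forall i j, adj G i j -> (j < b i)%N.

Lemma wt_ge0 i j : 0 <= w i j.
Proof.
by have [/(wt_pos hG)/ltW//|/(wt_zero hG) ->] := boolP (adj G i j).
Qed.

Lemma adjE i j : adj G i j = (0 < w i j).
Proof.
by have [/(wt_pos hG)->//|/(wt_zero hG) ->] := boolP (adj G i j); rewrite ltxx.
Qed.

Lemma wt_row i j : (b i <= j)%N -> w i j = 0.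
Proof.
by move=> h; apply: (wt_zero hG); apply: contraL h => /hb; rewrite -ltnNge.
Qed.

Lemma nbr_sumE i (f : nat -> R) : (forall j, ~~ adj G i j -> f j = 0) ->
  \sum_(j \in nbr G i) f j = \sum_(0 <= j < b i) f j.
Proof.
move=> h; rewrite /index_iota (@fsbig_seq _ _ _ _ _ _ (iota_uniq 0 (b i - 0))).
apply: fsbig_widen.
  by move=> j /= /hb; rewrite mem_iota subn0.
by move=> j [_ /= /negP/h].
Qed.

Local Notation rsum := (rowsum w b).

Lemma vmeasE i : mu i = \sum_(0 <= j < b i) w i j.
Proof. by rewrite /vmeas nbr_sumE// => j /(wt_zero hG). Qed.

Lemma vmeas_lbound : exists2 m : R, 0 < m & forall i, m <= mu i.
Proof.
have := vmeas_inf hG; set I := ereal_inf _ => I0.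
have hI i : (I <= (mu i)%:E)%E by apply: ereal_inf_lbound; exists i.
have If : (I \is a fin_num)%E.
  rewrite fin_numE; apply/andP; split; first by rewrite gt_eqF// (lt_trans _ I0)// ltNy0.
  by rewrite lt_eqF//; apply: le_lt_trans (hI 0%N) _; rewrite ltry.
exists (fine I) => [|i]; first by apply: fine_gt0; rewrite I0 -ge0_fin_numE// ltW.
by rewrite -lee_fin fineK.
Qed.

Lemma wt_lbound : exists2 m : R, 0 < m & forall i j, adj G i j -> m <= w i j.
Proof.
have := wt_inf hG; set I := ereal_inf _ => I0.
have hI i j : adj G i j -> (I <= (w i j)%:E)%E.
  by move=> ij; apply: ereal_inf_lbound; exists (i, j).
(* The infimum might a priori be infinite; capping it at 1 yields a real bound in all cases. *)
have [I1|I1] := leP I 1%:E.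
  have If : (I \is a fin_num)%E.
    by rewrite ge0_fin_numE ?(ltW I0)//; exact: le_lt_trans I1 (ltry _).
  exists (fine I) => [|i j /hI]; last by rewrite -lee_fin fineK.
  by apply: fine_gt0; rewrite I0 (le_lt_trans I1) ?ltry.
by exists 1 => // i j /hI/(lt_le_trans I1)/ltW; rewrite lee_fin.
Qed.

Lemma vmeas_gt0 i : 0 < mu i.
Proof. by have [m m0 /(_ i)] := vmeas_lbound; exact: lt_le_trans. Qed.

Lemma vmeas_ge0 i : 0 <= mu i.
Proof. exact/ltW/vmeas_gt0. Qed.

Lemma rsum_cst (f : nat -> R) i : rsum (fun i _ => f i) i = mu i * f i.
Proof. by rewrite vmeasE mulr_suml. Qed.

Lemma nbr_rsumE i (f : nat -> R) : \sum_(j \in nbr G i) w i j / mu i * f j =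
  rsum (fun _ j => f j) i / mu i.
Proof.
rewrite nbr_sumE => [|j /(wt_zero hG) ->]; last by rewrite !mul0r.
by rewrite mulr_suml; apply: eq_bigr => j _; rewrite mulrAC.
Qed.

Definition lflux (rho p : nat -> R) (i j : nat) : R :=
  (p j - p i) * logmean (rho i) (rho j).

Lemma lmeanE (rho : nat -> R) i j : (forall i, 0 < rho i) -> 0 < w i j ->
  lmean G rho i j = logmean (rho i) (rho j).
Proof. by move=> h ij; rewrite /lmean adjE ij !h. Qed.

Lemma gradE (p : nat -> R) i j : 0 < w i j -> grad G p i j = p j - p i.
Proof. by move=> ij; rewrite /grad adjE ij. Qed.

Lemma divGE rho p i : (forall i, 0 < rho i) ->
  mu i * divG G rho (grad G p) i = rsum (lflux rho p) i.
Proof.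
move=> h; rewrite /divG.
under eq_fsbigr do rewrite -mulrA.
rewrite nbr_rsumE mulrC mulfVK ?gt_eqF ?vmeas_gt0//.
apply: (@rowsum_ext _ _ _ wt_ge0) => j ij; by rewrite gradE// lmeanE.
Qed.

Lemma laplacianE rho i :
  mu i * laplacian G rho i = rsum (fun i j => rho j - rho i) i.
Proof.
by rewrite /laplacian nbr_rsumE mulrC mulfVK ?gt_eqF ?vmeas_gt0.
Qed.

Variable Psi : nat -> R.

Definition fpflux (rho : nat -> R) (i j : nat) : R :=
  rho j - rho i + (Psi j - Psi i) * logmean (rho i) (rho j).

Lemma fp_rhsE rho i : (forall i, 0 < rho i) ->
  mu i * fp_rhs G Psi rho i = rsum (fpflux rho) i.
Proof.
move=> h; by rewrite /fp_rhs mulrDr divGE// laplacianE addrC -rowsumD.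
Qed.

(** The defining property of the logarithmic mean, that it turns differences of [ln rho] into
    differences of [rho], merges diffusion and drift into one gradient. *)
Lemma fpflux_lflux rho i j : (forall i, 0 < rho i) ->
  fpflux rho i j = lflux rho (fun i => Psi i + ln (rho i)) i j.
Proof.
move=> h; rewrite /fpflux /lflux -(logmean_mul_ln (h i) (h j)); ring.
Qed.

Lemma fpflux_anti rho i j : fpflux rho j i = - fpflux rho i j.
Proof. by rewrite /fpflux logmeanC; ring. Qed.

Lemma lflux_anti rho p i j : lflux rho p j i = - lflux rho p i j.
Proof. by rewrite /lflux logmeanC; ring. Qed.

Definition l1le (f : nat -> R) (c : R) := absum_le (fun i => mu i * f i) c.

Lemma l1leD f g c c' : l1le f c -> l1le g c' -> l1le (fun i => f i + g i) (c + c').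
Proof.
move=> hf /(absum_leD hf); apply: absum_le_le => i; by rewrite mulrDr.
Qed.

Lemma l1leN f c : l1le f c -> l1le (fun i => - f i) c.
Proof. by apply: absum_le_le => i; rewrite mulrN normrN. Qed.

Lemma l1leB f g c c' : l1le f c -> l1le g c' -> l1le (fun i => f i - g i) (c + c').
Proof. by move=> hf /l1leN; exact: l1leD. Qed.

Lemma l1leZ k f c : l1le f c -> l1le (fun i => k * f i) (`|k| * c).
Proof. by move=> /(absum_leZ k); apply: absum_le_le => i; rewrite mulrCA. Qed.

Lemma l1le_le f g c : (forall i, `|f i| <= `|g i|) -> l1le g c -> l1le f c.
Proof. by move=> h; apply: absum_le_le => i; rewrite !normrM ler_wpM2l. Qed.

Lemma l1le_ext f g c : (forall i, f i = g i) -> l1le g c -> l1le f c.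
Proof. by move=> h; apply: l1le_le => i; rewrite h. Qed.

Lemma l1leW f c c' : c <= c' -> l1le f c -> l1le f c'.
Proof. exact: absum_leW. Qed.

Lemma l1le0 : l1le (fun=> 0) 0.
Proof. by move=> N; rewrite big1// => i _; rewrite mulr0 normr0. Qed.

Lemma l1le_closed f c : (forall e, 0 < e -> l1le f (c + e)) -> l1le f c.
Proof. by move=> h N; apply/ler_addgt0Pr => e /h; exact. Qed.

Lemma l1le_pt f c i : l1le f c -> mu i * `|f i| <= c.
Proof.
move=> /(_ i.+1); apply: le_trans; rewrite big_nat_recr//= normrM.
by rewrite (gtr0_norm (vmeas_gt0 i)) lerDr sumr_ge0.
Qed.

Lemma l1le_lim (u : nat -> nat -> R) f c : (forall i, u n i @[n --> \oo] --> f i) ->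
  (\forall n \near \oo, l1le (u n) c) -> l1le f c.
Proof. by move=> h; apply: absum_lim => i; exact: cvgMr. Qed.

Lemma flux_fst f c : l1le f c -> flux_le w b (fun i _ => f i) c.
Proof.
apply: absum_le_le => i.
by rewrite (rsum_cst (fun i => `|f i|)) !normrM normr_id.
Qed.

Lemma flux_snd f c : l1le f c -> flux_le w b (fun _ j => f j) c.
Proof. by move=> /flux_fst/(flux_le_sym (wt_sym hG) wt_ge0 wt_row). Qed.

(** The densities of [dens0], expressed through real series; see [dens0P]. *)
Definition pdens (rho : nat -> R) :=
  [/\ forall i, 0 < rho i, l1le rho 1 & vsum (fun i => mu i * rho i) = 1].

Lemma flux_of_bound X c k f : 0 <= k -> (forall i, 0 <= f i) -> l1le f c ->
  (forall i j, 0 < w i j -> `|X i j| <= k * (f i + f j)) ->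
  flux_le w b X (k * (2 * c)).
Proof.
move=> k0 f0 hf hX; have := flux_leZ wt_ge0 k (flux_leD wt_ge0 (flux_fst hf) (flux_snd hf)).
have <- : c + c = 2 * c by ring.
rewrite (ger0_norm k0); apply: (flux_le_le wt_ge0) => i j /hX/le_trans; apply.
exact: ler_norm.
Qed.

Variable C : R.
Hypotheses (C_ge0 : 0 <= C) (hC : forall i j, `|grad G Psi i j| <= C).

Lemma grad_Psi i j : 0 < w i j -> `|Psi j - Psi i| <= C.
Proof. by move=> ij; rewrite -gradE. Qed.

Local Notation F := (fp_rhs G Psi).
(** Bound for the l^1 norm of the velocity: [1 + C] for diffusion and drift against [rho i + rho j],
    2 for the ends of an edge, 1 for the mass. *)
Local Notation CF := ((1 + C) * (2 * 1)).

Lemma CF_ge0 : 0 <= CF.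
Proof. by move: C_ge0; lra. Qed.

Lemma fpflux_le rho : pdens rho -> flux_le w b (fpflux rho) CF.
Proof.
move=> [h0 h1 _]; have C1 : 0 <= 1 + C by rewrite addr_ge0.
apply: flux_of_bound h1 _ => // [i|i j ij]; first exact: ltW.
apply: le_trans (ler_normD _ _) _; rewrite normrM mulrDl mul1r; apply: lerD.
  by apply: le_trans (ler_normB _ _) _; rewrite !gtr0_norm// addrC.
apply: ler_pM => //; first exact: grad_Psi.
by rewrite gtr0_norm ?logmean_gt0// logmean_le_add.
Qed.

Lemma fp_l1 rho : pdens rho -> l1le (F rho) CF.
Proof.
move=> h; have := absum_rowsum wt_ge0 (fpflux_le h).
by case: h => h0 _ _; apply: absum_le_le => i; rewrite fp_rhsE.
Qed.

(** [logmean_modulus] summed over the edges: continuity of the velocity in l^1 with a small additive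
    error in place of a Lipschitz estimate. *)
Lemma fp_modulus (e : R) : 0 < e -> exists2 M : R, 0 < M &
  forall rho rho' d, pdens rho -> pdens rho' -> l1le (fun i => rho i - rho' i) d ->
  l1le (fun i => F rho i - F rho' i) (e + M * d).
Proof.
(* The 4 counts two densities of mass one, each seen from both ends of the edges. *)
move=> e0; have e1 : 0 < e / (4 * (C + 1)) by rewrite divr_gt0// mulr_gt0// ltr_wpDl.
have [M M0 hM] := logmean_modulus e1.
exists ((1 + C * M) * 2); first by rewrite mulr_gt0// ltr_pwDl// mulr_ge0// ltW.
move=> r r' d [r0 r1 _] [r'0 r'1 _] hd.
have k0 : 0 <= 1 + C * M by rewrite addr_ge0// mulr_ge0// ltW.
have hd' : l1le (fun i => `|r i - r' i|) d.
  by apply: l1le_le hd => i; rewrite normr_id.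
have k1 : 0 <= C * (e / (4 * (C + 1))) by rewrite mulr_ge0// ltW.
have X1 : flux_le w b (fun i j => (1 + C * M) * (`|r i - r' i| + `|r j - r' j|))
    ((1 + C * M) * (2 * d)).
  apply: flux_of_bound hd' _ => // i j _.
  by rewrite ger0_norm// mulr_ge0// addr_ge0.
have X2 : flux_le w b
    (fun i j => C * (e / (4 * (C + 1))) * (r i + r' i + (r j + r' j)))
    (C * (e / (4 * (C + 1))) * (2 * (1 + 1))).
  have rr i : 0 <= r i + r' i by rewrite addr_ge0// ltW.
  apply: (flux_of_bound k1 rr) (l1leD r1 r'1) _ => i j _.
  by rewrite ger0_norm// mulr_ge0// addr_ge0.
have X3 : flux_le w b (fun i j => fpflux r i j - fpflux r' i j) (e + (1 + C * M) * 2 * d).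
  have := flux_leD wt_ge0 X1 X2; move=> /absum_leW h.
  have /h {h} : (1 + C * M) * (2 * d) + C * (e / (4 * (C + 1))) * (2 * (1 + 1))
      <= e + (1 + C * M) * 2 * d.
    have -> : C * (e / (4 * (C + 1))) * (2 * (1 + 1)) = e * (C / (C + 1)).
      by field; rewrite gt_eqF// ltr_wpDl.
    have : e * (C / (C + 1)) <= e.
      by rewrite ler_piMr ?(ltW e0)// ler_pdivrMr ?ltr_wpDl// mul1r lerDl.
    lra.
  apply: (flux_le_le wt_ge0) => i j ij.
  rewrite [leRHS]ger0_norm; last first.
    by rewrite addr_ge0// mulr_ge0// ?addr_ge0// ltW.
  have -> : fpflux r i j - fpflux r' i j = ((r j - r' j) - (r i - r' i)) +
    (Psi j - Psi i) * (logmean (r i) (r j) - logmean (r' i) (r' j)).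
    by rewrite /fpflux; ring.
  apply: le_trans (ler_normD _ _) _; rewrite normrM.
  have := hM (r i) (r' i) (r j) (r' j) (r0 i) (r'0 i) (r0 j) (r'0 j).
  move=> /(ler_pM (normr_ge0 _) (normr_ge0 _) (grad_Psi ij)).
  have := ler_normB (r j - r' j) (r i - r' i).
  rewrite !mulrDr !mulrDl; lra.
have := absum_rowsum wt_ge0 X3; apply: absum_le_le => i.
by rewrite mulrBr !fp_rhsE// rowsumB.
Qed.

(** The inflow [rho j] absorbs the drift unless the mean is at most [M * rho i], so the loss at a
    vertex is proportional to its own density. This keeps short Euler steps positive. *)
Lemma fp_lower : exists2 K : R, 0 < K &
  forall rho i, (forall i, 0 < rho i) -> - K * rho i <= F rho i.
Proof.
have e0 : 0 < (C + 1)^-1 by rewrite invr_gt0 ltr_wpDl.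
have [M M0 hM] := logmean_dichotomy e0; exists (2 + C * M).
  by rewrite ltr_wpDr// mulr_ge0// ltW.
move=> r i r0; rewrite -(ler_pM2l (vmeas_gt0 i)) fp_rhsE//.
rewrite -(rsum_cst (fun i => - (2 + C * M) * r i)); apply: (@rowsum_le _ _ _ wt_ge0) => j ij.
rewrite /fpflux; set T := logmean _ _.
have T0 : 0 < T by exact: logmean_gt0.
have h : - (C * T) <= (Psi j - Psi i) * T.
  by rewrite -mulNr ler_pM2r//; have := grad_Psi ij; rewrite ler_norml => /andP[].
have r0i := r0 i; have r0j := r0 j.
have hCM : 0 <= C * M * r i by rewrite !mulr_ge0// ltW.
case: (hM (r i) (r j) r0i r0j) => [|[+ _]]; rewrite -/T => hT.
  have : C * T <= r i + r j.
    have : (C + 1) * T <= r i + r j.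
      by rewrite mulrC -ler_pdivlMr ?ltr_wpDl// mulrC.
    lra.
  lra.
have := ler_wpM2l C_ge0 hT; lra.
Qed.

Lemma fp_mass rho : pdens rho -> vsum (fun i => mu i * F rho i) = 0.
Proof.
move=> h; have [h0 _ _] := h.
rewrite (vsum_ext (fun i => fp_rhsE i h0)).
apply: (edge_sum_eq0 (wt_sym hG) wt_ge0 wt_row (fpflux_le h)) => i j _.
by rewrite (fpflux_anti rho i j) subrr.
Qed.

(** Propagates moments: a weight that varies by a bounded factor along edges can be moved from one
    end of the flux to the other. It is meant for the weight [1 + d^2]. *)
Lemma fp_upper : exists2 K : R, 0 < K & forall rho (V : nat -> R) c,
  (forall i, 0 < rho i) -> (forall i, 0 <= V i) ->
  (forall i j, adj G i j -> V i <= 3 * V j) -> l1le (fun i => V i * rho i) c ->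
  l1le (fun i => V i * F rho i) (K * c).
Proof.
exists (3 * (1 + C) * 2); first by rewrite !mulr_gt0// ltr_pwDl.
move=> r V c r0 V0 hV hc.
have rV i : 0 <= V i * r i by rewrite mulr_ge0// ltW.
have k0 : 0 <= 3 * (1 + C) by rewrite mulr_ge0// addr_ge0.
have : flux_le w b (fun i j => V i * fpflux r i j) (3 * (1 + C) * (2 * c)).
  apply: (flux_of_bound k0 rV hc) => i j ij.
  have hf : `|fpflux r i j| <= (1 + C) * (r i + r j).
    apply: le_trans (ler_normD _ _) _; rewrite normrM mulrDl mul1r; apply: lerD.
      by apply: le_trans (ler_normB _ _) _; rewrite !gtr0_norm// addrC.
    apply: ler_pM => //; first exact: grad_Psi.
    by rewrite gtr0_norm ?logmean_gt0// logmean_le_add.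
  rewrite normrM (ger0_norm (V0 i)).
  apply: le_trans (ler_wpM2l (V0 i) hf) _.
  rewrite [X in X <= _]mulrCA -mulrA [X in _ <= X]mulrCA ler_wpM2l ?addr_ge0//.
  have := hV i j; rewrite adjE => /(_ ij)/(ler_wpM2r (ltW (r0 j))).
  have := rV i; lra.
move=> /(absum_rowsum wt_ge0); rewrite [X in absum_le _ X]mulrA.
by apply: absum_le_le => i; rewrite rowsumZ -fp_rhsE// mulrCA.
Qed.

(** * Stability of approximate backward steps *)

Local Notation E a b := (vsum (fun i => mu i * tri (a i) (b i))).

Lemma tri_le_norm (x y : R) : 0 < x -> 0 < y -> `|tri x y| <= `|x - y|.
Proof.
move=> x0 y0; have s0 : 0 < x + y by rewrite addr_gt0.
rewrite /tri normrM normfV (gtr0_norm s0) ler_pdivrMr// normrX.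
by rewrite expr2 ler_wpM2l// ler_norml; lra.
Qed.

Lemma tri_l1 r r' d : (forall i, 0 < r i) -> (forall i, 0 < r' i) ->
  l1le (fun i => r i - r' i) d ->
  l1le (fun i => tri (r i) (r' i)) d.
Proof. by move=> h h'; apply: l1le_le => i; exact: tri_le_norm. Qed.

Lemma pdens_diff r r' : pdens r -> pdens r' -> l1le (fun i => r i - r' i) (1 + 1).
Proof. by move=> [_ h _] [_ h' _]; exact: l1leB. Qed.

(** Young's inequality [|x| <= x^2 / (2 s A) + s A / 2] with [A = r i + r' i], summed against total
    mass 2, replaces Cauchy-Schwarz for series; it gives [3 s / 2]. *)
Lemma l1_of_tri r r' s : pdens r -> pdens r' -> 0 < s -> E r r' <= s ^+ 2 ->
  l1le (fun i => r i - r' i) (2 * s).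
Proof.
move=> hr hr' s0 hE.
have [r0 r1 _] := hr; have [r'0 r'1 _] := hr'.
have hs := tri_l1 r0 r'0 (pdens_diff hr hr').
have hs' : l1le (fun i => tri (r i) (r' i)) (s ^+ 2).
  apply: absum_leW hE _; apply: (absum_le_vsum hs) => i.
  by rewrite mulr_ge0 ?tri_ge0// ltW// vmeas_gt0.
have := l1leD (l1leZ (2 * s)^-1 hs') (l1leZ (s / 2) (l1leD r1 r'1)).
rewrite !gtr0_norm ?invr_gt0 ?mulr_gt0// => /l1leW h.
have /h {h} : (2 * s)^-1 * s ^+ 2 + s / 2 * (1 + 1) <= 2 * s.
  have -> : (2 * s)^-1 * s ^+ 2 = s / 2 by field; rewrite gt_eqF.
  lra.
apply: l1le_le => i; rewrite /tri; set A := r i + r' i.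
have A0 : 0 < A by rewrite addr_gt0.
set x := r i - r' i; apply: le_trans (ler_norm _).
rewrite -subr_ge0 -(real_normK (num_real x)).
have -> : (2 * s)^-1 * (`|x| ^+ 2 / A) + s / 2 * A - `|x| =
   (`|x| - s * A) ^+ 2 / (2 * s * A) by field; rewrite !gt_eqF.
by rewrite divr_ge0 ?sqr_ge0// !mulr_ge0// ltW.
Qed.

(** A backward Euler step of length [h] with defect [e] per unit of time. The velocity is taken at
    the new point [a'], where [tri_tangent] linearises. *)
Definition fp_step (e h : R) (a a' : nat -> R) :=
  l1le (fun i => a' i - a i - h * F a' i) (e * h).

Lemma l1le_bmul f g c : (forall i, `|f i| <= 3) -> l1le g c ->
  l1le (fun i => f i * g i) (3 * c).
Proof.
move=> h hg; have := l1leZ 3 hg; rewrite ger0_norm//; apply: l1le_le => i.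
by rewrite !normrM (ger0_norm (_ : 0 <= 3))// ler_wpM2r.
Qed.

(** The tangent inequality at [(a', c')] splits the increment of [E] into a dissipation, bounded
    edge by edge with [edge_stability], and two defects, each multiplied by a derivative of size at
    most 3; hence the 6. *)
Lemma fp_stability : exists2 K : R, 0 < K &
  forall e h a a' c c', 0 <= h -> pdens a -> pdens a' -> pdens c -> pdens c' ->
  fp_step e h a a' -> fp_step e h c c' ->
  (1 - K * h) * E a' c' <= E a c + 6 * (e * h).
Proof.
have [K K0 hK] := edge_stability C_ge0; exists K => //.
move=> e h a a' c c' h0 ha ha' hc hc' sa sc.
have [a0 _ _] := ha; have [a'0 _ _] := ha'.
have [c0 _ _] := hc; have [c'0 _ _] := hc'.
pose g i := dtri (a' i) (c' i); pose g' i := dtri (c' i) (a' i).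
have gb i : `|g i| <= 3 by exact: dtri_bound.
have g'b i : `|g' i| <= 3 by exact: dtri_bound.
have sE := tri_l1 a0 c0 (pdens_diff ha hc).
have sE' := tri_l1 a'0 c'0 (pdens_diff ha' hc').
pose D i := g i * F a' i + g' i * F c' i.
have sD : l1le D (3 * CF + 3 * CF).
  by apply: l1leD; apply: l1le_bmul => //; exact: fp_l1.
pose S i := g i * (a' i - a i - h * F a' i) + g' i * (c' i - c i - h * F c' i).
have sS : l1le S (3 * (e * h) + 3 * (e * h)).
  by apply: l1leD; apply: l1le_bmul.
(* Spreading [K * tri] at each vertex over its edges, whose weights add up to [mu i], leaves on each
   edge the right-hand side of [edge_stability]. *)
have dis : vsum (fun i => mu i * D i) - K * E a' c' <= 0.
  have sK := l1leZ K sE'.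
  rewrite -(vsumZ K sE') -(vsumB sD (absum_leZ K sE')).
  pose X i j := g i * fpflux a' i j + g' i * fpflux c' i j - K * tri (a' i) (c' i).
  have eX i : mu i * D i - K * (mu i * tri (a' i) (c' i)) = rsum X i.
    have e1 := rsum_cst (fun i => K * tri (a' i) (c' i)) i.
    by rewrite rowsumB rowsumD e1 !rowsumZ -!fp_rhsE// /D; ring.
  rewrite (vsum_ext eX).
  have hX := flux_leB wt_ge0 (flux_leD wt_ge0
    (flux_le_mul wt_ge0 (fun i _ => gb i) (fpflux_le ha'))
    (flux_le_mul wt_ge0 (fun i _ => g'b i) (fpflux_le hc'))) (flux_fst sK).
  apply: (edge_sum_le0 (wt_sym hG) wt_ge0 wt_row hX) => i j ij.
  have := hK (a' i) (c' i) (a' j) (c' j) (Psi j - Psi i)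
    (a'0 i) (c'0 i) (a'0 j) (c'0 j) (grad_Psi ij).
  rewrite -/(fpflux a' i j) -/(fpflux c' i j) -/(g i) -/(g j) -/(g' i) -/(g' j).
  rewrite /X (fpflux_anti a' i j) (fpflux_anti c' i j); lra.
have : E a' c' <= E a c + h * vsum (fun i => mu i * D i) + vsum (fun i => mu i * S i).
  rewrite -(vsumZ h sD) -(vsumD sE (absum_leZ h sD)) -(vsumD (absum_leD sE (absum_leZ h sD)) sS).
  apply: (vsum_le sE' (absum_leD (absum_leD sE (absum_leZ h sD)) sS)) => i.
  have := tri_tangent (a0 i) (c0 i) (a'0 i) (c'0 i).
  rewrite -/(g i) -/(g' i) => /(ler_wpM2l (ltW (vmeas_gt0 i)))/le_trans; apply.
  by rewrite /D /S le_eqVlt; apply/orP; left; apply/eqP; ring.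
have : vsum (fun i => mu i * S i) <= 6 * (e * h).
  by apply: le_trans (ler_norm _) (le_trans (vsum_norm_le sS) _); lra.
have := ler_wpM2l h0 dis; lra.
Qed.

(** * The explicit Euler scheme *)

Section Euler.
Variable K : R.
Hypotheses (K_gt0 : 0 < K) (lowK : forall (rho : nat -> R) i,
  (forall i, 0 < rho i) -> - K * rho i <= F rho i).

Definition euler_next (h : R) (a : nat -> R) (i : nat) : R := a i + h * F a i.

Definition euler (h : R) (r0 : nat -> R) (k : nat) := iter k (euler_next h) r0.

Lemma expR_lower (x : R) : 0 <= x <= 2^-1 -> expR (- (2 * x)) <= 1 - x.
Proof.
move=> /andP[x0 x1]; rewrite expRN -div1r ler_pdivrMr ?expR_gt0//.
have := expR_ge1Dx (2 * x) => /(ler_wpM2l (_ : 0 <= 1 - x)) h.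
by apply: le_trans (h _); nra.
Qed.

Lemma euler_next_lower h a i : 0 <= h -> h * K <= 2^-1 -> (forall i, 0 < a i) ->
  expR (- (2 * (h * K))) * a i <= euler_next h a i.
Proof.
move=> h0 hK a0; have := lowK i a0 => /(ler_wpM2l h0).
have hK0 : 0 <= h * K <= 2^-1 by rewrite hK mulr_ge0// ltW.
have := expR_lower hK0 => /(ler_wpM2r (ltW (a0 i))).
rewrite /euler_next; lra.
Qed.

Lemma euler_next_pdens h a : 0 <= h -> h * K <= 2^-1 -> pdens a ->
  pdens (euler_next h a).
Proof.
move=> h0 hK ha; have [a0 a1 am] := ha.
have p i : 0 < euler_next h a i.
  by apply: lt_le_trans (euler_next_lower i h0 hK a0); rewrite mulr_gt0 ?expR_gt0.
have l1 := l1leD a1 (l1leZ h (fp_l1 ha)).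
have m1 : vsum (fun i => mu i * euler_next h a i) = 1.
  rewrite (vsum_ext (v := fun i => mu i * a i + h * (mu i * F a i))).
    by rewrite (vsumD a1 (absum_leZ h (fp_l1 ha))) (vsumZ h (fp_l1 ha)) fp_mass// mulr0 addr0.
  by move=> i; rewrite /euler_next mulrDr mulrCA.
split=> //; rewrite -m1; apply: (absum_le_vsum l1) => i.
by rewrite mulr_ge0 ?vmeas_ge0//; exact: ltW (p i).
Qed.

Lemma euler_pdens h a k : 0 <= h -> h * K <= 2^-1 -> pdens a -> pdens (euler h a k).
Proof. by move=> h0 hK ha; elim: k => //= k IH; exact: euler_next_pdens. Qed.

(** The factor depends only on the elapsed time [h * k], so the bound survives refinement of the
    mesh and makes the limit positive. *)
Lemma euler_lower h a k i : 0 <= h -> h * K <= 2^-1 -> pdens a ->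
  expR (- (2 * K * (h * k%:R))) * a i <= euler h a k i.
Proof.
move=> h0 hK ha; elim: k => [|k IH]; first by rewrite !mulr0 oppr0 expR0 mul1r.
have [a0 _ _] := euler_pdens k h0 hK ha.
apply: le_trans (euler_next_lower i h0 hK a0).
have -> : - (2 * K * (h * k.+1%:R)) = - (2 * (h * K)) - 2 * K * (h * k%:R).
  by rewrite -natr1; ring.
by rewrite expRD -mulrA ler_wpM2l ?expR_ge0.
Qed.

Lemma euler_drift h a k l e (Q : nat -> R) : 0 <= h ->
  (forall n, (n < l)%N -> l1le (fun i => F (euler h a (k + n)) i - Q i) e) ->
  l1le (fun i => euler h a (k + l) i - euler h a k i - l%:R * h * Q i) (l%:R * h * e).
Proof.
move=> h0; elim: l => [_|l IH hl].
  rewrite !mul0r addn0; apply: l1le_ext l1le0 => i.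
  by rewrite subrr !mul0r subrr.
have := l1leD (IH (fun n nl => hl n (ltnW nl))) (l1leZ h (hl l (ltnSn l))).
rewrite ger0_norm// => /l1leW h1.
have /h1 : l%:R * h * e + h * e <= l.+1%:R * h * e by rewrite -natr1; lra.
by apply: l1le_ext => i; rewrite addnS/= /euler_next -natr1; ring.
Qed.

Lemma euler_move h a k l : 0 <= h -> h * K <= 2^-1 -> pdens a ->
  l1le (fun i => euler h a (k + l) i - euler h a k i) (l%:R * h * CF).
Proof.
move=> h0 hK ha; have := @euler_drift h a k l CF (fun=> 0) h0; move=> H.
have /H {H} : forall n, (n < l)%N -> l1le (fun i => F (euler h a (k + n)) i - 0) CF.
  move=> n _; apply: l1le_ext (fp_l1 (euler_pdens (k + n) h0 hK ha)) => i.
  by rewrite subr0.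
by apply: l1le_ext => i; rewrite mulr0 subr0.
Qed.

Lemma euler_move' h a k l : 0 <= h -> h * K <= 2^-1 -> pdens a -> (k <= l)%N ->
  l1le (fun i => euler h a l i - euler h a k i) ((l - k)%:R * h * CF).
Proof. by move=> h0 hK ha kl; have := euler_move k (l - k) h0 hK ha; rewrite subnKC. Qed.

(** A block of [M] explicit steps is one approximate backward step of length [M * h]: during a short
    block the scheme moves little in l^1, so by [fp_modulus] its velocity stays close to the final
    one. This makes schemes with different meshes comparable. *)
Lemma euler_fp_step (e : R) : 0 < e -> exists2 h0 : R, 0 < h0 &
  forall h M a k, 0 <= h -> h * K <= 2^-1 -> M%:R * h <= h0 -> pdens a ->
  fp_step e (M%:R * h) (euler h a k) (euler h a (k + M)).
Proof.
move=> e0; have e20 : 0 < e / 2 by rewrite divr_gt0.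
have [L L0 hL] := fp_modulus e20.
have CL : 0 < CF * L + 1 by rewrite ltr_wpDl// mulr_ge0 ?CF_ge0// ltW.
exists (e / 2 / (CF * L + 1)); first by rewrite divr_gt0.
move=> h M a k h0 hK hM ha.
have := @euler_drift h a k M e (F (euler h a (k + M))) h0.
rewrite [_ * e]mulrC; apply=> n nM.
have := hL _ _ _ (euler_pdens (k + M) h0 hK ha) (euler_pdens (k + n) h0 hK ha)
  (euler_move' h0 hK ha (leq_add (leqnn k) (ltnW nM))).
move=> /l1leN/l1leW H.
have /H : e / 2 + L * ((k + M - (k + n))%:R * h * CF) <= e.
  have : (k + M - (k + n))%:R * h <= e / 2 / (CF * L + 1).
    by apply: le_trans hM; rewrite ler_wpM2r// ler_nat subnDl leq_subr.
  rewrite ler_pdivlMr// => H1.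
  have : 0 <= (k + M - (k + n))%:R * h by rewrite mulr_ge0.
  lra.
by apply: l1le_ext => i; rewrite opprB.
Qed.

End Euler.

(** The factor 2 in the exponent comes from [1 / (1 - x) <= 1 + 2 x] for [x] between 0 and 1/2. *)
Lemma gronwall (K h d : R) (x : nat -> R) : 0 <= h -> 0 <= d -> K * h <= 2^-1 ->
  0 <= K -> (forall k, 0 <= x k) -> (forall k, (1 - K * h) * x k.+1 <= x k + d) ->
  forall k, x k <= expR (2 * K * (h * k%:R)) * (x 0%N + k%:R * d).
Proof.
move=> h0 d0 Kh K0 x0 hx; elim=> [|k IH].
  by rewrite !mulr0 expR0 mul1r mul0r addr0.
have Kh0 : 0 <= K * h by rewrite mulr_ge0.
have h1 : x k.+1 <= (1 + 2 * (K * h)) * (x k + d).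
  have p0 : 0 <= 1 + 2 * (K * h) by rewrite addr_ge0 ?mulr_ge0.
  apply: le_trans (ler_wpM2l p0 (hx k)).
  by rewrite [leRHS]mulrA ler_peMl//; nra.
apply: (le_trans h1); have -> : 2 * K * (h * k.+1%:R) = 2 * (K * h) + 2 * K * (h * k%:R).
  by rewrite -natr1; ring.
rewrite expRD -mulrA ler_pM ?expR_ge1Dx ?addr_ge0 ?mulr_ge0//.
have E1 : 1 <= expR (2 * K * (h * k%:R)) by rewrite -expR0 ler_expR !mulr_ge0.
have := ler_wpM2r d0 E1; rewrite -natr1; lra.
Qed.

Lemma tri_sum_refl r : (forall i, 0 < r i) -> E r r = 0.
Proof.
move=> r0; rewrite (vsum_ext (v := fun=> 0)).
  by rewrite (vsum_fin_support (N := 0%N))// big_geq.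
by move=> i; rewrite /tri subrr expr0n/= mul0r mulr0.
Qed.

Lemma tri_sum_ge0 r r' : (forall i, 0 < r i) -> (forall i, 0 < r' i) -> 0 <= E r r'.
Proof.
move=> h h'; apply: vsum_ge0 => i.
by rewrite mulr_ge0 ?tri_ge0 ?vmeas_ge0.
Qed.

(** Applied to Euler schemes on two meshes for existence, and to two solutions sampled on a common
    grid for uniqueness. *)
Lemma fp_compare : exists2 K : R, 0 < K &
  forall e h (a c : nat -> nat -> R), 0 < e -> 0 <= h -> K * h <= 2^-1 ->
  (forall k, pdens (a k)) -> (forall k, pdens (c k)) -> a 0%N = c 0%N ->
  (forall k, fp_step e h (a k) (a k.+1)) -> (forall k, fp_step e h (c k) (c k.+1)) ->
  forall k, E (a k) (c k) <= expR (2 * K * (h * k%:R)) * (6 * e * (h * k%:R)).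
Proof.
have [K K0 hK] := fp_stability; exists K => // e h a c e0 h0 Kh ha hc ac sa sc k.
have x0 k' : 0 <= E (a k') (c k').
  by have [? _ _] := ha k'; have [? _ _] := hc k'; exact: tri_sum_ge0.
have d0 : 0 <= 6 * (e * h) by rewrite !mulr_ge0// ltW.
have hx k' : (1 - K * h) * E (a k'.+1) (c k'.+1) <= E (a k') (c k') + 6 * (e * h).
  exact: hK.
have /= := @gronwall K h _ (fun k => E (a k) (c k)) h0 d0 Kh (ltW K0) x0 hx k.
rewrite ac tri_sum_refl ?add0r; last by have [] := hc 0%N.
move=> /le_trans; apply; rewrite le_eqVlt; apply/orP; left; apply/eqP; ring.
Qed.

Lemma l1_complete (u : nat -> nat -> R) :
  (forall e, 0 < e -> exists N, forall n m, (N <= n)%N -> (n <= m)%N ->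
    l1le (fun i => u m i - u n i) e) ->
  exists f, forall e, 0 < e -> exists N, forall n, (N <= n)%N ->
    l1le (fun i => f i - u n i) e.
Proof.
move=> hu; have hc i : cvgn (fun n => u n i).
  apply/cauchy_cvgP; apply: cauchy_exP => e e0.
  have e1 : 0 < mu i * (e / 2) by rewrite mulr_gt0 ?vmeas_gt0 ?divr_gt0.
  have [N hN] := hu _ e1; exists (u N i); exists N => //= m Nm.
  have := l1le_pt i (hN N m (leqnn N) Nm); rewrite ler_pM2l ?vmeas_gt0// => h.
  by rewrite /ball/= distrC (le_lt_trans h)//; lra.
exists (fun i => limn (fun n => u n i)) => e /hu[N hN]; exists N => n Nn.
apply: (@l1le_lim (fun m i => u m i - u n i)) => [i|].
  by apply: cvgB; [exact: hc|exact: cvg_cst].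
by exists n => // m /= nm; exact: hN.
Qed.

Lemma pdens_lim f : (forall i, 0 < f i) ->
  (forall e, 0 < e -> exists2 r, pdens r & l1le (fun i => f i - r i) e) -> pdens f.
Proof.
move=> f0 hf.
have f1 : l1le f 1.
  apply: l1le_closed => e /hf[r [_ r1 _] fr].
  by apply: l1le_ext (l1leD r1 fr) => i; rewrite addrC subrK.
split=> //; apply/eqP; rewrite -subr_eq0 -normr_le0; apply/ler_addgt0Pl => e e0.
have [r [_ r1 <-] fr] := hf _ e0.
rewrite -(vsumB f1 r1) addr0; apply: vsum_norm_le.
by apply: absum_le_le fr => i; rewrite mulrBr.
Qed.

Lemma pow2_small (d : R) : 0 < d -> exists N, forall n, (N <= n)%N -> (2 ^+ n)^-1 <= d.
Proof.
move=> d0; exists (Num.truncn d^-1) => n Nn.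
rewrite -[leRHS]invrK lef_pV2 ?posrE ?invr_gt0 ?exprn_gt0//.
apply: (le_trans (ltW (truncnS_gt _))).
rewrite -natrX ler_nat; apply: leq_trans (ltn_expl n (ltnSn 1)) => //.
Qed.

(** * The limit of Euler schemes on dyadic meshes *)

Section Flow.
Variable r0 : nat -> R.
Hypothesis r0_dens : pdens r0.

Local Notation hs n := ((2 : R) ^+ n)^-1.
Definition euler_approx (n : nat) (t : R) := euler (hs n) r0 (Num.truncn (t * 2 ^+ n)).

Lemma pow2_gt0 n : 0 < (2 : R) ^+ n. Proof. by rewrite exprn_gt0. Qed.
Lemma dyadic_ge0 n : 0 <= hs n. Proof. by rewrite invr_ge0 ltW ?pow2_gt0. Qed.

Lemma trunc_time n t : 0 <= t ->
  hs n * (Num.truncn (t * 2 ^+ n))%:R <= t < hs n * (Num.truncn (t * 2 ^+ n))%:R + hs n.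
Proof.
move=> t0; have p := pow2_gt0 n.
have := @truncn_itv _ (t * 2 ^+ n); rewrite mulr_ge0 ?(ltW p)// => /(_ erefl).
rewrite -(natr1 (Num.truncn _)) => /andP[h1 h2]; apply/andP; split.
  by rewrite mulrC ler_pdivrMr.
set k := (Num.truncn _)%:R in h2 *; have -> : hs n * k + hs n = (k + 1) / 2 ^+ n by ring.
by rewrite ltr_pdivlMr.
Qed.

(** Grouping the fine scheme in blocks of [2 ^ (m - n)] steps gives it the mesh of the coarse one,
    and [fp_compare] applies. The fine steps left over last at most one coarse step and move at most
    [CF * 2^-n] in l^1. *)
Lemma euler_approx_cauchy t e : 0 <= t -> 0 < e ->
  exists N, forall n m, (N <= n)%N -> (n <= m)%N ->
    l1le (fun i => euler_approx m t i - euler_approx n t i) e.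
Proof.
move=> t0 e0.
have [K1 K10 hlow] := fp_lower; have [K K0 hcmp] := fp_compare.
set s := e / 4; have s0 : 0 < s by rewrite divr_gt0.
have D0 : 0 < expR (2 * K * t) * (6 * (t + 1)).
  by rewrite !mulr_gt0 ?expR_gt0// ltr_wpDl.
(* Chosen so that the bound of [fp_compare] at time [t] is at most [s ^+ 2], that is, an l^1
   distance of at most [2 * s = e / 2]. *)
set e' := s ^+ 2 / (expR (2 * K * t) * (6 * (t + 1))).
have e'0 : 0 < e' by rewrite divr_gt0 ?exprn_gt0.
have [h0 h00 hstep] := euler_fp_step K10 hlow e'0.
have [N1 hN1] := pow2_small h00.
have [N2 hN2] : exists N, forall n, (N <= n)%N -> hs n <= 2^-1 / K1.
  by apply: pow2_small; rewrite divr_gt0// invr_gt0.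
have [N3 hN3] : exists N, forall n, (N <= n)%N -> hs n <= 2^-1 / K.
  by apply: pow2_small; rewrite divr_gt0// invr_gt0.
have CF1 : 0 < CF + 1 by rewrite ltr_wpDl// CF_ge0.
have [N4 hN4] : exists N, forall n, (N <= n)%N -> hs n <= e / 2 / (CF + 1).
  by apply: pow2_small; rewrite !divr_gt0.
exists (maxn (maxn N1 N2) (maxn N3 N4)) => n m.
rewrite !geq_max => /andP[/andP[n1 n2] /andP[n3 n4]] nm.
have hK1 m' : (n <= m')%N -> hs m' * K1 <= 2^-1.
  by move=> h; rewrite -ler_pdivlMr// hN2// (leq_trans n2).
have hK : K * hs n <= 2^-1 by rewrite mulrC -ler_pdivlMr// hN3.
have hCF : hs n * CF <= e / 2.
  have := hN4 _ n4; rewrite ler_pdivlMr// => /(le_trans _); apply.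
  by rewrite ler_wpM2l ?dyadic_ge0// lerDl.
pose M := (2 ^ (m - n))%N.
have hM : M%:R * hs m = hs n.
  have -> : (2 : R) ^+ m = 2 ^+ (m - n) * 2 ^+ n by rewrite -exprD subnK.
  by rewrite /M natrX invfM mulrA divff ?mul1r// lt0r_neq0 ?pow2_gt0.
pose a k := euler (hs n) r0 k; pose c k := euler (hs m) r0 (k * M).
have ha k : pdens (a k) by apply: (euler_pdens K10 hlow); rewrite ?dyadic_ge0 ?hK1.
have hc k : pdens (c k) by apply: (euler_pdens K10 hlow); rewrite ?dyadic_ge0 ?hK1.
have sa k : fp_step e' (hs n) (a k) (a k.+1).
  have := hstep (hs n) 1%N r0 k (dyadic_ge0 n) (hK1 _ (leqnn n)).
  by rewrite mul1r addn1; apply => //; exact: hN1.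
have sc k : fp_step e' (hs n) (c k) (c k.+1).
  have := hstep (hs m) M r0 (k * M)%N (dyadic_ge0 m) (hK1 _ nm).
  by rewrite hM {2}/c mulSn (addnC M); apply => //; exact: hN1.
set k := Num.truncn (t * 2 ^+ n); set k' := Num.truncn (t * 2 ^+ m).
have tn : hs n * k%:R <= t by have /andP[] := trunc_time n t0.
have tm : t * 2 ^+ m = t * 2 ^+ n * M%:R.
  by rewrite /M natrX -mulrA -exprD subnKC.
have t2 : 0 <= t * 2 ^+ n by rewrite mulr_ge0 ?(ltW (pow2_gt0 _)).
have t3 : 0 <= t * 2 ^+ m by rewrite mulr_ge0 ?(ltW (pow2_gt0 _)).
have M0 : 0 < M%:R :> R by rewrite ltr0n expn_gt0.
have /andP[kt1 kt2] := truncn_itv t2.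
have kk : (k * M <= k')%N.
  by rewrite /k' truncn_ge_nat// tm natrM ler_pM2r.
have kk' : (k' - k * M <= M)%N.
  rewrite leq_subLR addnC -mulSn ltnW// /k' truncn_lt_nat// tm natrM.
  by rewrite ltr_pM2r.
have Ekc : E (a k) (c k) <= s ^+ 2.
  apply: le_trans (hcmp e' (hs n) a c e'0 (dyadic_ge0 n) hK ha hc erefl sa sc k) _.
  have -> : s ^+ 2 = expR (2 * K * t) * (6 * e' * (t + 1)).
    by rewrite /e'; field; rewrite !gt_eqF ?ltr_wpDl ?expR_gt0.
  have hk0 : 0 <= hs n * k%:R by rewrite mulr_ge0 ?dyadic_ge0.
  have e6 : 0 <= 6 * e' by rewrite mulr_ge0// ltW.
  apply: ler_pM; rewrite ?expR_ge0//; first exact: mulr_ge0.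
    by rewrite ler_expR ler_wpM2l// mulr_ge0// ltW.
  by rewrite ler_wpM2l//; lra.
have h1 := l1_of_tri (ha k) (hc k) s0 Ekc.
have h2 := euler_move' K10 hlow (dyadic_ge0 m) (hK1 _ nm) r0_dens kk.
have := l1leB h2 h1; move=> /l1leW H.
have /H : (k' - k * M)%:R * hs m * CF + 2 * s <= e.
  have : (k' - k * M)%:R * hs m <= hs n.
    by rewrite -hM ler_wpM2r ?dyadic_ge0// ler_nat.
  move=> /(ler_wpM2r CF_ge0); rewrite /s; lra.
apply: l1le_ext => i; rewrite /euler_approx -/k -/k' /a /c; ring.
Qed.

Lemma fp_lim_F f (u : nat -> nat -> R) : pdens f ->
  (\forall n \near \oo, pdens (u n)) ->
  (forall e, 0 < e -> exists N, forall n, (N <= n)%N -> l1le (fun i => f i - u n i) e) ->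
  forall e, 0 < e -> exists N, forall n, (N <= n)%N ->
    l1le (fun i => F f i - F (u n) i) e.
Proof.
move=> hf [N1 _ hu] fu e e0.
have e20 : 0 < e / 2 by rewrite divr_gt0.
have [L L0 hL] := fp_modulus e20.
have [N2 hN2] := fu _ (divr_gt0 e20 L0).
exists (maxn N1 N2) => n; rewrite geq_max => /andP[n1 n2].
have := hL _ _ _ hf (hu _ n1) (hN2 _ n2).
have -> : L * (e / 2 / L) = e / 2 by rewrite mulrC divfK ?gt_eqF.
by apply: l1leW; lra.
Qed.

(** The equation in backward form, uniformly in time. It passes to limits of schemes and is all that
    uniqueness and the Lyapunov estimates use of a solution. *)
Definition uniform_step (rho : R -> nat -> R) := forall e, 0 < e ->
  exists2 h0 : R, 0 < h0 & forall t h, 0 <= t -> 0 <= h <= h0 ->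
  fp_step e h (rho t) (rho (t + h)).

(** The last clause, for general weights [V], will keep the second moment of the solution finite. *)
Lemma fp_flow : exists rho : R -> nat -> R, [/\ rho 0 = r0,
  forall t, 0 <= t -> pdens (rho t), uniform_step rho &
  forall (V : nat -> R) c, (forall i, 0 <= V i) ->
    (forall i j, adj G i j -> V i <= 3 * V j) -> l1le (fun i => V i * r0 i) c ->
    forall t, 0 <= t -> exists c', l1le (fun i => V i * rho t i) c'].
Proof.
have [K K0 hlow] := fp_lower.
have [N0 hN0] : exists N, forall n, (N <= n)%N -> hs n <= 2^-1 / K.
  by apply: pow2_small; rewrite divr_gt0// invr_gt0.
have hK n : (N0 <= n)%N -> hs n * K <= 2^-1.
  by move=> h; rewrite -ler_pdivlMr// hN0.
have ex t : exists f, 0 <= t -> forall e, 0 < e -> exists N, forall n, (N <= n)%N ->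
    l1le (fun i => f i - euler_approx n t i) e.
  have [t0|] := boolP (0 <= t); last by exists r0.
  have [f hf] := l1_complete (fun e => @euler_approx_cauchy t e t0).
  by exists f.
(* The value at time 0 is prescribed, so that the initial condition holds by definition. *)
pose rho t := if t == 0 then r0 else projT1 (cid (ex t)).
have hrho t : 0 <= t -> forall e, 0 < e -> exists N, forall n, (N <= n)%N ->
    l1le (fun i => rho t i - euler_approx n t i) e.
  move=> t0 e e0; rewrite /rho; case: eqP => [->|_]; last first.
    by case: cid => /= f; exact.
  exists 0%N => n _; rewrite /euler_approx mul0r truncn0/=.
  by apply: l1leW (ltW e0) _; apply: l1le_ext l1le0 => i; rewrite subrr.
have happ n t : (N0 <= n)%N -> pdens (euler_approx n t).
  by move=> h; apply: (euler_pdens K0 hlow); rewrite ?dyadic_ge0 ?hK.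
(* A mesh-independent lower bound [c] for the schemes, approximated within [c / 2] at the vertex
   [i], leaves a positive limit. *)
have hpos t i : 0 <= t -> 0 < rho t i.
  move=> t0; have [r00 _ _] := r0_dens.
  set c := expR (- (2 * K * t)) * r0 i.
  have c0 : 0 < c by rewrite mulr_gt0 ?expR_gt0.
  have [N hN] := hrho t t0 _ (mulr_gt0 (vmeas_gt0 i) (divr_gt0 c0 (ltr0Sn R 1))).
  pose n := maxn N N0.
  have := l1le_pt i (hN n (leq_maxl _ _)).
  rewrite ler_pM2l ?vmeas_gt0// ler_norml => /andP[h1 _].
  have h2 : c <= euler_approx n t i.
    apply: le_trans (euler_lower K0 hlow _ i (dyadic_ge0 n) (hK _ (leq_maxr _ _)) r0_dens).
    rewrite /c ler_wpM2r ?(ltW (r00 i))// ler_expR lerN2 ler_wpM2l//.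
      by rewrite mulr_ge0// ltW.
    by have /andP[] := trunc_time n t0.
  lra.
have hdens t : 0 <= t -> pdens (rho t).
  move=> t0; apply: pdens_lim => [i|e e0]; first exact: hpos.
  have [N hN] := hrho t t0 e e0; exists (euler_approx (maxn N N0) t).
    by apply: happ; exact: leq_maxr.
  by apply: hN; exact: leq_maxl.
exists rho; split=> //; first by rewrite /rho eqxx.
- move=> e e0; have [h0 h00 hstep] := euler_fp_step K0 hlow e0.
  (* Half of [h0], since rounding both times to the grid can lengthen the block by one mesh step. *)
  exists (h0 / 2); first by rewrite divr_gt0.
  (* The excess [d] is shared in quarters: replacing [rho] by the scheme at the two times, replacing
     the final velocity, and rounding the length of the block. *)
  move=> t h t0 /andP[hh0 hh]; apply: l1le_closed => d d0.
  have th0 : 0 <= t + h by rewrite addr_ge0.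
  have d40 : 0 < d / 4 by rewrite divr_gt0.
  have d4h : 0 < d / 4 / (1 + h) by rewrite divr_gt0// ltr_wpDr.
  have [N1 hN1] := hrho _ t0 _ d40; have [N2 hN2] := hrho _ th0 _ d40.
  have nh : \forall n \near \oo, pdens (euler_approx n (t + h)).
    by exists N0 => // n /= /happ.
  have [N3 hN3] := fp_lim_F (hdens _ th0) nh (hrho _ th0) d4h.
  have eCF : 0 < e + CF + 1 by rewrite ltr_wpDl// addr_ge0 ?CF_ge0// ltW.
  have [N4 hN4] := pow2_small (divr_gt0 d40 eCF).
  have [N5 hN5] : exists N, forall n, (N <= n)%N -> hs n <= h0 / 2.
    by apply: pow2_small; rewrite divr_gt0.
  pose n := maxn (maxn (maxn N0 N1) (maxn N2 N3)) (maxn N4 N5).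
  have := leqnn n; rewrite {1}/n !geq_max.
  move=> /andP[/andP[/andP[n0 n1] /andP[n2 n3]] /andP[n4 n5]].
  have {}hN1 := hN1 n n1; have {}hN2 := hN2 n n2; have {}hN3 := hN3 n n3.
  have {}hN4 := hN4 n n4; have {}hN5 := hN5 n n5; have {}hK := hK n n0.
  have hd2 : pdens (euler_approx n (t + h)) by exact: happ.
  move: (trunc_time n t0) (trunc_time n th0) => /andP[k1 k2] /andP[l1 l2].
  set k := Num.truncn (t * 2 ^+ n) in k1 k2.
  set l := Num.truncn ((t + h) * 2 ^+ n) in l1 l2.
  have kl : (k <= l)%N.
    by apply: le_truncn; rewrite ler_wpM2r ?(ltW (pow2_gt0 _))// lerDl.
  have lk : (l - k)%:R = l%:R - k%:R :> R by rewrite natrB.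
  have s1 := hstep (hs n) (l - k)%N r0 k (dyadic_ge0 n) hK.
  have /s1 {s1} : (l - k)%:R * hs n <= h0 by rewrite lk; lra.
  move=> /(_ r0_dens); rewrite subnKC// /fp_step => s1.
  have hs0 := dyadic_ge0 n.
  set x := (l - k)%:R * hs n in s1.
  have xh : `|x - h| <= hs n by rewrite /x lk ler_norml; lra.
  have := l1leB (l1leD (l1leB (l1leD s1 hN2) hN1) (l1leZ (x - h) (fp_l1 hd2)))
    (l1leZ h hN3).
  move=> /l1leW H.
  have /H : e * x + d / 4 + d / 4 + `|x - h| * CF + `|h| * (d / 4 / (1 + h)) <= e * h + d.
    rewrite ler_pdivlMr// in hN4.
    have g1 : `|h| * (d / 4 / (1 + h)) <= d / 4.
      rewrite ger0_norm// mulrA ler_pdivrMr ?ltr_wpDr//.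
      by rewrite mulrC ler_wpM2l ?(ltW d40)//; lra.
    have g2 := ler_wpM2r CF_ge0 xh.
    have g3 : e * x <= e * h + e * hs n.
      rewrite -mulrDr ler_wpM2l ?(ltW e0)//.
      by move: xh; rewrite ler_norml; lra.
    have : 0 <= hs n := hs0; lra.
  apply: l1le_ext => i; rewrite /euler_approx -/k -/l; ring.
- move=> V c V0 hV hc t t0; have [K2 K20 hup] := fp_upper.
  have c0 := absum_le_ge0 hc.
  have hm n k : (N0 <= n)%N -> l1le (fun i => V i * euler (hs n) r0 k i)
      (expR (K2 * (hs n * k%:R)) * c).
    move=> nN; elim: k => [|k IH]; first by rewrite !mulr0 expR0 mul1r.
    have pk := euler_pdens K0 hlow k (dyadic_ge0 n) (hK _ nN) r0_dens.
    have [pk0 _ _] := pk.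
    have := l1leD IH (l1leZ (hs n) (hup _ V _ pk0 V0 hV IH)).
    rewrite (ger0_norm (dyadic_ge0 n)) => /l1leW H.
    have /H : expR (K2 * (hs n * k%:R)) * c + hs n * (K2 * (expR (K2 * (hs n * k%:R)) * c))
        <= expR (K2 * (hs n * k.+1%:R)) * c.
      have -> : K2 * (hs n * k.+1%:R) = K2 * hs n + K2 * (hs n * k%:R).
        by rewrite -natr1; ring.
      rewrite expRD; have := expR_ge1Dx (K2 * hs n).
      have : 0 <= expR (K2 * (hs n * k%:R)) * c by rewrite mulr_ge0 ?expR_ge0.
      move=> h1 h2; have := ler_wpM2r h1 h2; lra.
    apply: l1le_ext => i; rewrite /= /euler_next; ring.
  exists (expR (K2 * t) * c).
  apply: (@l1le_lim (fun n i => V i * euler_approx n t i)).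
    move=> i; apply: cvgMr; apply/cvgrPdist_le => e e0.
    have [N hN] := hrho t t0 _ (mulr_gt0 (vmeas_gt0 i) e0).
    exists N => // n /= /hN/(l1le_pt i).
    by rewrite ler_pM2l ?vmeas_gt0.
  exists N0 => // n /= nN; apply: l1leW (hm n _ nN).
  rewrite ler_wpM2r// ler_expR ler_wpM2l ?(ltW K20)//.
  by have /andP[] := trunc_time n t0.
Qed.

End Flow.

End Graph.

(** * Differentiable curves in l^1 *)

Section Curves.
Context {R : realType}.
Variable G : wgraph R.
Hypothesis hG : weighted_graph G.
Local Notation w := (wt G).
Local Notation mu := (vmeas G).
Local Notation l1le := (l1le G).
Local Notation pdens := (pdens G).

Lemma lnorm1E (f : nat -> R) :
  lnorm G 1%:E f = (\sum_(i <oo) `|mu i * f i|%:E)%E.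
Proof.
rewrite /lnorm invr1 poweRe1; last first.
  by apply: nneseries_ge0 => i _ _; rewrite lee_fin mulr_ge0 ?vmeas_ge0// powR_ge0.
apply: eq_eseriesr => i _; rewrite powRr1// normrM ger0_norm//.
exact: vmeas_ge0.
Qed.

Lemma lnorm1_leP f c : (lnorm G 1%:E f <= c%:E)%E <-> l1le f c.
Proof. by rewrite lnorm1E; exact: nneseries_leP. Qed.

Lemma lnorm1_finP f : in_l1 G f <-> exists c, l1le f c.
Proof. by rewrite /in_l1 lnorm1E; exact: nneseries_finP. Qed.

Lemma cvge0_leP (T : Type) (F : set_system T) (u : T -> \bar R) : Filter F ->
  (forall t, 0 <= u t)%E ->
  u t @[t --> F] --> 0%E <-> forall e : R, 0 < e -> \forall t \near F, (u t <= e%:E)%E.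
Proof.
move=> FF u0; split=> [/fine_cvgP[uf /cvgrPdist_le h] e /h he|h].
  near=> t; have ut : u t \is a fin_num by near: t.
  have : `|0 - fine (u t)| <= e by near: t.
  rewrite sub0r normrN => /(le_trans (ler_norm _)).
  by rewrite -lee_fin fineK.
apply/fine_cvgP; split.
  near=> t; have : (u t <= 1%:E)%E by near: t; exact: h.
  move=> ut; rewrite ge0_fin_numE//; exact: le_lt_trans ut (ltry _).
apply/cvgrPdist_le => e e0; near=> t.
have ut : (u t <= e%:E)%E by near: t; exact: h.
have uf : u t \is a fin_num by rewrite ge0_fin_numE//; exact: le_lt_trans ut (ltry _).
rewrite sub0r normrN ger0_norm ?fine_ge0//.
by rewrite -lee_fin fineK.
Unshelve. all: by end_near. Qed.

Lemma lnorm_ge0 r f : (0 <= lnorm G r f)%E.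
Proof.
rewrite /lnorm; case: r => [q||]; first exact: poweR_ge0.
  by apply: (@le_trans _ _ `|f 0%N|%:E); [rewrite lee_fin|apply: ereal_sup_ubound; exists 0%N].
by apply: (@le_trans _ _ `|f 0%N|%:E); [rewrite lee_fin|apply: ereal_sup_ubound; exists 0%N].
Qed.

Lemma cvg_lnorm1P (T : Type) (F : set_system T) (u : T -> nat -> R) : Filter F ->
  lnorm G 1%:E (u t) @[t --> F] --> 0%E <->
  forall e : R, 0 < e -> \forall t \near F, l1le (u t) e.
Proof.
move=> FF; rewrite (cvge0_leP _ (fun t => lnorm_ge0 1%:E (u t))).
split=> h e /h; apply: filterS => t; by rewrite lnorm1_leP.
Qed.

Lemma within_dnbhsP (t : R) (P : R -> Prop) : 0 <= t ->
  (\forall s \near within `[0, +oo[%classic t^', P s) <->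
  exists2 d : R, 0 < d & forall s, 0 <= s -> s != t -> `|s - t| < d -> P s.
Proof.
move=> t0; rewrite /within /dnbhs /within/=; split.
  move=> /nbhs_ballP[d d0 h]; exists d => // s s0 st sd.
  by apply: h => //=; rewrite ?in_itv/= ?s0// /ball/= distrC.
move=> [d d0 h]; apply/nbhs_ballP; exists d => //= s sd st.
by rewrite in_itv/= andbT => s0; apply: h => //; rewrite distrC.
Qed.

Lemma within_nbhsP (t : R) (P : R -> Prop) : 0 <= t ->
  (\forall s \near within `[0, +oo[%classic (nbhs t), P s) <->
  exists2 d : R, 0 < d & forall s, 0 <= s -> `|s - t| < d -> P s.
Proof.
move=> t0; rewrite /within/=; split.
  move=> /nbhs_ballP[d d0 h]; exists d => // s s0 sd.
  by apply: h => //=; rewrite ?in_itv/= ?s0// /ball/= distrC.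
move=> [d d0 h]; apply/nbhs_ballP; exists d => //= s sd.
by rewrite in_itv/= andbT => s0; apply: h => //; rewrite distrC.
Qed.

(** With the denominator cleared, the condition is meaningful at [s = t] as well and consists of
    plain l^1 bounds. *)
Lemma C1_curveP (rho drho : R -> nat -> R) :
  C1_curve G `[0, +oo[%classic rho drho <->
  forall t, 0 <= t -> forall e, 0 < e -> exists2 d : R, 0 < d &
    forall s, 0 <= s -> `|s - t| < d ->
    l1le (fun i => rho s i - rho t i - (s - t) * drho t i) (e * `|s - t|) /\
    l1le (fun i => drho s i - drho t i) e.
Proof.
split=> [h t t0 e e0|h t].
  have /h[] : `[0, +oo[%classic t by rewrite /= in_itv/= t0.
  move=> /cvg_lnorm1P/(_ e e0)/(within_dnbhsP _ t0)[d1 d10 h1].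
  move=> /cvg_lnorm1P/(_ e e0)/(within_nbhsP _ t0)[d2 d20 h2].
  exists (Num.min d1 d2) => [|s s0]; first by rewrite lt_min d10.
  rewrite lt_min => /andP[sd1 sd2]; split; last exact: h2.
  have [->|st] := eqVneq s t.
    rewrite !subrr normr0 mulr0; apply: (l1le_ext _ (l1le0 G)) => i.
    by rewrite subrr mul0r subrr.
  have := l1leZ (s - t) (h1 s s0 st sd1); rewrite mulrC.
  apply: l1le_ext => i; field; by rewrite subr_eq0.
rewrite /= in_itv/= andbT => t0; split; apply/cvg_lnorm1P => e e0.
  apply/(within_dnbhsP _ t0); have [d d0 hd] := h t t0 e e0.
  exists d => // s s0 st sd; have [h1 _] := hd s s0 sd.
  have st0 : s - t != 0 by rewrite subr_eq0.
  have := l1leZ (s - t)^-1 h1; rewrite mulrC normfV mulfK ?normr_eq0//.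
  by apply: l1le_ext => i; field.
apply/(within_nbhsP _ t0); have [d d0 hd] := h t t0 e e0.
by exists d => // s s0 sd; have [] := hd s s0 sd.
Qed.

Lemma is_derive_of_diff (f : R -> R) (x l : R) :
  (forall e, 0 < e -> exists2 d : R, 0 < d & forall s, `|s - x| < d ->
    `|f s - f x - (s - x) * l| <= e * `|s - x|) ->
  is_derive x 1 f l.
Proof.
move=> h.
have c : (fun k : R => k^-1 *: ((f \o shift x) (k *: (1 : R)) - f x)) @ 0^' --> l.
  apply/cvgrPdist_le => e e0; have [d d0 hd] := h e e0.
  near=> k.
  have k0 : k != 0 by near: k; exact: nbhs_dnbhs_neq.
  have kd : `|k| < d by near: k; exact: dnbhs0_lt.
  rewrite /= /shift/= !scaler1 /GRing.scale/= distrC.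
  have := hd (k + x); rewrite addrK => /(_ kd) hk.
  have -> : k^-1 * (f (k + x) - f x) - l = k^-1 * (f (k + x) - f x - k * l).
    by field.
  by rewrite normrM normfV mulrC ler_pdivrMr// normr_gt0.
split; first by apply/cvg_ex; exists l.
exact: cvg_lim c.
Unshelve. all: by end_near. Qed.

Lemma diff_cvg (f : R -> R) (x l : R) (F : set_system R) : Filter F ->
  (forall d, 0 < d -> \forall s \near F, `|s - x| < d /\ 0 <= s) ->
  (exists2 d : R, 0 < d & forall s, 0 <= s -> `|s - x| < d ->
    `|f s - f x - (s - x) * l| <= `|s - x|) ->
  f s @[s --> F] --> f x.
Proof.
move=> FF hF [d d0 h]; apply/cvgrPdist_le => e e0.
have l1 : 0 < `|l| + 1 by rewrite ltr_wpDl.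
have d'0 : 0 < Num.min d (e / (`|l| + 1)) by rewrite lt_min d0 divr_gt0.
near=> s.
have [sd s0] : `|s - x| < Num.min d (e / (`|l| + 1)) /\ 0 <= s by near: s; exact: hF.
move: sd; rewrite lt_min => /andP[sd]; rewrite ltr_pdivlMr// => se.
have := h s s0 sd => h'; rewrite distrC.
have -> : f s - f x = (f s - f x - (s - x) * l) + (s - x) * l by ring.
apply: le_trans (ler_normD _ _) _; rewrite normrM; lra.
Unshelve. all: by end_near. Qed.

(* A curve with values in l^1 is tested against sign vectors to reduce the mean
   value inequality to the real mean value theorem. *)
Lemma l1_mean_value (rho drho : R -> nat -> R) (t s c : R) (q : nat -> R) :
  C1_curve G `[0, +oo[%classic rho drho -> 0 <= t -> t < s ->
  (forall x, t < x < s -> l1le (fun i => drho x i - q i) c) ->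
  l1le (fun i => rho s i - rho t i - (s - t) * q i) ((s - t) * c).
Proof.
move=> /C1_curveP h t0 ts hq N.
pose sg i := Num.sg (rho s i - rho t i - (s - t) * q i).
pose g x := \sum_(0 <= i < N) mu i * sg i * rho x i.
pose dg x := \sum_(0 <= i < N) mu i * sg i * drho x i.
have sg1 i : `|sg i| <= 1 by rewrite /sg normr_sg; case: eqP.
have hg x e : 0 <= x -> 0 < e -> exists2 d : R, 0 < d &
    forall y, 0 <= y -> `|y - x| < d -> `|g y - g x - (y - x) * dg x| <= e * `|y - x|.
  move=> x0 e0; have [d d0 hd] := h x x0 e e0; exists d => // y y0 yx.
  have [h1 _] := hd y y0 yx.
  rewrite /g /dg mulr_sumr -!sumrB; apply: le_trans (norm_sum_nat _ _ _) _.
  apply: le_trans (h1 N); apply: le_sum_nat => i _.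
  have -> : mu i * sg i * rho y i - mu i * sg i * rho x i - (y - x) * (mu i * sg i * drho x i)
    = sg i * (mu i * (rho y i - rho x i - (y - x) * drho x i)) by ring.
  by rewrite normrM ler_piMl.
have der x : x \in `]t, s[ -> is_derive x 1 g (dg x).
  rewrite in_itv/= => /andP[tx xs]; have x0 : 0 < x by apply: le_lt_trans tx.
  apply: is_derive_of_diff => e e0; have [d d0 hd] := hg x e (ltW x0) e0.
  exists (Num.min d x) => [|y]; first by rewrite lt_min d0.
  rewrite lt_min => /andP[yd yx]; apply: hd => //.
  by move: yx; rewrite ltr_norml => /andP[]; lra.
have cont (x : R) (F : set_system R) : Filter F -> 0 <= x ->
    (forall d, 0 < d -> \forall y \near F, `|y - x| < d /\ 0 <= y) ->
    g y @[y --> F] --> g x.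
  move=> FF x0 hF; apply: (diff_cvg (l := dg x) FF hF).
  have [d d0 hd] := hg x 1 x0 ltr01; exists d => // y y0 yx.
  by rewrite -[leRHS]mul1r; exact: hd.
have nearb (x d : R) : 0 < d -> \forall y \near x, `|y - x| < d.
  by move=> d0; apply/nbhs_ballP; exists d => //= y; rewrite /ball/= distrC.
have cg : {within `[t, s], continuous g}.
  apply/continuous_within_itvP => //; split.
  - move=> x; rewrite in_itv/= => /andP[tx xs]; have x0 : 0 < x by apply: le_lt_trans tx.
    apply: cont => [|d d0]; first exact: ltW.
    near=> y; split; first by near: y; exact: nearb.
    have : `|y - x| < x by near: y; exact: nearb.
    by rewrite ltr_norml; lra.
  - apply: cont => // d d0; near=> y; split.
      by near: y; apply: cvg_within; exact: nearb.
    by apply: (le_trans t0); near: y; exact: nbhs_right_ge.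
  - have s0 : 0 < s by apply: le_lt_trans ts.
    apply: cont => [|d d0]; first exact: ltW.
    near=> y; split; first by near: y; apply: cvg_within; exact: nearb.
    by near: y; exact: nbhs_left_ge.
have [x xts E] := MVT ts der cg.
have := hq x; move: xts; rewrite in_itv/= => xts /(_ xts N) hx.
have st0 : 0 < s - t by rewrite subr_gt0.
rewrite (eq_bigr (fun i => mu i * sg i * (rho s i - rho t i - (s - t) * q i))); last first.
  by move=> i _; rewrite normrM ger0_norm ?vmeas_ge0// normrEsg mulrA.
have -> : \sum_(0 <= i < N) mu i * sg i * (rho s i - rho t i - (s - t) * q i)
   = (s - t) * \sum_(0 <= i < N) mu i * sg i * (drho x i - q i).
  rewrite [RHS](_ : _ = dg x * (s - t) - (s - t) * \sum_(0 <= i < N) mu i * sg i * q i).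
    rewrite -E /g mulr_sumr -!sumrB; apply: eq_bigr => i _; ring.
  rewrite (mulrC (dg x)) -mulrBr -sumrB; congr (_ * _); apply: eq_bigr => i _; ring.
rewrite ler_pM2l//; apply: le_trans hx; apply: le_sum_nat => i _.
apply: le_trans (ler_norm _) _; rewrite !normrM mulrAC ler_piMr//.
Unshelve. all: by end_near. Qed.

End Curves.

(** * Well-posedness *)

Section Solutions.
Context {R : realType}.
Variable G : wgraph R.
Hypothesis hG : weighted_graph G.
Local Notation w := (wt G).
Local Notation mu := (vmeas G).
Local Notation l1le := (l1le G).
Local Notation pdens := (pdens G).
Variable b : nat -> nat.
Hypothesis hb : forall i j, adj G i j -> (j < b i)%N.
Variables (Psi : nat -> R) (C : R).
Hypotheses (C_ge0 : 0 <= C) (hC : forall i j, `|grad G Psi i j| <= C).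
Local Notation F := (fp_rhs G Psi).
Local Notation CF := ((1 + C) * (2 * 1)).

Lemma exists_small_step (t d : R) : 0 <= t -> 0 < d ->
  exists n : nat, 0 <= t / n.+1%:R <= d.
Proof.
move=> t0 d0; exists (Num.truncn (t / d)).
rewrite divr_ge0//= ler_pdivrMr ?ltr0n// mulrC -ler_pdivrMr//.
by rewrite ltW// truncnS_gt.
Qed.

(** On the grid of step [t / (n + 1)] both curves make backward steps of arbitrarily small defect,
    so [fp_compare] bounds their distance at [t] by any positive number. *)
Lemma uniform_step_unique rho rho' : rho 0 = rho' 0 ->
  (forall t, 0 <= t -> pdens (rho t)) -> (forall t, 0 <= t -> pdens (rho' t)) ->
  uniform_step G Psi rho -> uniform_step G Psi rho' ->
  forall t, 0 <= t -> rho t = rho' t.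
Proof.
move=> e0 hr hr' ur ur' t t0.
have [K K0 hK] := fp_compare hG hb C_ge0 hC.
have key s : 0 < s -> l1le (fun i => rho t i - rho' t i) (2 * s).
  move=> s0; apply: (l1_of_tri hG (hr t t0) (hr' t t0) s0).
  have D0 : 0 < expR (2 * K * t) * (6 * (t + 1)).
    by rewrite !mulr_gt0 ?expR_gt0// ltr_wpDl.
  set e := s ^+ 2 / (expR (2 * K * t) * (6 * (t + 1))).
  have e_gt0 : 0 < e by rewrite divr_gt0 ?exprn_gt0.
  have [h1 h10 s1] := ur e e_gt0; have [h2 h20 s2] := ur' e e_gt0.
  have d0 : 0 < Num.min (Num.min h1 h2) (2^-1 / K).
    by rewrite !lt_min h10 h20 divr_gt0// invr_gt0.
  have [n] := exists_small_step t0 d0.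
  set h := t / n.+1%:R; rewrite !le_min => /andP[h0 /andP[/andP[hh1 hh2] hhK]].
  have hn : h * n.+1%:R = t by rewrite /h divfK// gt_eqF// ltr0n.
  have hk k : 0 <= h * k%:R by rewrite mulr_ge0.
  have S k : h * k.+1%:R = h * k%:R + h by rewrite -natr1 mulrDr mulr1.
  have Kh : K * h <= 2^-1 by rewrite mulrC -ler_pdivlMr.
  have := hK e h (fun k => rho (h * k%:R)) (fun k => rho' (h * k%:R)) e_gt0 h0 Kh
    (fun k => hr _ (hk k)) (fun k => hr' _ (hk k)).
  rewrite !mulr0 => /(_ e0) H.
  have := H _ _ n.+1; rewrite hn => {}H; apply: le_trans (H _ _) _.
  - by move=> k; rewrite S; apply: s1; rewrite ?h0.
  - by move=> k; rewrite S; apply: s2; rewrite ?h0.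
  have -> : s ^+ 2 = expR (2 * K * t) * (6 * e * (t + 1)).
    by rewrite /e; field; rewrite !gt_eqF ?ltr_wpDl ?expR_gt0.
  have e6 : 0 <= 6 * e by rewrite mulr_ge0// ltW.
  by rewrite ler_wpM2l ?expR_ge0// ler_wpM2l// lerDl.
apply/funext => i; apply/eqP; rewrite -subr_eq0 -normr_le0.
apply/ler_addgt0Pl => e e_gt0; rewrite addr0.
have m0 := vmeas_gt0 hG i.
have := l1le_pt hG i (key (mu i * e / 2) _); rewrite divr_gt0 ?mulr_gt0// => /(_ erefl).
have -> : 2 * (mu i * e / 2) = mu i * e by field.
by rewrite ler_pM2l.
Qed.

(** The l^1 mean value inequality is used twice: with velocity 0 it shows the curve to be Lipschitz
    with constant [CF], and then, by [fp_modulus], with the final velocity it gives the defect. *)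
Lemma solution_uniform_step rho drho : C1_curve G `[0, +oo[%classic rho drho ->
  (forall t, 0 <= t -> pdens (rho t)) ->
  (forall t i, 0 <= t -> drho t i = F (rho t) i) -> uniform_step G Psi rho.
Proof.
move=> hc hr hF e e0.
have drhoE t : 0 <= t -> drho t = F (rho t) by move=> t0; apply/funext => i; exact: hF.
have lip x y : 0 <= x -> x < y -> l1le (fun i => rho y i - rho x i) ((y - x) * CF).
  move=> x0 xy; have := @l1_mean_value R G hG rho drho x y CF (fun=> 0) hc x0 xy.
  move=> H; have /H {H} : forall z, x < z < y -> l1le (fun i => drho z i - 0) CF.
    move=> z /andP[xz _]; have z0 : 0 <= z by rewrite ltW// (le_lt_trans x0).
    apply: (l1le_ext _ (fp_l1 hG hb C_ge0 hC (hr z z0))) => i.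
    by rewrite subr0 drhoE.
  by apply: l1le_ext => i; rewrite mulr0 subr0.
have e20 : 0 < e / 2 by rewrite divr_gt0.
have [L L0 hL] := fp_modulus hG hb C_ge0 hC e20.
have CL : 0 < CF * L + 1.
  by rewrite ltr_wpDl// mulr_ge0 ?(ltW L0)// mulr_ge0// addr_ge0.
exists (e / 2 / (CF * L + 1)); first by rewrite divr_gt0.
move=> t h t0 /andP[]; rewrite le_eqVlt => /predU1P[<- _|h0 hh].
  rewrite addr0 /fp_step mulr0; apply: (l1le_ext _ (l1le0 G)) => i.
  by rewrite subrr mul0r subr0.
have th : t < t + h by rewrite ltrDl.
have := @l1_mean_value R G hG rho drho t (t + h) e (F (rho (t + h))) hc t0 th.
have -> : t + h - t = h by ring.
rewrite mulrC; apply => x /andP[tx xt].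
have x0 : 0 <= x by rewrite ltW// (le_lt_trans t0).
rewrite drhoE//; have th0 : 0 <= t + h by rewrite addr_ge0// ltW.
have := hL _ _ _ (hr _ th0) (hr _ x0) (lip _ _ x0 xt) => /l1leN/l1leW H.
have /H : e / 2 + L * ((t + h - x) * CF) <= e.
  have hx : t + h - x <= e / 2 / (CF * L + 1) by lra.
  rewrite ler_pdivlMr// in hx; lra.
by apply: l1le_ext => i; rewrite opprB.
Qed.

(** A backward step ending at [t] gives the left derivative at once. A step starting at [t] involves
    the velocity at [s], which is exchanged for that at [t] by continuity of the velocity along the
    curve. *)
Lemma uniform_step_C1 rho : (forall t, 0 <= t -> pdens (rho t)) ->
  uniform_step G Psi rho ->
  C1_curve G `[0, +oo[%classic rho (fun t => F (rho t)).
Proof.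
move=> hr ur; apply/(C1_curveP hG) => t t0 e e0.
have e20 : 0 < e / 2 by rewrite divr_gt0.
have e40 : 0 < e / 4 by rewrite divr_gt0.
have [L L0 hL] := fp_modulus hG hb C_ge0 hC e40.
have [h0 h00 hs] := ur _ e20; have [h1 h10 hs1] := ur _ ltr01.
have CF0 : 0 <= CF by rewrite mulr_ge0// addr_ge0.
have CL : 0 < (1 + CF) * L + 1.
  by rewrite ltr_wpDl// mulr_ge0 ?(ltW L0)// addr_ge0.
have lip x h : 0 <= x -> 0 <= h <= h1 ->
    l1le (fun i => rho (x + h) i - rho x i) (h * (1 + CF)).
  move=> x0 hh; have := hs1 x h x0 hh; have /andP[hh0 _] := hh.
  have xh : 0 <= x + h by rewrite addr_ge0.
  move=> /l1leD/(_ (l1leZ h (fp_l1 hG hb C_ge0 hC (hr _ xh)))).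
  rewrite ger0_norm// => /l1leW H.
  have /H : 1 * h + h * CF <= h * (1 + CF) by lra.
  by apply: l1le_ext => i; rewrite subrK.
have Fl x h : 0 <= x -> 0 <= h <= Num.min h1 (e / 4 / ((1 + CF) * L + 1)) ->
    l1le (fun i => F (rho (x + h)) i - F (rho x) i) (e / 2).
  move=> x0; rewrite le_min => /andP[hh0 /andP[hh1]].
  rewrite ler_pdivlMr// => hh2; have xh : 0 <= x + h by rewrite addr_ge0.
  have hh : 0 <= h <= h1 by rewrite hh0.
  have := hL _ _ _ (hr _ xh) (hr _ x0) (lip x h x0 hh); apply: l1leW; lra.
exists (Num.min h0 (Num.min h1 (e / 4 / ((1 + CF) * L + 1)))).
  by rewrite !lt_min h00 h10 divr_gt0.
have [d dE] : exists d, d = Num.min h1 (e / 4 / ((1 + CF) * L + 1)) by eexists.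
rewrite -dE in Fl *.
move=> s s0; rewrite lt_min => /andP[/ltW sh0 /ltW sd].
have [ts|/ltW st] := leP t s.
  rewrite ger0_norm ?subr_ge0// in sh0 sd *.
  have ss : t + (s - t) = s by ring.
  have st0 : 0 <= s - t by rewrite subr_ge0.
  have hF := Fl t (s - t) t0; rewrite st0 sd ss in hF; have {}hF := hF isT.
  split; last by apply: l1leW hF; lra.
  have := hs t (s - t) t0; rewrite st0 sh0 ss => /(_ isT) h.
  have := l1leD h (l1leZ (s - t) hF); rewrite ger0_norm// => /l1leW H.
  have /H : e / 2 * (s - t) + (s - t) * (e / 2) <= e * (s - t) by lra.
  by apply: l1le_ext => i; ring.
rewrite distrC ger0_norm ?subr_ge0// in sh0 sd *.
have ss : s + (t - s) = t by ring.
have st0 : 0 <= t - s by rewrite subr_ge0.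
have hF := Fl s (t - s) s0; rewrite st0 sd ss in hF; have {}hF := hF isT.
split.
  have := hs s (t - s) s0; rewrite st0 sh0 ss => /(_ isT)/l1leN/l1leW H.
  have /H : e / 2 * (t - s) <= e * (t - s) by rewrite ler_wpM2r//; lra.
  by apply: l1le_ext => i; ring.
have hle : e / 2 <= e by lra.
by apply: (l1le_ext _ (l1leW hle (l1leN hF))) => i; rewrite opprB.
Qed.

Lemma gdist_ge0 i j : 0 <= gdist G i j.
Proof.
have [h|/set0P h] := eqVneq [set ((size s)%:R : R) | s in gpath G i j] set0.
  (* Without paths the infimum is 0 by convention. *)
  by rewrite /gdist h inf0.
by apply: lb_le_inf => // _ [s _ <-].
Qed.

Lemma gdist_adj i j k : gconnected G -> adj G j k -> gdist G i k <= gdist G i j + 1.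
Proof.
move=> hc jk; rewrite -lerBlDr; apply: lb_le_inf.
  by have [s hs] := hc i j; exists (size s)%:R; exists s.
move=> _ [s [p l] <-]; rewrite lerBlDr natr1; apply: ge_inf.
  by exists 0 => _ [s' _ <-].
exists (rcons s k); last by rewrite size_rcons.
by split; [rewrite rcons_path p l|rewrite last_rcons].
Qed.

(** The origin of the factor 3 in the weight condition of [fp_upper]. *)
Lemma gdist_sq_adj i j k : gconnected G -> adj G j k ->
  1 + gdist G i k ^+ 2 <= 3 * (1 + gdist G i j ^+ 2).
Proof.
move=> hc jk; have h1 := gdist_adj i hc jk.
have h2 := gdist_ge0 i k; have h3 := gdist_ge0 i j.
have : gdist G i k ^+ 2 <= (gdist G i j + 1) ^+ 2.
  by rewrite lerXn2r// nnegrE addr_ge0.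
have := sqr_ge0 (gdist G i j - 1); have := sqr_ge0 (gdist G i j).
lra.
Qed.

Lemma nneseries_vsum (f : nat -> R) c : (forall i, 0 <= f i) -> absum_le f c ->
  (\sum_(i <oo) (f i)%:E = (vsum f)%:E)%E.
Proof.
move=> f0 /absum_le_cvg hf; rewrite /vsum -EFin_lim//.
by apply: congr_lim; apply/funext => n; rewrite /= sumEFin.
Qed.

Lemma dens0P rho : dens0 G rho <-> pdens rho.
Proof.
split=> [[[_ h] r0]|[r0 r1 rm]].
  have r0' i : 0 <= rho i * mu i by rewrite mulr_ge0 ?(vmeas_ge0 hG)// ltW.
  have r1 : absum_le (fun i => rho i * mu i) 1.
    have /(nneseries_leP _ r0') h' : (\sum_(i <oo) (rho i * mu i)%:E <= 1%:E)%E by rewrite h.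
    move=> N; rewrite (eq_bigr (fun i => rho i * mu i)) => [|i _]; first exact: h'.
    by rewrite ger0_norm.
  split=> //; first by apply: absum_le_le r1 => i; rewrite mulrC.
  have := nneseries_vsum r0' r1; rewrite h => -[e].
  by rewrite [RHS]e; apply: vsum_ext => i; rewrite mulrC.
split=> //; split=> [i|]; first exact: ltW.
rewrite -[RHS]/(1%:E) -rm -(nneseries_vsum _ r1).
  by apply: eq_eseriesr => i _; rewrite mulrC.
by move=> i; rewrite mulr_ge0 ?(vmeas_ge0 hG)// ltW.
Qed.

(** The weight is [1 + d^2] because [d^2] vanishes at the base vertex and is not comparable with its
    values at the neighbours. *)
Lemma dens0sP rho : dens0s G rho <->
  pdens rho /\ exists c, l1le (fun i => (1 + gdist G 0 i ^+ 2) * rho i) c.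
Proof.
rewrite /dens0s/= dens0P; split=> -[hr h]; have [r0 r1 _] := hr; split=> //.
  have g0 i : 0 <= gdist G 0 i ^+ 2 * rho i * mu i.
    by rewrite mulr_ge0 ?(vmeas_ge0 hG)// mulr_ge0 ?sqr_ge0// ltW.
  move/(nneseries_finP g0): h => [c hc]; exists (1 + c).
  have hc' : l1le (fun i => gdist G 0 i ^+ 2 * rho i) c.
    move=> N; rewrite (eq_bigr (fun i => gdist G 0 i ^+ 2 * rho i * mu i)) => [|i _].
      exact: hc.
    by rewrite mulrC ger0_norm.
  by apply: l1le_ext (l1leD r1 hc') => i; rewrite mulrDl mul1r.
move: h => [c hc].
apply/nneseries_finP => [i|].
  by rewrite mulr_ge0 ?(vmeas_ge0 hG)// mulr_ge0 ?sqr_ge0// ltW.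
exists c => N; apply: le_trans (hc N); apply: le_sum_nat => i _.
apply: le_trans (ler_norm _) _; rewrite mulrC normrM [leRHS]normrM ler_wpM2l//.
rewrite normrM [leRHS]normrM ler_wpM2r//.
have g0 := sqr_ge0 (gdist G 0 i).
by rewrite (ger0_norm g0) ger0_norm ?addr_ge0// lerDr.
Qed.

Lemma fp_global rho0 : gconnected G -> dens0s G rho0 ->
  exists2 rho : R -> nat -> R, global_solution G Psi rho0 rho &
    forall rho', global_solution G Psi rho0 rho' ->
    forall t, 0 <= t -> rho' t = rho t.
Proof.
move=> hc /dens0sP[h0 [c hV]].
have [rho [r0 rd ru rV]] := fp_flow hG hb C_ge0 hC h0.
exists rho.
  exists (fun t => F (rho t)); last by split.
  split; first exact: uniform_step_C1.
  move=> t t0; apply/dens0sP; split; first exact: rd.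
  apply: rV hV t t0 => [i|i j]; first by rewrite addr_ge0// sqr_ge0.
  by rewrite (adj_sym hG) => /gdist_sq_adj; exact.
move=> rho' [drho [hc' hd] [fp r'0]] t t0.
have rd' s : 0 <= s -> pdens (rho' s) by move=> /hd[/dens0P].
apply: uniform_step_unique => //; first by rewrite r0.
exact: solution_uniform_step hc' rd' fp.
Qed.

End Solutions.

(** * Convergence to the Gibbs density *)

Section Convergence.
Context {R : realType}.
Variable G : wgraph R.
Hypothesis hG : weighted_graph G.
Local Notation w := (wt G).
Local Notation mu := (vmeas G).
Local Notation l1le := (l1le G).
Local Notation pdens := (pdens G).
Variable b : nat -> nat.
Hypothesis hb : forall i j, adj G i j -> (j < b i)%N.
Variables (Psi : nat -> R) (C : R).
Hypotheses (C_ge0 : 0 <= C) (hC : forall i j, `|grad G Psi i j| <= C).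
Local Notation F := (fp_rhs G Psi).
Local Notation rsum := (rowsum w b).
Local Notation gs := (gibbs G Psi).
Hypothesis gs_dens : pdens gs.

Let gs_gt0 i : 0 < gs i. Proof. by case: gs_dens. Qed.

(** The normalisation cancels in differences, so the flux has the sign of the difference of the
    ratios [rho / gs]. *)
Lemma fpflux_gibbs rho i j : (forall i, 0 < rho i) ->
  fpflux Psi rho i j =
  (ln (rho j / gs j) - ln (rho i / gs i)) * logmean (rho i) (rho j).
Proof.
move=> r0; rewrite (fpflux_lflux _ _ _ r0) /lflux; congr (_ * _).
have Z0 : 0 < partition_fun G Psi.
  have := gs_gt0 0%N; rewrite /gibbs pmulr_rgt0 ?expR_gt0// invr_gt0//.
have lng k : ln (gs k) = - Psi k - ln (partition_fun G Psi).
  by rewrite /gibbs ln_div ?posrE ?expR_gt0// expRK.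
have lnd k : ln (rho k / gs k) = ln (rho k) - ln (gs k) by rewrite ln_div ?posrE.
by rewrite !lnd !lng; ring.
Qed.

(** [g] stands for [phi' (rho / gs)] with [phi] convex: it is ordered like the ratios, hence
    opposite in sign to the flux on every edge. *)
Lemma gibbs_subgradient (g : nat -> R) rho : pdens rho -> (forall i, `|g i| <= 3) ->
  (forall i j, 0 < w i j -> rho i / gs i <= rho j / gs j -> g i <= g j) ->
  vsum (fun i => mu i * (g i * F rho i)) <= 0.
Proof.
move=> hr gb gm; have [r0 _ _] := hr.
have e i : mu i * (g i * F rho i) = rsum (fun i j => g i * fpflux Psi rho i j) i.
  by rewrite rowsumZ -(fp_rhsE hG hb)// mulrCA.
rewrite (vsum_ext e).
have hX := flux_le_mul (wt_ge0 hG) (fun i _ => gb i) (fpflux_le hG hb C_ge0 hC hr).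
apply: (edge_sum_le0 (wt_sym hG) (wt_ge0 hG) (wt_row hG hb) hX) => i j ij.
rewrite (fpflux_anti Psi rho i j) mulrN -mulrBl fpflux_gibbs//.
have T0 : 0 < logmean (rho i) (rho j) by exact: logmean_gt0.
have p k : 0 < rho k / gs k by rewrite divr_gt0.
rewrite mulrA pmulr_lle0//.
have ji : 0 < w j i by rewrite (wt_sym hG).
have [h|/ltW h] := leP (rho i / gs i) (rho j / gs j).
  by rewrite mulr_le0_ge0 ?subr_le0 ?subr_ge0 ?ler_ln ?posrE//; exact: gm.
by rewrite mulr_ge0_le0 ?subr_le0 ?subr_ge0 ?ler_ln ?posrE//; exact: gm.
Qed.

(** No time derivative of the functional is taken: the subgradient inequality at the new point is
    added up over equal backward steps, and the total defect vanishes with the mesh. The rate [k]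
    may be 0, which gives monotonicity. *)
Lemma lyapunov (phi g : nat -> R -> R) (rho : R -> nat -> R) (k : R) :
  (forall t, 0 <= t -> pdens (rho t)) -> uniform_step G Psi rho ->
  (forall i r, `|g i r| <= 3) ->
  (forall i r r', 0 < r -> 0 < r' -> phi i r' <= phi i r + g i r' * (r' - r)) ->
  (forall t, 0 <= t -> exists c, l1le (fun i => phi i (rho t i)) c) ->
  (forall t, 0 <= t ->
    vsum (fun i => mu i * (g i (rho t i) * F (rho t) i)) <= - k) ->
  forall s t, 0 <= s -> s <= t ->
  vsum (fun i => mu i * phi i (rho t i)) <=
    vsum (fun i => mu i * phi i (rho s i)) - k * (t - s).
Proof.
move=> hr ur gb tang summ diss s t s0 st.
pose Phi x := vsum (fun i => mu i * phi i (rho x i)).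
rewrite -/(Phi t) -/(Phi s).
have step e h x : 0 <= x -> 0 <= h -> fp_step G Psi e h (rho x) (rho (x + h)) ->
    Phi (x + h) <= Phi x - k * h + 3 * (e * h).
  move=> x0 h0 hs; have xh : 0 <= x + h by rewrite addr_ge0.
  have [c1 s1] := summ _ x0; have [c2 s2] := summ _ xh.
  pose gg i := g i (rho (x + h) i).
  have sD := l1le_bmul (fun i => gb i (rho (x + h) i)) (fp_l1 hG hb C_ge0 hC (hr _ xh)).
  have sE := l1le_bmul (fun i => gb i (rho (x + h) i)) hs.
  have : Phi (x + h) <= Phi x +
      h * vsum (fun i => mu i * (gg i * F (rho (x + h)) i)) +
      vsum (fun i => mu i * (gg i * (rho (x + h) i - rho x i - h * F (rho (x + h)) i))).
    rewrite -(vsumZ h sD) -(vsumD s1 (absum_leZ h sD)).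
    rewrite -(vsumD (absum_leD s1 (absum_leZ h sD)) sE).
    apply: (vsum_le s2 (absum_leD (absum_leD s1 (absum_leZ h sD)) sE)) => i.
    have [r0 _ _] := hr _ x0; have [r0' _ _] := hr _ xh.
    have := tang i _ _ (r0 i) (r0' i) => /(ler_wpM2l (vmeas_ge0 hG i))/le_trans; apply.
    by rewrite /gg le_eqVlt; apply/orP; left; apply/eqP; ring.
  have := diss _ xh => /(ler_wpM2l h0).
  have := vsum_norm_le sE => /(le_trans (ler_norm _)); rewrite -/gg.
  rewrite /gg; lra.
apply/ler_addgt0Pl => e e0.
have T0 : 0 <= t - s by rewrite subr_ge0.
have T1 : 0 < 3 * (t - s + 1) by rewrite mulr_gt0// ltr_wpDl.
have e1 : 0 < e / (3 * (t - s + 1)) by rewrite divr_gt0.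
have [h0 h00 hs] := ur _ e1.
have [n] := exists_small_step T0 h00; set h := _ / _ => hh.
have hn : h * n.+1%:R = t - s by rewrite /h divfK// gt_eqF// ltr0n.
have /andP[hh0 _] := hh.
have iter m : Phi (s + h * m%:R) <=
    Phi s + m%:R * (- (k * h) + 3 * (e / (3 * (t - s + 1)) * h)).
  elim: m => [|m IH]; first by rewrite mulr0 addr0 mul0r addr0.
  have x0 : 0 <= s + h * m%:R by rewrite addr_ge0// mulr_ge0.
  have := step _ h _ x0 hh0 (hs _ _ x0 hh).
  have -> : s + h * m%:R + h = s + h * m.+1%:R by rewrite -(natr1 m); ring.
  move: IH; rewrite -(natr1 m); lra.
have := iter n.+1; rewrite hn (_ : s + (t - s) = t); last by ring.
move=> /le_trans; apply.
have [D eD] : exists D, D = t - s + 1 by eexists.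
have D0 : 0 < D by rewrite eD ltr_wpDl.
rewrite -eD.
have -> : n.+1%:R * (- (k * h) + 3 * (e / (3 * D) * h)) =
   - (k * (h * n.+1%:R)) + 3 * (e / (3 * D)) * (h * n.+1%:R) by ring.
have -> : 3 * (e / (3 * D)) * (h * n.+1%:R) = e * (h * n.+1%:R / D).
  by field; rewrite gt_eqF.
rewrite hn.
have : e * ((t - s) / D) <= e.
  by rewrite ler_piMr ?(ltW e0)// ler_pdivrMr// mul1r eD lerDl.
lra.
Qed.

(** This is [gs * phi (r / gs)] with [phi x = (x - L)^+]. *)
Definition excess (L : R) (i : nat) (r : R) : R := r - Num.min r (L * gs i).

Lemma excess_ge0 L i r : 0 <= excess L i r.
Proof. by rewrite /excess subr_ge0 ge_min lexx. Qed.

Lemma excess_le L i r : 0 <= L -> 0 <= r -> `|excess L i r| <= `|r|.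
Proof.
move=> L0 r0; rewrite ger0_norm ?excess_ge0// ger0_norm// /excess.
by rewrite lerBlDr lerDl le_min r0 mulr_ge0// ltW.
Qed.

(** * Lyapunov functionals along a solution *)

Section Flow.
Variable rho : R -> nat -> R.
Hypotheses (rho_dens : forall t, 0 <= t -> pdens (rho t))
  (rho_step : uniform_step G Psi rho).

Lemma excess_nonincr (L s t : R) : 0 <= L -> 0 <= s -> s <= t ->
  vsum (fun i => mu i * excess L i (rho t i)) <=
  vsum (fun i => mu i * excess L i (rho s i)).
Proof.
move=> L0 s0 st; pose g i (r : R) : R := if L < r / gs i then 1 else 0.
have gb i r : `|g i r| <= 3 by rewrite /g; case: ifP => _; rewrite ?normr1 ?normr0//; lra.
rewrite -[leRHS]subr0 -(mul0r (t - s)).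
apply: (lyapunov (g := g) rho_dens rho_step gb) => //.
- move=> i r r' r0 r0'; rewrite /excess /g ltr_pdivlMr//.
  have [h1|h1] := ltP (L * gs i) r'; have [h2|h2] := ltP (L * gs i) r;
    rewrite /Num.min; do 2?case: ltP; lra.
- move=> x x0; have [r0 r1 _] := rho_dens x0; exists 1.
  by apply: l1le_le r1 => // i; apply: excess_le => //; exact: ltW.
- move=> x x0; rewrite oppr0; apply: gibbs_subgradient => [|i|i j ij]; [exact: rho_dens|exact: gb|].
  rewrite /g => hx; case: ifP => h1; last by case: ifP.
  by rewrite (lt_le_trans h1 hx).
Qed.

(** The mass far out is at most the excess over [L * gs] plus [L] times a tail of the Gibbs density.
    The excess is small at time 0 for large [L] and never increases; [N] is chosen after [L]. *)
Lemma fp_tight (e : R) : 0 < e -> exists N, forall t M, 0 <= t ->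
  \sum_(N <= i < M) mu i * rho t i <= e.
Proof.
move=> e0; have [r0 r1 rm] := rho_dens (lexx 0).
have e20 : 0 < e / 2 by rewrite divr_gt0.
have dom (L : nat) i : `|mu i * Num.min (rho 0 i) (L%:R * gs i)| <= `|mu i * rho 0 i|.
  rewrite !normrM ler_wpM2l// ger0_norm ?gtr0_norm//.
    by rewrite ge_min lexx.
  by rewrite le_min ltW//= mulr_ge0// ltW.
have ev i : \forall L \near \oo,
    mu i * Num.min (rho 0 i) (L%:R * gs i) = mu i * rho 0 i.
  exists (Num.truncn (rho 0 i / gs i)).+1 => // L /= hL.
  congr (_ * _); apply/min_idPl; rewrite -ler_pdivrMr// ltW//.
  apply: (lt_le_trans (truncnS_gt _)); by rewrite ler_nat.
have [L _ /(_ L (leqnn L))] := vsum_eventually r1 e20 dom ev.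
rewrite rm distrC => /(le_trans (ler_norm _)) hL.
have sx : absum_le (fun i => mu i * Num.min (rho 0 i) (L%:R * gs i)) 1.
  exact: absum_le_le (dom L) r1.
have ex0 : vsum (fun i => mu i * excess L%:R i (rho 0 i)) <= e / 2.
  rewrite (vsum_ext (v := fun i => mu i * rho 0 i - mu i * Num.min (rho 0 i) (L%:R * gs i))).
    by rewrite (vsumB r1 sx) rm.
  by move=> i; rewrite /excess mulrBr.
have L10 : 0 < e / 2 / (L%:R + 1) by rewrite divr_gt0// ltr_wpDl.
have [_ g1 _] := gs_dens.
have [N hN] := absum_tail g1 L10; exists N => t M t0.
have [t0' t1 _] := rho_dens t0.
have := excess_nonincr (ler0n _ L) (lexx 0) t0 => /le_trans/(_ ex0) hx.
have st : absum_le (fun i => mu i * excess L%:R i (rho t i)) 1.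
  apply: absum_le_le t1 => i; rewrite !normrM ler_wpM2l// excess_le//.
  exact: ltW.
have [MN|/ltnW NM] := leqP M N; first by rewrite big_geq// ltW.
have h1 : \sum_(N <= i < M) mu i * excess L%:R i (rho t i) <= e / 2.
  apply: le_trans hx; apply: (@le_trans _ _ (\sum_(0 <= i < M) mu i * excess L%:R i (rho t i))).
    rewrite [leRHS](sum_cut _ NM) lerDr; apply: sumr_ge0 => i _.
    by rewrite mulr_ge0 ?(vmeas_ge0 hG)// excess_ge0.
  apply: (sum_le_vsum M st) => i.
  by rewrite mulr_ge0 ?(vmeas_ge0 hG)// excess_ge0.
have h2 : \sum_(N <= i < M) L%:R * `|mu i * gs i| <= e / 2.
  rewrite -mulr_sumr; have := hN M; rewrite ler_pdivlMr ?ltr_wpDl//.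
  have : 0 <= \sum_(N <= i < M) `|mu i * gs i| by exact: sumr_ge0.
  lra.
have -> : e = e / 2 + e / 2 by field.
apply: le_trans (lerD h1 h2); rewrite -big_split/=; apply: le_sum_nat => i _.
rewrite normrM (ger0_norm (vmeas_ge0 hG i)) gtr0_norm// mulrCA -mulrDr.
rewrite ler_wpM2l ?(vmeas_ge0 hG)// /excess.
have : Num.min (rho t i) (L%:R * gs i) <= L%:R * gs i by rewrite ge_min lexx orbT.
lra.
Qed.

(** From [|x| = 2 x^+ - x] and equality of the masses, the distance is twice the excess at level
    1. *)
Lemma l1_dist_nonincr (s t e : R) : 0 <= s -> s <= t ->
  l1le (fun i => rho s i - gs i) e -> l1le (fun i => rho t i - gs i) e.
Proof.
move=> s0 st hs; have t0 := le_trans s0 st.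
have [_ g1 gm] := gs_dens.
have key x : 0 <= x -> vsum (fun i => mu i * `|rho x i - gs i|) =
    2 * vsum (fun i => mu i * excess 1 i (rho x i)).
  move=> x0; have [r0 r1 rm] := rho_dens x0.
  have sx : absum_le (fun i => mu i * excess 1 i (rho x i)) 1.
    apply: absum_le_le r1 => i; rewrite !normrM ler_wpM2l// excess_le//.
    exact: ltW.
  rewrite -(vsumZ 2 sx).
  have -> : vsum (fun i => 2 * (mu i * excess 1 i (rho x i))) =
     vsum (fun i => 2 * (mu i * excess 1 i (rho x i))) -
     (vsum (fun i => mu i * rho x i) - vsum (fun i => mu i * gs i)).
    by rewrite rm gm subrr subr0.
  rewrite -(vsumB r1 g1) -(vsumB (absum_leZ 2 sx) (absum_leB r1 g1)).
  apply: vsum_ext => i; rewrite /excess mul1r -mulrBr mulrCA -mulrBr; congr (_ * _).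
  have [h|h] := leP (rho x i) (gs i).
    by rewrite ler0_norm ?subr_le0//; ring.
  by rewrite gtr0_norm ?subr_gt0//; ring.
have [r0 r1 _] := rho_dens t0.
have sd : absum_le (fun i => mu i * `|rho t i - gs i|) (1 + 1).
  apply: absum_le_le (l1leB r1 g1) => i; by rewrite !normrM normr_id.
have h : vsum (fun i => mu i * `|rho t i - gs i|) <= e.
  rewrite key//; have := excess_nonincr ler01 s0 st.
  move=> /(ler_wpM2l (ler0n R 2))/le_trans; apply.
  rewrite -key//; apply: le_trans (ler_norm _) _; apply: vsum_norm_le.
  by apply: absum_le_le hs => i; rewrite !normrM normr_id.
apply: absum_leW h _ => N.
have := sum_le_vsum N sd (fun i => mulr_ge0 (vmeas_ge0 hG i) (normr_ge0 _)).
apply: le_trans; apply: le_sum_nat => i _.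
by rewrite normrM (ger0_norm (vmeas_ge0 hG i)).
Qed.

(** Equal to [1 / (1 + x)] for the ratio [x = rho / gs], so that [- y ^+ 2] is the derivative of the
    functional to be dissipated, and constancy of [y] characterises multiples of the Gibbs
    density. *)
Local Notation y t i := (gs i / (gs i + rho t i)).

Lemma gibbs_share_itv t i : 0 <= t -> 0 < y t i <= 1.
Proof.
move=> t0; have [r0 _ _] := rho_dens t0.
have p : 0 < gs i + rho t i by rewrite addr_gt0.
apply/andP; split; first exact: divr_gt0.
by rewrite ler_pdivrMr// mul1r lerDl ltW.
Qed.

(** If [x i <= x j], then [y i ^+ 2 - y j ^+ 2 >= (y i - y j) ^+ 2], while the flux is at least the
    minimum of [gs] times [x j - x i], which exceeds [y i - y j]. The cubic form needs no bounds on
    the density. *)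
Lemma gibbs_share_edge (t : R) i j : 0 <= t ->
  Num.min (gs i) (gs j) * `|y t i - y t j| ^+ 3 <=
  (y t i ^+ 2 - y t j ^+ 2) * fpflux Psi (rho t) i j.
Proof.
move=> t0; have [r0 _ _] := rho_dens t0.
pose x k := rho t k / gs k.
have x0 k : 0 < x k by rewrite divr_gt0.
have ey k : y t k = (1 + x k)^-1.
  by rewrite /x; field; rewrite !gt_eqF// ?addr_gt0.
have er k : rho t k = x k * gs k by rewrite /x divfK// gt_eqF.
have key i' j' : x i' <= x j' ->
    Num.min (gs i') (gs j') * `|y t i' - y t j'| ^+ 3 <=
    (y t i' ^+ 2 - y t j' ^+ 2) * fpflux Psi (rho t) i' j'.
  move=> xij; rewrite fpflux_gibbs// -/(x i') -/(x j').
  set c := Num.min _ _; have c0 : 0 < c by rewrite lt_min !gs_gt0.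
  have hJ : c * (x j' - x i') <= (ln (x j') - ln (x i')) * logmean (rho t i') (rho t j').
    rewrite -(logmean_mul_ln (x0 i') (x0 j')) mulrA [leRHS]mulrC ler_wpM2r//.
      by rewrite subr_ge0 ler_ln ?posrE.
    rewrite -logmean_hom//; apply: logmean_homo; rewrite ?(mulr_gt0 c0 (x0 _))//.
      by rewrite er mulrC ler_pM2l// ge_min lexx.
    by rewrite er mulrC ler_pM2l// ge_min lexx orbT.
  rewrite !ey; set u := (1 + x i')^-1; set v := (1 + x j')^-1.
  have a1 : 1 <= 1 + x i' by rewrite lerDl ltW.
  have b1 : 1 <= 1 + x j' by rewrite lerDl ltW.
  have u0 : 0 < u <= 1.
    have p := lt_le_trans ltr01 a1.
    by apply/andP; split; [rewrite invr_gt0|rewrite invf_le1].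
  have v0 : 0 < v <= 1.
    have p := lt_le_trans ltr01 b1.
    by apply/andP; split; [rewrite invr_gt0|rewrite invf_le1].
  have vu : v <= u by rewrite lef_pV2 ?posrE ?(lt_le_trans ltr01)// lerD2l.
  have xd : u - v <= x j' - x i'.
    have -> : u - v = (x j' - x i') * (u * v).
      rewrite /u /v; field; rewrite !gt_eqF//; exact: lt_le_trans ltr01 _.
    by rewrite ler_piMr ?subr_ge0// mulr_ile1; lra.
  have d0 : 0 <= u - v by rewrite subr_ge0.
  rewrite ger0_norm//.
  have h2 : (u - v) ^+ 2 <= u ^+ 2 - v ^+ 2.
    have -> : u ^+ 2 - v ^+ 2 = (u - v) * (u + v) by ring.
    by rewrite expr2 ler_wpM2l//; lra.
  have h3 : c * (u - v) <= c * (x j' - x i') by rewrite ler_wpM2l// ltW.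
  have h4 := le_trans h3 hJ.
  have -> : c * (u - v) ^+ 3 = (u - v) ^+ 2 * (c * (u - v)) by ring.
  by rewrite ler_pM// ?sqr_ge0// mulr_ge0// ltW.
have [h|/ltW h] := leP (x i) (x j); first exact: key.
rewrite minC distrC (fpflux_anti Psi (rho t) j i) mulrN -mulNr opprB.
exact: key.
Qed.

(** No edge contributes with the wrong sign, so a gap on one edge already bounds the total
    dissipation. *)
Lemma gibbs_share_dissipation (t d c : R) i0 j0 : 0 <= t -> 0 <= c -> 0 <= d ->
  c <= gs i0 -> c <= gs j0 -> adj G i0 j0 -> d <= `|y t i0 - y t j0| ->
  vsum (fun i => mu i * (- (y t i) ^+ 2 * F (rho t) i)) <= - (w i0 j0 * (c * d ^+ 3)).
Proof.
move=> t0 c0 d0 ci cj ij hd; have [r0 _ _] := rho_dens t0.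
have yb i : `|- (y t i) ^+ 2| <= 3.
  have h := gibbs_share_itv i t0.
  rewrite normrN ger0_norm ?sqr_ge0//; move: h; set z := y t i => h.
  have : z ^+ 2 <= 1 by nra.
  lra.
pose X i j := - (y t i) ^+ 2 * fpflux Psi (rho t) i j.
pose k := c * d ^+ 3.
(* [Q] puts the claimed gain on one orientation of one edge; [X - Q] still has the sign required by
   [edge_sum_le0]. *)
pose Q i j := if (i == i0) && (j == j0) then - k else 0.
have eX i : mu i * (- (y t i) ^+ 2 * F (rho t) i) = rsum X i.
  by rewrite /X rowsumZ -(fp_rhsE hG hb)// mulrCA.
rewrite (vsum_ext eX).
have hX : flux_le w b X (3 * ((1 + C) * (2 * 1))).
  exact: (flux_le_mul (wt_ge0 hG) (fun i _ => yb i) (fpflux_le hG hb C_ge0 hC (rho_dens t0))).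
have Q0 i : (i0.+1 <= i)%N -> rsum (fun i j => `|Q i j|) i = 0.
  move=> ii; rewrite /rowsum big1// => j _.
  by rewrite /Q (gtn_eqF ii) normr0 mulr0.
have hQ := absum_fin_support Q0.
have Qi : vsum (rsum Q) = - (w i0 j0 * k).
  rewrite (vsum_fin_support (N := i0.+1)) => [|i ii]; last first.
    rewrite /rowsum big1// => j _; by rewrite /Q (gtn_eqF ii) mulr0.
  rewrite big_nat_recr//= big_nat big1 ?add0r => [|i /andP[_ ii]]; last first.
    rewrite /rowsum big1// => j _; by rewrite /Q (ltn_eqF ii) mulr0.
  rewrite /rowsum (bigD1_seq j0) ?iota_uniq//=; last by rewrite mem_index_iota/= hb.
  rewrite big1 ?addr0 => [|j /negPf jj]; last by rewrite /Q jj andbF mulr0.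
  by rewrite /Q !eqxx/= mulrN.
rewrite -/k -Qi -subr_le0.
have QX := flux_leB (wt_ge0 hG) hX hQ.
rewrite -(vsumB (absum_rowsum (wt_ge0 hG) hX) (absum_rowsum (wt_ge0 hG) hQ)).
rewrite (vsum_ext (v := rsum (fun i j => X i j - Q i j))); last first.
  by move=> i; rewrite rowsumB.
apply: (edge_sum_le0 (wt_sym hG) (wt_ge0 hG) (wt_row hG hb) QX) => i j wij.
have XX : X i j + X j i = - ((y t i ^+ 2 - y t j ^+ 2) * fpflux Psi (rho t) i j).
  by rewrite /X (fpflux_anti Psi (rho t) i j); ring.
have := gibbs_share_edge i j t0.
have m0 : 0 <= Num.min (gs i) (gs j) * `|y t i - y t j| ^+ 3.
  by rewrite mulr_ge0 ?exprn_ge0// le_min !ltW.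
have hk (c' d' : R) : c <= c' -> d <= d' -> k <= c' * d' ^+ 3.
  move=> cc dd; rewrite /k ler_pM ?exprn_ge0//.
  by rewrite lerXn2r ?nnegrE// (le_trans d0).
have i0j0 : i0 != j0 by apply: contraTneq ij => ->; rewrite (adj_irr hG).
rewrite /Q; have [/andP[/eqP ei /eqP ej]|_] := boolP ((i == i0) && (j == j0)).
  subst i j; rewrite (eq_sym j0) (negPf i0j0)/=.
  have /(hk _ _)/(_ hd) : c <= Num.min (gs i0) (gs j0) by rewrite le_min ci.
  lra.
have [/andP[/eqP ej /eqP ei]|_] := boolP ((j == i0) && (i == j0)).
  subst i j; rewrite distrC in hd.
  have /(hk _ _)/(_ hd) : c <= Num.min (gs j0) (gs i0) by rewrite le_min cj.
  lra.
lra.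
Qed.

Lemma path_oscillation (y : nat -> R) (d : R) (M : nat) : 0 <= d ->
  (forall i j, (i < M)%N -> (j < M)%N -> adj G i j -> `|y i - y j| <= d) ->
  forall s i, path (adj G) i s -> all (fun k => k < M)%N (i :: s) ->
  `|y (last i s) - y i| <= (size s)%:R * d.
Proof.
move=> d0 h; elim=> [|j s IH] i /=; first by rewrite subrr normr0 mul0r.
move=> /andP[ij js] /and3P[iM jM sM].
have := IH j js; rewrite /= jM sM => /(_ isT) h1.
have h2 := h i j iM jM ij; rewrite -natr1.
rewrite (_ : y (last j s) - y i = (y (last j s) - y j) - (y i - y j)); last by ring.
apply: le_trans (ler_normB _ _) _; lra.
Qed.

(** Finitely many paths join vertex 0 to the vertices below [N], and they stay below some [M]. Thus
    [M] and [d] depend on [N] and [e] but not on [y]. *)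
Lemma connected_oscillation (N : nat) (e : R) : gconnected G -> 0 < e ->
  exists M, exists2 d : R, 0 < d & forall y : nat -> R,
    (forall i j, (i < M)%N -> (j < M)%N -> adj G i j -> `|y i - y j| <= d) ->
    forall i, (i < N)%N -> `|y i - y 0%N| <= e.
Proof.
move=> hc e0; elim: N => [|N [M [d d0 IH]]]; first by exists 0%N, 1.
have [s [ps ls]] := hc 0%N N.
pose M' := (\max_(k <- 0%N :: s) k).+1.
exists (maxn M M'), (Num.min d (e / ((size s)%:R + 1))).
  by rewrite lt_min d0 divr_gt0// ltr_wpDl.
move=> y hy i; rewrite ltnS leq_eqVlt => /predU1P[->|iN]; last first.
  apply: IH iN => i' j' i'M j'M ij'.
  have := hy i' j'; rewrite !leq_max i'M j'M => /(_ isT isT ij').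
  by rewrite le_min => /andP[].
have d'0 : 0 <= e / ((size s)%:R + 1) by rewrite divr_ge0 ?addr_ge0// ltW.
have := @path_oscillation y (e / ((size s)%:R + 1)) M' d'0 _ s 0%N ps.
rewrite ls => H; apply: le_trans (H _ _) _.
- move=> i' j' i'M j'M ij'.
  have := hy i' j'; rewrite !leq_max i'M j'M !orbT => /(_ isT isT ij').
  by rewrite le_min => /andP[].
- apply/allP => k ks; rewrite ltnS; exact: leq_bigmax_seq.
rewrite mulrC -mulrA ler_piMr ?(ltW e0)// mulrC ler_pdivrMr ?ltr_wpDl// mul1r.
by rewrite lerDl.
Qed.

(** On the first [N] vertices [gs = y * (gs + rho)] with [y] almost constant, and equality of the
    masses up to tails forces [y] to be near 1/2. There [rho - gs = (1 - 2 y) * (gs + rho)] with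
    [|1 - 2 y| <= 5 e + 2 e]; mass at most 2 and two tails give [14 e + 2 e]. *)
Lemma near_gibbs (t e : R) N : 0 <= t -> 0 < e ->
  (forall M, \sum_(N <= i < M) mu i * rho t i <= e) ->
  (forall M, \sum_(N <= i < M) mu i * gs i <= e) ->
  (forall i, (i < N)%N -> `|y t i - y t 0%N| <= e) ->
  l1le (fun i => rho t i - gs i) (16 * e).
Proof.
move=> t0 e0 tr tg hy; have [r0 r1 rm] := rho_dens t0.
have [_ g1 gm] := gs_dens.
have mp := vmeas_gt0 hG.
have head (f : nat -> R) : (forall i, 0 < f i) -> l1le f 1 ->
    vsum (fun i => mu i * f i) = 1 ->
    (forall M, \sum_(N <= i < M) mu i * f i <= e) ->
    1 - e <= \sum_(0 <= i < N) mu i * f i <= 1.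
  move=> f0 f1 fm ft; apply/andP; split.
    rewrite lerBlDr -[leLHS]fm; apply: (vsum_le_near f1).
    exists N => // M /= NM; rewrite (sum_cut _ NM) lerD2l; exact: ft.
  by rewrite -[leRHS]fm; apply: (sum_le_vsum N f1) => i; rewrite mulr_ge0 ?(vmeas_ge0 hG)// ltW.
have hr := head _ r0 r1 rm tr; have hg := head _ gs_gt0 g1 gm tg.
set a := \sum_(0 <= i < N) mu i * rho t i in hr.
set g := \sum_(0 <= i < N) mu i * gs i in hg.
have y0 := gibbs_share_itv 0%N t0; set y0v := y t 0%N in y0 hy.
have yE i : gs i = y t i * (gs i + rho t i).
  by rewrite divfK// gt_eqF// addr_gt0.
have sE : \sum_(0 <= i < N) mu i * (gs i + rho t i) = g + a.
  by rewrite /g /a -big_split/=; apply: eq_bigr => i _; rewrite mulrDr.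
have p0 i : 0 <= mu i * (gs i + rho t i).
  by rewrite mulr_ge0 ?(vmeas_ge0 hG)// ltW// addr_gt0.
have ga0 : 0 <= g + a by rewrite -sE; apply: sumr_ge0 => i _.
have gy : `|g - y0v * (g + a)| <= e * (g + a).
  rewrite -sE !mulr_sumr /g -sumrB; apply: le_trans (norm_sum_nat _ _ _) _.
  rewrite big_nat [leRHS]big_nat; apply: ler_sum => i /andP[_ iN].
  rewrite [X in `|mu i * X - _|]yE.
  have -> : mu i * (y t i * (gs i + rho t i)) - y0v * (mu i * (gs i + rho t i)) =
     (y t i - y0v) * (mu i * (gs i + rho t i)) by ring.
  by rewrite normrM (ger0_norm (p0 i)) ler_wpM2r// hy.
have y5 : `|1 - 2 * y0v| <= 5 * e.
  move: gy; rewrite !ler_norml => /andP[q1 q2].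
  move: hr hg y0 => /andP[a1 a2] /andP[g1' g2] /andP[y1 y2].
  have := ler_wpM2l (ltW y1) a1; have := ler_wpM2l (ltW y1) a2.
  have := ler_wpM2l (ltW y1) g1'; have := ler_wpM2l (ltW y1) g2.
  have := ler_wpM2l (ltW e0) a2; have := ler_wpM2l (ltW e0) g2.
  have := ler_wpM2l (ltW e0) y2.
  by move=> *; apply/andP; split; lra.
have big M : (N <= M)%N -> \sum_(0 <= i < M) `|mu i * (rho t i - gs i)| <= 16 * e.
  move=> NM; rewrite (sum_cut _ NM).
  have h1 : \sum_(0 <= i < N) `|mu i * (rho t i - gs i)| <= 7 * e * (g + a).
    rewrite -sE mulr_sumr big_nat [leRHS]big_nat; apply: ler_sum => i /andP[_ iN].
    have -> : mu i * (rho t i - gs i) = (1 - 2 * y t i) * (mu i * (gs i + rho t i)).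
      by field; rewrite gt_eqF// addr_gt0.
    rewrite normrM (ger0_norm (p0 i)) ler_wpM2r//.
    have -> : 1 - 2 * y t i = (1 - 2 * y0v) - 2 * (y t i - y0v) by ring.
    apply: le_trans (ler_normB _ _) _; rewrite normrM (ger0_norm (ler0n _ 2)).
    have := hy i iN; lra.
  have h2 : \sum_(N <= i < M) `|mu i * (rho t i - gs i)| <= 2 * e.
    have -> : 2 * e = e + e by ring.
    apply: le_trans (lerD (tr M) (tg M)).
    rewrite -big_split/=; apply: le_sum_nat => i _.
    rewrite -mulrDr normrM (ger0_norm (ltW (mp i))) ler_wpM2l ?(ltW (mp i))//.
    by apply: le_trans (ler_normB _ _) _; rewrite !gtr0_norm.
  have : e * (g + a) <= e * 2 by rewrite ler_wpM2l ?(ltW e0)//; lra.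
  lra.
move=> M; have [MN|/ltnW/big//] := leqP M N.
by apply: le_trans (big N (leqnn N)); exact: le_sum_widen.
Qed.

(* Otherwise the entropy [sum pi gs^2 / (gs + rho)], which is nonnegative, would
   decrease at a rate bounded away from zero. *)
Lemma fp_reaches_gibbs (e : R) : gconnected G -> 0 < e ->
  exists2 T, 0 <= T & l1le (fun i => rho T i - gs i) e.
Proof.
move=> hc e0; apply: contrapT => hn.
have e1 : 0 < e / 16 by rewrite divr_gt0.
have [N1 hN1] := fp_tight e1.
have [_ g1 _] := gs_dens; have [N2 hN2] := absum_tail g1 e1.
pose N := maxn N1 N2.
have shrink (f : nat -> R) N' M : (forall i, 0 <= f i) -> (N' <= N)%N ->
    \sum_(N <= i < M) f i <= \sum_(N' <= i < M) f i.
  move=> f0 NN; have [MN|/ltnW NM] := leqP M N.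
    by rewrite big_geq//; exact: sumr_ge0.
  by rewrite [leRHS](big_cat_nat NN NM)/= lerDr; exact: sumr_ge0.
have tr t M : 0 <= t -> \sum_(N <= i < M) mu i * rho t i <= e / 16.
  move=> t0; have [r0 _ _] := rho_dens t0.
  apply: le_trans (hN1 t M t0); apply: shrink; last exact: leq_maxl.
  by move=> i; rewrite mulr_ge0 ?(vmeas_ge0 hG)// ltW.
have tg M : \sum_(N <= i < M) mu i * gs i <= e / 16.
  apply: le_trans (hN2 M); apply: (@le_trans _ _ (\sum_(N2 <= i < M) mu i * gs i)).
    apply: shrink; last exact: leq_maxr.
    by move=> i; rewrite mulr_ge0 ?(vmeas_ge0 hG)// ltW.
  by apply: le_sum_nat => i _; exact: ler_norm.
have [M [d d0 osc]] := connected_oscillation N hc e1.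
have [c c0 hcM] : exists2 c : R, 0 < c & forall i, (i < M)%N -> c <= gs i.
  elim: (M) => [|M' [c c0 IH]]; first by exists 1.
  exists (Num.min c (gs M')) => [|i]; first by rewrite lt_min c0 gs_gt0.
  rewrite ltnS leq_eqVlt => /predU1P[->|/IH h]; first by rewrite ge_min lexx orbT.
  by rewrite ge_min h.
have [w0 w00 hw] := wt_lbound hG.
pose k := w0 * (c * d ^+ 3).
have k0 : 0 < k by rewrite !mulr_gt0// exprn_gt0.
pose phi i (r : R) := gs i ^+ 2 / (gs i + r).
(* The cut at nonpositive [r] secures the bound that [lyapunov] asks for at every real. *)
pose g i (r : R) := if 0 < r then - (gs i / (gs i + r)) ^+ 2 else 0.
have gb i r : `|g i r| <= 3.
  rewrite /g; case: ifPn => [r0|_]; last by rewrite normr0.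
  have p : 0 < gs i + r by rewrite addr_gt0.
  have z1 : gs i / (gs i + r) <= 1 by rewrite ler_pdivrMr// mul1r lerDl ltW.
  have z0 : 0 < gs i / (gs i + r) by rewrite divr_gt0.
  rewrite normrN ger0_norm ?sqr_ge0//; set z := _ / _ in z0 z1 *; nra.
have tang i r r' : 0 < r -> 0 < r' -> phi i r' <= phi i r + g i r' * (r' - r).
  move=> r0 r'0; rewrite /phi /g r'0 -subr_ge0.
  have p : 0 < gs i + r by rewrite addr_gt0.
  have p' : 0 < gs i + r' by rewrite addr_gt0.
  have -> : gs i ^+ 2 / (gs i + r) + - (gs i / (gs i + r')) ^+ 2 * (r' - r) -
     gs i ^+ 2 / (gs i + r') =
     (gs i * (r' - r)) ^+ 2 / ((gs i + r) * (gs i + r') ^+ 2).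
    by field; rewrite !gt_eqF.
  by rewrite divr_ge0 ?sqr_ge0// mulr_ge0 ?sqr_ge0// ltW.
have phi0 t i : 0 <= t -> 0 <= phi i (rho t i) <= gs i.
  move=> t0; have [r0 _ _] := rho_dens t0.
  have p : 0 < gs i + rho t i by rewrite addr_gt0.
  rewrite /phi divr_ge0 ?sqr_ge0 ?(ltW p)//= ler_pdivrMr// expr2 ler_wpM2l ?ltW//.
  by rewrite ltrDl.
have sphi t : 0 <= t -> exists c, l1le (fun i => phi i (rho t i)) c.
  move=> t0; exists 1; apply: l1le_le g1 => // i.
  by have /andP[p1 p2] := phi0 t i t0; rewrite !ger0_norm// ltW.
have diss t : 0 <= t -> vsum (fun i => mu i * (g i (rho t i) * F (rho t) i)) <= - k.
  move=> t0; have [r0 _ _] := rho_dens t0.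
  have [i [j [iM jM ij hd]]] : exists i j, [/\ (i < M)%N, (j < M)%N, adj G i j &
      d <= `|y t i - y t j|].
    apply: contrapT => nex; apply: hn; exists t => //.
    have -> : e = 16 * (e / 16) by field.
    apply: (near_gibbs t0 e1 (fun M => tr t M t0) tg).
    apply: osc => i j iM jM ij; rewrite leNgt; apply/negP => /ltW hd.
    by apply: nex; exists i, j.
  rewrite (vsum_ext (v := fun i => mu i * (- (y t i) ^+ 2 * F (rho t) i))); last first.
    by move=> l; rewrite /g r0.
  apply: le_trans (gibbs_share_dissipation t0 (ltW c0) (ltW d0) (hcM i iM) (hcM j jM) ij hd) _.
  by rewrite lerN2 /k ler_wpM2r ?hw// mulr_ge0 ?exprn_ge0// ltW.
have := lyapunov rho_dens rho_step gb tang sphi diss (lexx 0).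
(* At this time the nonnegative functional would have fallen to -1. *)
pose T := (vsum (fun i => mu i * phi i (rho 0 i)) + 1) / k.
have ph0 t : 0 <= t -> 0 <= vsum (fun i => mu i * phi i (rho t i)).
  move=> t0; apply: vsum_ge0 => i; have /andP[p1 _] := phi0 t i t0.
  by rewrite mulr_ge0 ?(vmeas_ge0 hG).
have T0 : 0 <= T by rewrite divr_ge0 ?(ltW k0)// addr_ge0// ph0.
have kT : k * T = vsum (fun i => mu i * phi i (rho 0 i)) + 1.
  by rewrite /T mulrC divfK ?gt_eqF.
move=> /(_ T T0); rewrite subr0 kT.
have := ph0 _ T0; lra.
Qed.

Lemma fp_l1_converges (e : R) : gconnected G -> 0 < e ->
  exists2 T, 0 <= T & forall t, T <= t -> l1le (fun i => rho t i - gs i) e.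
Proof.
move=> hc /(fp_reaches_gibbs hc)[T T0 hT]; exists T => // t Tt.
exact: l1_dist_nonincr T0 Tt hT.
Qed.

End Flow.

(** A lower bound on the measure turns a small l^1 norm into a small sup norm; once [|f| <= 1], the
    powers satisfy [|f| ^ q <= |f|]. *)
Lemma lnorm_small (r : \bar R) (eta : R) : (2%:E <= r)%E -> 0 < eta ->
  exists2 e : R, 0 < e & forall f, l1le f e -> (lnorm G r f <= eta%:E)%E.
Proof.
move=> r2 eta0; have [m m0 hm] := vmeas_lbound hG.
have fb f e i : l1le f e -> `|f i| <= e / m.
  move=> /(l1le_pt hG i) h; rewrite ler_pdivlMr// mulrC; apply: le_trans h.
  by rewrite ler_wpM2r.
case: r r2 => [q|_|//]; last first.
  exists (eta * m); first by rewrite mulr_gt0.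
  move=> f hf; apply: ge_ereal_sup => _ [i _ <-]; rewrite lee_fin.
  by have := fb f _ i hf; rewrite mulfK// gt_eqF.
rewrite lee_fin => q2; have q0 : 0 < q by lra.
exists (Num.min m (eta `^ q)); first by rewrite lt_min m0 powR_gt0.
move=> f hf; have f1 i : `|f i| <= 1.
  have := fb f _ i (l1leW _ hf); move=> /(_ m); rewrite ge_min lexx divff ?gt_eqF//.
  exact.
have hs : (\sum_(i <oo) (mu i * `|f i| `^ q)%:E <= (eta `^ q)%:E)%E.
  apply/nneseries_leP => [i|N].
    by rewrite mulr_ge0 ?(vmeas_ge0 hG)// powR_ge0.
  have : l1le f (eta `^ q) by apply: l1leW hf; rewrite ge_min lexx orbT.
  move=> /(_ N); apply: le_trans; apply: le_sum_nat => i _.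
  rewrite normrM (ger0_norm (vmeas_ge0 hG i)) ler_wpM2l ?(vmeas_ge0 hG)//.
  have [->|fi] := eqVneq `|f i| 0; first by rewrite powR0 ?gt_eqF.
  by rewrite ge1r_powR ?f1 ?lt0r ?fi ?normr_ge0//=; lra.
rewrite /lnorm.
have -> : eta%:E = ((eta `^ q)%:E `^ q^-1)%E.
  by rewrite poweR_EFin -powRrM mulfV ?gt_eqF// powRr1// ltW.
apply: gt0_ler_poweR => //.
- by rewrite invr_ge0 ltW.
- rewrite in_itv/= leey andbT; apply: nneseries_ge0 => i _ _.
  by rewrite lee_fin mulr_ge0 ?(vmeas_ge0 hG)// powR_ge0.
- by rewrite in_itv/= leey andbT lee_fin powR_ge0.
Qed.

End Convergence.

(** * Summation by parts and the pseudo-inverse *)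

Section Truncation.
Context {R : realType}.
Implicit Types (M x y : R).

Definition clip M x : R := Num.max (- M) (Num.min x M).

Lemma clip_bound M x : 0 <= M -> `|clip M x| <= M.
Proof.
move=> M0; rewrite ler_norml /clip.
rewrite /Num.min; case: (ltP x M) => ?; rewrite /Num.max;
  by case: (ltP (- M) _) => ?; apply/andP; split; lra.
Qed.

Lemma clip_id M x : `|x| <= M -> clip M x = x.
Proof.
rewrite ler_norml /clip => /andP[h1 h2].
rewrite /Num.min; case: (ltP x M) => ?; rewrite /Num.max;
  by case: (ltP (- M) _) => ?; lra.
Qed.

Lemma clip_lip M x y : 0 <= M -> `|clip M x - clip M y| <= `|x - y|.
Proof.
move=> M0; have h1 := ler_norm (x - y); have h2 := ler_norm (y - x).
rewrite distrC in h2; rewrite ler_norml /clip /Num.min.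
case: (ltP x M) => ?; case: (ltP y M) => ?; rewrite /Num.max;
  by do 2?[case: (ltP (- M) _) => ?]; apply/andP; split; lra.
Qed.

Lemma clip_le M x : 0 <= M -> `|clip M x| <= `|x|.
Proof.
move=> M0; have := clip_lip x 0 M0.
by rewrite [clip M 0]clip_id ?normr0// !subr0.
Qed.

Lemma clip_mono M x y : 0 <= (x - y) * (clip M x - clip M y).
Proof.
have h (a c : R) : a <= c -> clip M a <= clip M c.
  move=> ac; rewrite /clip /Num.min.
  case: (ltP a M) => ?; case: (ltP c M) => ?; rewrite /Num.max;
    by do 2?[case: (ltP (- M) _) => ?]; lra.
have [xy|/ltW xy] := leP x y.
  by rewrite mulr_le0// subr_le0// h.
by rewrite mulr_ge0// subr_ge0// h.
Qed.

End Truncation.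

(** * Weak formulation and kernel of the operator [B_rho] *)

Section Riemannian.
Context {R : realType}.
Variable G : wgraph R.
Hypothesis hG : weighted_graph G.
Local Notation w := (wt G).
Local Notation mu := (vmeas G).
Local Notation l1le := (l1le G).
Local Notation pdens := (pdens G).
Variable b : nat -> nat.
Hypothesis hb : forall i j, adj G i j -> (j < b i)%N.
Local Notation rsum := (rowsum w b).
Local Notation wge0 := (wt_ge0 hG).
Variable rho : nat -> R.
Hypothesis rho_gt0 : forall i, 0 < rho i.

Let lm_gt0 i j : 0 < logmean (rho i) (rho j).
Proof. exact: logmean_gt0. Qed.

Definition energy (p q : nat -> R) (i j : nat) : R :=
  (p j - p i) * (q j - q i) * logmean (rho i) (rho j).

Lemma energyC p q i j : energy p q i j = energy q p i j.
Proof. by rewrite /energy (mulrC (p j - p i)). Qed.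

(** Boundedness of [q] makes [q i] times the flux summable; the edge function
    [2 * q i * flux + energy] is then antisymmetric. The 2 reflects that the energy counts both
    orientations. *)
Lemma parts_bounded p q c c' M : flux_le w b (lflux rho p) c ->
  flux_le w b (energy p q) c' -> (forall i, `|q i| <= M) ->
  2 * vsum (fun i => q i * rsum (lflux rho p) i) = - vsum (rsum (energy p q)).
Proof.
move=> hp he hq.
have hq' := flux_le_mul wge0 (fun i _ => hq i) hp.
have hX := flux_leD wge0 (flux_leZ wge0 2 hq') he.
have h0 : vsum (rsum (fun i j => 2 * (q i * lflux rho p i j) + energy p q i j)) = 0.
  apply: (edge_sum_eq0 (wt_sym hG) wge0 (wt_row hG hb) hX) => i j _.
  by rewrite (lflux_anti rho p i j) /energy /lflux (logmeanC (rho j)); ring.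
have e i : rsum (fun i j => 2 * (q i * lflux rho p i j) + energy p q i j) i =
    2 * (q i * rsum (lflux rho p) i) + rsum (energy p q) i.
  by rewrite rowsumD (rowsumZ w b (fun=> 2)) rowsumZ.
rewrite (vsum_ext e) in h0.
have hs : absum_le (fun i => q i * rsum (lflux rho p) i) (M * c).
  by apply: absum_le_le (absum_rowsum wge0 hq') => i; rewrite rowsumZ.
rewrite (vsumD (absum_leZ 2 hs) (absum_rowsum wge0 he)) (vsumZ 2 hs) in h0.
lra.
Qed.

(* Summation by parts for an unbounded [q]: truncate [q] at height [M], where no
   boundary term survives since the flux of [p] is summable, and let [M] go to
   infinity by dominated convergence. *)
Lemma parts p q c c' c'' : flux_le w b (lflux rho p) c ->
  flux_le w b (energy p q) c' ->
  absum_le (fun i => q i * rsum (lflux rho p) i) c'' ->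
  2 * vsum (fun i => q i * rsum (lflux rho p) i) = - vsum (rsum (energy p q)).
Proof.
move=> hp he hq.
pose qM (M : nat) i := clip M%:R (q i).
have ev i : \forall M \near \oo, forall j, (j < i)%N -> qM M j = q j.
  exists (Num.truncn (\sum_(0 <= j < i) `|q j|)).+1 => // M /= hM j ji.
  apply: clip_id; apply: (@le_trans _ _ (\sum_(0 <= j < i) `|q j|)).
    rewrite (bigD1_seq j) ?iota_uniq ?mem_index_iota//= lerDl.
    exact: sumr_ge0.
  by apply: (le_trans (ltW (truncnS_gt _))); rewrite ler_nat.
have dE M i j : `|energy p (qM M) i j| <= `|energy p q i j|.
  rewrite /energy !normrM ler_wpM2r// ler_wpM2l//.
  exact: clip_lip.
have pM M : 2 * vsum (fun i => qM M i * rsum (lflux rho p) i) =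
    - vsum (rsum (energy p (qM M))).
  apply: (parts_bounded hp (flux_le_le wge0 (fun i j _ => dE M i j) he) (M := M%:R)).
  by move=> i; exact: clip_bound.
apply/eqP; rewrite -subr_eq0 -normr_le0; apply/ler_addgt0Pl => e e0; rewrite addr0.
have e3 : 0 < e / 3 by rewrite divr_gt0.
have d1 M i : `|qM M i * rsum (lflux rho p) i| <= `|q i * rsum (lflux rho p) i|.
  by rewrite !normrM ler_wpM2r// clip_le.
have ev1 i : \forall M \near \oo, qM M i * rsum (lflux rho p) i = q i * rsum (lflux rho p) i.
  by move: (ev i.+1); apply: filterS => M /(_ i (ltnSn i)) ->.
have d2 M i : `|rsum (energy p (qM M)) i| <= `|rsum (fun i j => `|energy p q i j|) i|.
  rewrite [leRHS]ger0_norm ?(rowsum_ge0 b wge0)//.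
  apply: le_trans (rowsum_norm b wge0 _ _) _.
  by apply: (rowsum_le b wge0) => j _; exact: dE.
have ev2 i : \forall M \near \oo, rsum (energy p (qM M)) i = rsum (energy p q) i.
  move: (ev (maxn i.+1 (b i))); apply: filterS => M h; apply: eq_big_nat => j /andP[_ ji].
  by rewrite /energy !h ?leq_max ?ltnSn ?ji ?orbT.
have h1 := vsum_eventually hq e3 d1 ev1.
have h2 := vsum_eventually he e3 d2 ev2.
have [M _ /(_ M (leqnn M)) [k1 k2]] := filterI h1 h2.
rewrite (_ : _ - _ = 2 * (vsum (fun i => q i * rsum (lflux rho p) i) -
   vsum (fun i => qM M i * rsum (lflux rho p) i)) +
   (vsum (rsum (energy p q)) - vsum (rsum (energy p (qM M))))); last first.
  by have := pM M; lra.
apply: le_trans (ler_normD _ _) _.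
rewrite normrM (ger0_norm (ler0n _ 2)) distrC [X in _ + X]distrC; lra.
Qed.

(** Testing with a truncation of [r] itself: [clip] is monotone, so the energy is nonnegative on
    every edge, and its sum vanishes. *)
Lemma flux_kernel r c : gconnected G -> flux_le w b (lflux rho r) c ->
  (forall i, rsum (lflux rho r) i = 0) -> forall i, r i = r 0%N.
Proof.
move=> hc hr h0.
have edge i j : adj G i j -> r j = r i.
  (* At this height the truncation leaves [r] unchanged at both ends of the edge, and the energy
     there is a genuine square. *)
  move=> ij; pose M := `|r i| + `|r j|.
  have M0 : 0 <= M by rewrite addr_ge0.
  pose q k := clip M (r k).
  have qb k : `|q k| <= M by exact: clip_bound.
  have he : flux_le w b (energy r q) ((M + M) * c).
    have := flux_le_mul wge0 (g := fun i j => q j - q i) (k := M + M) _ hr.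
    move=> /(_ (fun i j => le_trans (ler_normB _ _) (lerD (qb j) (qb i)))).
    apply: (flux_le_le wge0) => i' j' _; rewrite /energy /lflux le_eqVlt.
    by apply/orP; left; apply/eqP; congr (`|_|); ring.
  have e_ge0 i' j' : 0 <= energy r q i' j'.
    by rewrite /energy mulr_ge0 ?clip_mono// ltW.
  have := parts_bounded hr he qb.
  rewrite (vsum_fin_support (N := 0%N)) => [|k _]; last by rewrite h0 mulr0.
  rewrite big_geq// mulr0 => E.
  have := sum_le_vsum i.+1 (absum_rowsum wge0 he)
     (fun k => rowsum_ge0 b wge0 (X := energy r q) (e_ge0 k)).
  rewrite (_ : vsum _ = 0); last by lra.
  rewrite big_nat_recr//= => hle.
  have : rsum (energy r q) i <= 0.
    apply: le_trans hle; rewrite lerDr; apply: sumr_ge0 => k _.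
    by apply: (rowsum_ge0 b wge0) => ?; exact: e_ge0.
  rewrite /rowsum (bigD1_seq j) ?iota_uniq//=; last by rewrite mem_index_iota/= hb.
  move=> hle2; have : w i j * energy r q i j <= 0.
    apply: le_trans hle2; rewrite lerDl; apply: sumr_ge0 => k _.
    by rewrite mulr_ge0 ?wge0.
  rewrite pmulr_rle0 -?(adjE hG)// => e0.
  have qi : q i = r i by apply: clip_id; rewrite lerDl.
  have qj : q j = r j by apply: clip_id; rewrite lerDr.
  move: e0; rewrite /energy qi qj pmulr_lle0// -expr2 => e0.
  have : (r j - r i) ^+ 2 == 0 by rewrite eq_le e0 sqr_ge0.
  by rewrite sqrf_eq0 subr_eq0 => /eqP.
have along s : forall i, path (adj G) i s -> r (last i s) = r i.
  elim: s => [|j s IH] i //= /andP[ij js].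
  by rewrite IH// (edge _ _ ij).
by move=> i; have [s [ps <-]] := hc 0%N i; exact: along.
Qed.

Lemma BopE p i : mu i * Bop G rho p i = - rsum (lflux rho p) i.
Proof. by rewrite /Bop mulrN (divGE hG hb). Qed.

Lemma lflux_l1 p c : flux_le w b (lflux rho p) c -> l1le (divG G rho (grad G p)) c.
Proof.
by move=> /(absum_rowsum wge0); apply: absum_le_le => i; rewrite (divGE hG hb).
Qed.

Lemma nbr_rowsum (f : nat -> R) X i : (forall j, ~~ adj G i j -> f j = 0) ->
  (forall j, adj G i j -> f j = w i j * X i j) ->
  \sum_(j \in nbr G i) f j = rsum X i.
Proof.
move=> h0 h1; rewrite (nbr_sumE hb)//; apply: eq_bigr => j _.
have [/h1//|nij] := boolP (adj G i j).
by rewrite h0// (wt_zero hG)// mul0r.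
Qed.

Lemma flux_seriesP p : 
  (\sum_(i <oo)
        (\sum_(j \in nbr G i) w i j * `|grad G p i j| * lmean G rho i j)%:E < +oo)%E
  <-> exists c, flux_le w b (lflux rho p) c.
Proof.
have e i : \sum_(j \in nbr G i) w i j * `|grad G p i j| * lmean G rho i j =
    rsum (fun i j => `|lflux rho p i j|) i.
  apply: nbr_rowsum => j; first by move=> /(wt_zero hG) ->; rewrite !mul0r.
  rewrite (adjE hG) => ij.
  by rewrite -mulrA (gradE hG)// (lmeanE hG)// /lflux normrM [in RHS](gtr0_norm (lm_gt0 _ _)).
under eq_eseriesr do rewrite e.
rewrite nneseries_finP => [|i]; last by apply: (rowsum_ge0 b wge0) => ?.
split=> -[c hc]; exists c => N.
  rewrite (eq_bigr (rsum (fun i j => `|lflux rho p i j|))) => [|i _]; first exact: hc.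
  by rewrite ger0_norm ?(rowsum_ge0 b wge0).
apply: le_trans (hc N); apply: le_sum_nat => i _; exact: ler_norm.
Qed.

Lemma cross_seriesP p q :
  (\sum_(i <oo) (\sum_(j \in nbr G i) w i j * `|grad G p i j| * `|grad G q i j|
     * lmean G rho i j)%:E < +oo)%E <-> exists c, flux_le w b (energy p q) c.
Proof.
have e i : \sum_(j \in nbr G i) w i j * `|grad G p i j| * `|grad G q i j|
     * lmean G rho i j = rsum (fun i j => `|energy p q i j|) i.
  apply: nbr_rowsum => j; first by move=> /(wt_zero hG) ->; rewrite !mul0r.
  rewrite (adjE hG) => ij.
  rewrite !(gradE hG)// (lmeanE hG)// /energy !normrM (gtr0_norm (lm_gt0 _ _)).
  by rewrite !mulrA.
under eq_eseriesr do rewrite e.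
rewrite nneseries_finP => [|i]; last by apply: (rowsum_ge0 b wge0) => ?.
split=> -[c hc]; exists c => N.
  rewrite (eq_bigr (rsum (fun i j => `|energy p q i j|))) => [|i _]; first exact: hc.
  by rewrite ger0_norm ?(rowsum_ge0 b wge0).
apply: le_trans (hc N); apply: le_sum_nat => i _; exact: ler_norm.
Qed.

Lemma is_BpinvP sigma p : is_Bpinv G rho sigma p <->
  (exists c, flux_le w b (lflux rho p) c) /\
  forall i, mu i * sigma i = - rsum (lflux rho p) i.
Proof.
rewrite /is_Bpinv/=; split=> [[_ <- /flux_seriesP h]|[[c hc] h]].
  by split=> // i; exact: BopE.
split.
- by apply/(lnorm1_finP hG); exists c; exact: lflux_l1.
- apply/funext => i; apply: (mulfI (lt0r_neq0 (vmeas_gt0 hG i))).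
  by rewrite BopE h.
- by apply/flux_seriesP; exists c.
Qed.

Lemma Bpinv_unique sigma p q : gconnected G ->
  is_Bpinv G rho sigma p -> is_Bpinv G rho sigma q ->
  exists k, forall i, p i = q i + k.
Proof.
move=> hc /is_BpinvP[[c1 f1] h1] /is_BpinvP[[c2 f2] h2].
have e i j : lflux rho (fun i => p i - q i) i j = lflux rho p i j - lflux rho q i j.
  by rewrite /lflux; ring.
have hf : flux_le w b (lflux rho (fun i => p i - q i)) (c1 + c2).
  by apply: (flux_le_le wge0) (flux_leB wge0 f1 f2) => i j _; rewrite e.
have h0 i : rsum (lflux rho (fun i => p i - q i)) i = 0.
  rewrite (rowsum_ext b wge0 (Y := fun i j => lflux rho p i j - lflux rho q i j)) => [|j _].
    by rewrite rowsumB; have := h1 i; have := h2 i; lra.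
  exact: e.
exists (p 0%N - q 0%N) => i; have := flux_kernel hc hf h0 i; lra.
Qed.

Lemma BpinvP sigma : is_Bpinv G rho sigma !=set0 ->
  is_Bpinv G rho sigma (Bpinv G rho sigma).
Proof. by move=> [p hp]; exact: xgetPex (ex_intro _ p hp). Qed.

End Riemannian.

(** * Gradient flow of the free energy *)

Section FreeEnergy.
Context {R : realType}.
Variable G : wgraph R.
Hypothesis hG : weighted_graph G.
Local Notation w := (wt G).
Local Notation mu := (vmeas G).
Local Notation l1le := (l1le G).
Local Notation pdens := (pdens G).
Variable b : nat -> nat.
Hypothesis hb : forall i j, adj G i j -> (j < b i)%N.
Local Notation rsum := (rowsum w b).
Local Notation wge0 := (wt_ge0 hG).
Hypothesis hconn : gconnected G.
Variables (Psi : nat -> R) (C : R).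
Hypotheses (C_ge0 : 0 <= C) (hC : forall i j, `|grad G Psi i j| <= C).
Local Notation F := (fp_rhs G Psi).
Hypothesis hZ : (\sum_(j <oo) (mu j * expR (- Psi j))%:E < +oo)%E.

Definition chemical (rho : nat -> R) (i : nat) : R := Psi i + 1 + ln (rho i).

(** Bounded differences along edges give linear growth in the distance, which the second moment
    controls. *)
Lemma potential_growth i : `|Psi i| <= (`|Psi 0%N| + (C + 1)) * (1 + gdist G 0 i ^+ 2).
Proof.
have C1 : 0 < C + 1 by rewrite ltr_wpDl.
have g0 := gdist_ge0 G 0 i.
have h : `|Psi i - Psi 0%N| <= (C + 1) * gdist G 0 i.
  rewrite mulrC -ler_pdivrMr//; apply: lb_le_inf.
    by have [s hs] := hconn 0%N i; exists (size s)%:R; exists s.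
  move=> _ [s [ps <-] <-]; rewrite ler_pdivrMr//.
  have d0 : 0 <= C + 1 by exact: ltW.
  apply: (path_oscillation (M := (\max_(k <- 0%N :: s) k).+1) d0 _ ps).
    move=> i' j' _ _; rewrite (adjE hG) => ij; rewrite distrC.
    by apply: le_trans (grad_Psi hG hC ij) _; rewrite lerDl.
  by apply/allP => k ks; rewrite ltnS; exact: leq_bigmax_seq.
have e : Psi i = Psi 0%N + (Psi i - Psi 0%N) by ring.
rewrite [in leLHS]e; apply: le_trans (ler_normD _ _) _.
have a0 := normr_ge0 (Psi 0%N).
have h1 : (C + 1) * gdist G 0 i <= (C + 1) * (1 + gdist G 0 i ^+ 2).
  rewrite ler_wpM2l ?(ltW C1)//; have := sqr_ge0 (gdist G 0 i - 1); nra.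
have h2 : `|Psi 0%N| <= `|Psi 0%N| * (1 + gdist G 0 i ^+ 2).
  by rewrite ler_peMr// lerDl sqr_ge0.
rewrite mulrDl; lra.
Qed.

Lemma potential_summable rho : dens0s G rho ->
  exists c, absum_le (fun i => mu i * Psi i * rho i) c.
Proof.
move=> /(dens0sP hG)[_ [c hc]].
exists ((`|Psi 0%N| + (C + 1)) * c).
have k0 : 0 <= `|Psi 0%N| + (C + 1) by rewrite addr_ge0// addr_ge0.
have := l1leZ (`|Psi 0%N| + (C + 1)) hc; rewrite (ger0_norm k0) => h.
apply: (absum_le_le _ h) => i; rewrite -mulrA normrM [leRHS]normrM ler_wpM2l//.
rewrite mulrA normrM [leRHS]normrM ler_wpM2r//.
by apply: le_trans (potential_growth i) _; exact: ler_norm.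
Qed.

(* [- r ln r <= r Psi + exp (- Psi)] bounds the entropy of small densities. *)
Lemma entropy_summable rho : dens0s G rho ->
  exists c, absum_le (fun i => mu i * rho i * ln (rho i)) c.
Proof.
move=> hs; have [c1 h1] := potential_summable hs.
have [[r0 r1 _] _] := (dens0sP hG rho).1 hs.
have z0 i : 0 <= mu i * expR (- Psi i) by rewrite mulr_ge0 ?(vmeas_ge0 hG)// expR_ge0.
have [c2 h2] := (nneseries_finP z0).1 hZ.
have [m m0 hm] := vmeas_lbound hG.
have h2' : absum_le (fun i => mu i * expR (- Psi i)) c2.
  move=> N; rewrite (eq_bigr (fun i => mu i * expR (- Psi i))) => [|i _]; first exact: h2.
  by rewrite ger0_norm.
have n1 : absum_le (fun i => `|mu i * Psi i * rho i|) c1.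
  by apply: absum_le_le h1 => i; rewrite normr_id.
have := absum_leD (absum_leD n1 h2') (absum_leZ m^-1 r1).
move=> h; exists (c1 + c2 + `|m^-1| * 1); apply: absum_le_le h => i.
have ri := r0 i; have mi := vmeas_gt0 hG i.
have rm : rho i <= m^-1.
  have := l1le_pt hG i r1; rewrite gtr0_norm// => h.
  rewrite -[leRHS]mul1r ler_pdivlMr// mulrC; apply: le_trans h.
  by rewrite ler_wpM2r ?(ltW ri).
have up : rho i * ln (rho i) <= m^-1 * rho i.
  rewrite mulrC ler_wpM2r ?(ltW ri)//; apply: le_trans rm.
  have := ln_diff_le ri ltr01; rewrite ln1 subr0 divr1; lra.
have lo : - (rho i * ln (rho i)) <= rho i * Psi i + expR (- Psi i).
  have := ln_diff_le (expR_gt0 (- Psi i)) ri; rewrite expRK ler_pdivlMr//; lra.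
have lo' : rho i * Psi i <= `|rho i * Psi i| by exact: ler_norm.
have a0 : 0 <= `|rho i * Psi i| by [].
have b0 := expR_ge0 (- Psi i).
have c0 : 0 <= m^-1 * rho i by rewrite mulr_ge0 ?invr_ge0 ?(ltW m0)// ltW.
have -> : `|mu i * rho i * ln (rho i)| = mu i * `|rho i * ln (rho i)|.
  by rewrite -mulrA normrM (gtr0_norm mi).
rewrite [leRHS](_ : _ = mu i * (`|rho i * Psi i| + expR (- Psi i) + m^-1 * rho i)).
  by rewrite ler_pM2l// ler_norml; lra.
have e : `|mu i * Psi i * rho i| + mu i * expR (- Psi i) + m^-1 * (mu i * rho i) =
    mu i * (`|rho i * Psi i| + expR (- Psi i) + m^-1 * rho i).
  by rewrite -mulrA normrM (gtr0_norm mi) (mulrC (Psi i)); ring.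
by rewrite e ger0_norm// mulr_ge0 ?(ltW mi)// !addr_ge0.
Qed.

Lemma vsum_perturb (u v : nat -> R) c N : absum_le v c ->
  (forall i, (N <= i)%N -> u i = v i) ->
  vsum u = vsum v - \sum_(0 <= i < N) v i + \sum_(0 <= i < N) u i.
Proof.
move=> hv h; have h0 i : (N <= i)%N -> u i - v i = 0.
  by move=> /h ->; rewrite subrr.
have := vsumD hv (absum_fin_support h0).
rewrite (vsum_ext (v := u)) => [->|i]; last by rewrite addrC subrK.
by rewrite (vsum_fin_support h0) sumrB; ring.
Qed.

Lemma finite_support_bound (s : nat -> R) : finite_set [set i | s i != 0] ->
  exists N, forall i, (N <= i)%N -> s i = 0.
Proof.
move=> /finite_seqP[l hl]; exists (\max_(i <- l) i).+1 => i hi.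
apply/eqP; apply: contraTT hi => si.
have : [set i | s i != 0] i by [].
by rewrite hl/= -leqNgt => il; exact: leq_bigmax_seq.
Qed.

Lemma is_derive_psum (f : nat -> R -> R) (df : nat -> R) (x : R) N :
  (forall i, is_derive x 1 (f i) (df i)) ->
  is_derive x 1 (fun s => \sum_(0 <= i < N) f i s) (\sum_(0 <= i < N) df i).
Proof.
move=> h; elim: N => [|N IH].
  rewrite big_geq//; have := is_derive_cst (0 : R) x (1 : R).
  by congr is_derive; apply/funext => s; rewrite big_geq.
rewrite big_nat_recr//=.
have := is_deriveD IH (h N); congr is_derive; apply/funext => s.
by rewrite big_nat_recr.
Qed.

(** Along a finitely supported direction the functional is a constant plus a finite sum, so no
    series has to be differentiated. *)
Lemma first_variation_free_energy rho : dens0s G rho ->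
  first_variation G (free_energy G Psi) rho (chemical rho).
Proof.
move=> hs sigma /finite_support_bound[N hN].
have [c1 h1] := potential_summable hs; have [c2 h2] := entropy_summable hs.
have [[r0 _ _] _] := (dens0sP hG rho).1 hs.
pose f i (s : R) := mu i * Psi i * (rho i + s * sigma i) +
  mu i * (rho i + s * sigma i) * ln (rho i + s * sigma i).
pose K := vsum (fun i => mu i * Psi i * rho i)
  - \sum_(0 <= i < N) mu i * Psi i * rho i +
  (vsum (fun i => mu i * rho i * ln (rho i))
  - \sum_(0 <= i < N) mu i * rho i * ln (rho i)).
have -> : (fun s : R => free_energy G Psi (fun i => rho i + s * sigma i)) =
    (fun s => K + \sum_(0 <= i < N) f i s).
  apply/funext => s; rewrite /free_energy /K /f.
  have z i : (N <= i)%N -> rho i + s * sigma i = rho i.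
    by move=> /hN ->; rewrite mulr0 addr0.
  rewrite (vsum_perturb (N := N) h1) => [|i /z e]; last by rewrite /= e.
  rewrite (vsum_perturb (u := fun i => mu i * (rho i + s * sigma i) *
    ln (rho i + s * sigma i)) (N := N) h2) => [|i /z e]; last by rewrite /= e.
  by rewrite big_split/=; ring.
have -> : pairing G (chemical rho) sigma = 0 + \sum_(0 <= i < N) chemical rho i * sigma i * mu i.
  by rewrite add0r; apply: vsum_fin_support => i /hN ->; rewrite mulr0 mul0r.
apply: is_deriveD; apply: is_derive_psum => i.
have lin : is_derive (0 : R) 1 (fun s : R => rho i + s * sigma i) (sigma i).
  have h := is_deriveD (is_derive_cst (rho i) (0 : R) (1 : R))
    (is_deriveM (is_derive_id (0 : R) (1 : R)) (is_derive_cst (sigma i) (0 : R) (1 : R))).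
  apply: is_derive_eq h _.
  by rewrite /GRing.scale/= mulr0 !add0r mulr1.
have r00 : 0 < rho i + 0 * sigma i by rewrite mul0r addr0.
have lnd : is_derive (0 : R) 1 (fun s : R => ln (rho i + s * sigma i))
    (sigma i * (rho i)^-1).
  have h := @is_derive1_comp R (@ln R) (fun s : R => rho i + s * sigma i) 0 _ _
    (is_derive1_ln r00) lin.
  apply: is_derive_eq h _.
  by rewrite mul0r addr0 mulrC.
have h1' := is_deriveM (is_derive_cst (mu i * Psi i) (0 : R) (1 : R)) lin.
have h2' := is_deriveM (is_deriveM (is_derive_cst (mu i) (0 : R) (1 : R)) lin) lnd.
apply: is_derive_eq (is_deriveD h1' h2') _.
rewrite /GRing.scale/= mulrfctE /cst !mul0r !mulr0 !addr0 /chemical.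
have ri := r0 i; field; rewrite gt_eqF//.
Qed.

Lemma fp_rhs_Bop rho i : (forall i, 0 < rho i) -> F rho i = - Bop G rho (chemical rho) i.
Proof.
move=> r0; apply: (mulfI (lt0r_neq0 (vmeas_gt0 hG i))).
rewrite mulrN (BopE hG hb)// opprK (fp_rhsE hG hb)//.
apply: (rowsum_ext b wge0) => j _.
rewrite (fpflux_lflux _ _ _ r0) /lflux /chemical; congr (_ * _); ring.
Qed.

Lemma chemical_flux rho : (forall i, 0 < rho i) ->
  forall i j, lflux rho (chemical rho) i j = fpflux Psi rho i j.
Proof.
by move=> r0 i j; rewrite (fpflux_lflux _ _ _ r0) /lflux /chemical; congr (_ * _); ring.
Qed.

(** The flux of the chemical potential is the Fokker-Planck flux, which is absolutely summable, so
    the pseudo-inverse selects this preimage of the velocity up to a constant and sign. *)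
Lemma fp_is_Bpinv rho v : pdens rho -> (forall i, v i = F rho i) ->
  is_Bpinv G rho v (fun i => - chemical rho i).
Proof.
move=> hr hv; have [r0 _ _] := hr.
have e i j : lflux rho (fun i => - chemical rho i) i j = - fpflux Psi rho i j.
  by rewrite -chemical_flux// /lflux; ring.
apply/(is_BpinvP hG hb r0); split.
  exists ((1 + C) * (2 * 1)).
  apply: (flux_le_le wge0) (fpflux_le hG hb C_ge0 hC hr) => i j _.
  by rewrite e normrN.
move=> i; rewrite hv (fp_rhsE hG hb)//.
have -> : rsum (lflux rho (fun i => - chemical rho i)) i = - rsum (fpflux Psi rho) i.
  rewrite /rowsum -sumrN; apply: eq_bigr => j _; by rewrite e mulrN.
by rewrite opprK.
Qed.

Lemma tangent_l1 rho sigma p c : (forall i, 0 < rho i) ->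
  flux_le w b (lflux rho p) c -> (forall i, mu i * sigma i = - rsum (lflux rho p) i) ->
  tangent G rho sigma.
Proof.
move=> r0 hp hs; have [hK hB _] : is_Bpinv G rho sigma p.
  by apply/(is_BpinvP hG hb r0); split=> //; exists c.
split; first by exists p.
rewrite (vsum_ext (v := fun i => - rsum (lflux rho p) i)) => [|i]; last first.
  by rewrite mulrC hs.
rewrite (vsumN (absum_rowsum wge0 hp)) (edge_sum_eq0 (wt_sym hG) wge0 (wt_row hG hb) hp).
  by rewrite oppr0.
by move=> i j _; rewrite (lflux_anti rho p i j) subrr.
Qed.

(** The pseudo-inverse of the velocity is minus the chemical potential plus a constant. Summation by
    parts turns both pairings into the same energy with opposite signs. *)
Lemma fp_gradient_flow_at rho v : dens0s G rho -> (forall i, v i = F rho i) ->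
  gradient_flow_at G (free_energy G Psi) rho v.
Proof.
move=> hs hv; exists (chemical rho); first exact: first_variation_free_energy.
have [hr _] := (dens0sP hG rho).1 hs; have [r0 _ _] := hr.
have hp0 := fp_is_Bpinv hr hv.
have /(is_BpinvP hG hb r0)[[c0 f0] e0] := hp0.
split; first exact: (tangent_l1 r0 f0 e0).
  by exists (fun i => - chemical rho i).
move=> sigma _ [n1 n2 abs1 crs] abs2.
have hp := BpinvP n1; have hq := BpinvP n2.
rewrite /g2; move: abs1 crs hp hq.
set p := Bpinv G rho v; set q := Bpinv G rho sigma => abs1 crs hp hq.
have [k hk] := Bpinv_unique hG hb r0 hconn hp hp0.
have /(is_BpinvP hG hb r0)[[c1 f1] e1] := hp.
have /(is_BpinvP hG hb r0)[[c2 f2] e2] := hq.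
have [c he] := (cross_seriesP hG hb r0 p q).1 crs.
have [a1 {}abs1] := (vsummableP _).1 abs1.
have [a2 {}abs2] := (vsummableP _).1 abs2.
have s1 : absum_le (fun i => q i * rsum (lflux rho p) i) a1.
  apply: absum_le_le abs1 => i; have -> : rsum (lflux rho p) i = - (mu i * v i).
    by rewrite e1 opprK.
  by rewrite mulrN normrN mulrCA mulrA mulrC mulrA mulrAC.
have ed i j : energy rho q (chemical rho) i j = - energy rho p q i j.
  by rewrite /energy !hk; ring.
have he' : flux_le w b (energy rho q (chemical rho)) c.
  by apply: (flux_le_le wge0) he => i j _; rewrite ed normrN.
have s2 : absum_le (fun i => chemical rho i * rsum (lflux rho q) i) a2.
  apply: absum_le_le abs2 => i; have -> : rsum (lflux rho q) i = - (mu i * sigma i).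
    by rewrite e2 opprK.
  by rewrite mulrN normrN mulrA mulrAC.
have P1 := parts hG hb f1 he s1; have P2 := parts hG hb f2 he' s2.
have g1 : pairing G v q = - vsum (fun i => q i * rsum (lflux rho p) i).
  rewrite -(vsumN s1); apply: vsum_ext => i.
  by rewrite -mulrN -e1; ring.
have g2' : pairing G (chemical rho) sigma = - vsum (fun i => chemical rho i * rsum (lflux rho q) i).
  rewrite -(vsumN s2); apply: vsum_ext => i.
  by rewrite -mulrN -e2; ring.
have P3 : vsum (rsum (energy rho q (chemical rho))) = - vsum (rsum (energy rho p q)).
  rewrite -(vsumN (absum_rowsum wge0 he)); apply: vsum_ext => i.
  by rewrite /rowsum -sumrN; apply: eq_bigr => j _; rewrite ed mulrN.
rewrite g1 g2'; move: P1 P2; rewrite P3; lra.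
Qed.

Lemma gradient_flow_at_fp rho v : dens0s G rho ->
  gradient_flow_at G (free_energy G Psi) rho v -> forall i, v i = F rho i.
Proof.
move=> hs [D hD [[_ vm] nv hv]] k.
have [hr _] := (dens0sP hG rho).1 hs; have [r0 _ _] := hr.
have mk := vmeas_gt0 hG.
pose delta (l i : nat) : R := (i == l)%:R.
have fin l : finite_set [set i | delta l i != 0].
  apply: (@sub_finite_set _ _ [set l]); last exact: finite_set1.
  by move=> i /=; rewrite /delta; have [->//|_] := eqVneq i l; rewrite mulr0n eqxx.
(* Testing with indicators of single vertices identifies the unspecified first variation. *)
have D0 : D = chemical rho.
  apply/funext => l.
  have := @derive_val _ _ _ _ _ _ _ (hD (delta l) (fin l)).
  rewrite (@derive_val _ _ _ _ _ _ _ (first_variation_free_energy hs (fin l))).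
  have pd (f : nat -> R) : pairing G f (delta l) = f l * mu l.
    rewrite /pairing (vsum_fin_support (N := l.+1)) => [|i li].
      rewrite big_nat_recr//= big_nat big1 ?add0r => [|i /andP[_ il]].
        by rewrite /delta eqxx mulr1.
      by rewrite /delta (ltn_eqF il) mulr0 mul0r.
    by rewrite /delta (gtn_eqF li) mulr0 mul0r.
  by rewrite !pd => /(mulIf (lt0r_neq0 (mk l))).
subst D.
have fD : flux_le w b (lflux rho (chemical rho)) ((1 + C) * (2 * 1)).
  apply: (flux_le_le wge0) (fpflux_le hG hb C_ge0 hC hr) => i j _.
  by rewrite chemical_flux.
pose q := delta k; pose sigma := Bop G rho q.
have qb i : `|q i| <= 1 by rewrite /q /delta; case: (i == k); rewrite ?normr1 ?normr0.
have qd i j : `|q j - q i| <= 2.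
  apply: le_trans (ler_normB _ _) _; have := qb i; have := qb j; lra.
(* Beyond [k] and all its neighbours both the flux of [q] and [sigma] vanish, so the series
   involving them are finite sums. *)
pose B := maxn k.+1 (b k).
have q0 i j : (B <= i)%N -> 0 < w i j -> q j - q i = 0.
  rewrite geq_max => /andP[ki bi] wij.
  have jk : j != k.
    apply: contraTneq wij => ->; rewrite (wt_sym hG) (wt_row hG hb)// ltxx//.
  by rewrite /q /delta (negPf jk) (gtn_eqF ki) subrr.
have lq0 i : (B <= i)%N -> rsum (lflux rho q) i = 0.
  move=> Bi; rewrite (rowsum_ext b wge0 (Y := fun _ _ => 0)) => [|j wij].
    by rewrite /rowsum big1// => j _; rewrite mulr0.
  by rewrite /lflux (q0 i j Bi wij) mul0r.
have lq0' i : (B <= i)%N -> rsum (fun i j => `|lflux rho q i j|) i = 0.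
  move=> Bi; rewrite (rowsum_ext b wge0 (Y := fun _ _ => 0)) => [|j wij].
    by rewrite /rowsum big1// => j _; rewrite mulr0.
  by rewrite /lflux (q0 i j Bi wij) mul0r normr0.
have fq := absum_fin_support lq0'.
have es i : mu i * sigma i = - rsum (lflux rho q) i by rewrite (BopE hG hb).
have hq : is_Bpinv G rho sigma q.
  by apply/(is_BpinvP hG hb r0); split; [eexists; exact: fq|].
have nq : is_Bpinv G rho sigma !=set0 by exists q.
have hq' := BpinvP nq; have hp := BpinvP nv.
(* The chosen preimage is the indicator of [k] plus an unknown constant [c]; since [v] has total
   mass zero, [c] drops out and [g2] returns [v k * mu k]. *)
have [c hc] := Bpinv_unique hG hb r0 hconn hq' hq.
have /(is_BpinvP hG hb r0)[[c1 f1] e1] := hp.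
have vl1 : absum_le (fun i => v i * mu i) c1.
  apply: absum_le_le (absum_rowsum wge0 f1) => i.
  by rewrite mulrC e1 normrN.
have vq : absum_le (fun i => v i * Bpinv G rho sigma i * mu i) ((1 + `|c|) * c1).
  have k0 : 0 <= 1 + `|c| by rewrite addr_ge0.
  have := absum_leZ (1 + `|c|) vl1; rewrite (ger0_norm k0).
  apply: absum_le_le => i; rewrite mulrAC mulrC normrM [leRHS]normrM ler_wpM2r//.
  rewrite hc (ger0_norm k0); apply: le_trans (ler_normD _ _) _.
  by rewrite lerD2r.
have ce : flux_le w b (energy rho (Bpinv G rho v) (Bpinv G rho sigma)) (2 * c1).
  have := flux_le_mul wge0 (g := fun i j => q j - q i) qd f1.
  apply: (flux_le_le wge0) => i j _; rewrite /energy /lflux !hc le_eqVlt.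
  by apply/orP; left; apply/eqP; congr (`|_|); ring.
have Ds0 i : (B <= i)%N -> chemical rho i * sigma i * mu i = 0.
  by move=> Bi; rewrite -mulrA (mulrC (sigma i)) es lq0// oppr0 mulr0.
have := hv sigma (tangent_l1 r0 fq es).
have gd : g2_defined G rho v sigma.
  split=> //; first by apply/vsummableP; eexists; exact: vq.
  by apply/(cross_seriesP hG hb r0); exists (2 * c1).
have ad : pairing_abs_cvg G (chemical rho) sigma.
  by apply/vsummableP; eexists; exact: (absum_fin_support Ds0).
move=> /(_ gd ad) E.
have qv0 i : (k.+1 <= i)%N -> v i * q i * mu i = 0.
  by move=> ki; rewrite /q /delta (gtn_eqF ki) mulr0 mul0r.
have E1 : g2 G rho v sigma = v k * mu k.
  rewrite /g2 /pairing (vsum_ext (v := fun i => v i * q i * mu i + c * (v i * mu i))).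
    rewrite (vsumD (absum_fin_support qv0) (absum_leZ c vl1)) (vsumZ c vl1) vm mulr0 addr0.
    rewrite (vsum_fin_support qv0) big_nat_recr//= big_nat big1 ?add0r => [|i /andP[_ ik]].
      by rewrite /q /delta eqxx mulr1.
    by rewrite /q /delta (ltn_eqF ik) mulr0 mul0r.
  by move=> i; rewrite hc; ring.
have lqD : forall i, (B <= i)%N -> chemical rho i * rsum (lflux rho q) i = 0.
  by move=> i /lq0 ->; rewrite mulr0.
have qDk i : (k.+1 <= i)%N -> q i * rsum (lflux rho (chemical rho)) i = 0.
  by move=> ki; rewrite /q /delta (gtn_eqF ki) mul0r.
have eD : flux_le w b (energy rho (chemical rho) q) (2 * ((1 + C) * (2 * 1))).
  have := flux_le_mul wge0 (g := fun i j => q j - q i) qd fD.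
  apply: (flux_le_le wge0) => i j _; rewrite /energy /lflux le_eqVlt.
  by apply/orP; left; apply/eqP; congr (`|_|); ring.
have eD' : flux_le w b (energy rho q (chemical rho)) (2 * ((1 + C) * (2 * 1))).
  by apply: (flux_le_le wge0) eD => i j _; rewrite energyC.
have P1 := parts hG hb fq eD' (absum_fin_support lqD).
have P2 := parts hG hb fD eD (absum_fin_support qDk).
have E2 : pairing G (chemical rho) sigma = - vsum (fun i => chemical rho i * rsum (lflux rho q) i).
  rewrite -(vsumN (absum_fin_support lqD)); apply: vsum_ext => i.
  by rewrite -mulrN -es; ring.
have E3 : vsum (fun i => q i * rsum (lflux rho (chemical rho)) i) = rsum (lflux rho (chemical rho)) k.
  rewrite (vsum_fin_support qDk) big_nat_recr//= big_nat big1 ?add0r => [|i /andP[_ ik]].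
    by rewrite /q /delta eqxx mul1r.
  by rewrite /q /delta (ltn_eqF ik) mul0r.
have E4 : vsum (rsum (energy rho q (chemical rho))) = vsum (rsum (energy rho (chemical rho) q)).
  by apply: vsum_ext => i; apply: eq_bigr => j _; rewrite energyC.
have E5 : rsum (lflux rho (chemical rho)) k = mu k * F rho k.
  rewrite (fp_rhsE hG hb)//; apply: (rowsum_ext b wge0) => j _; exact: chemical_flux.
apply: (mulfI (lt0r_neq0 (mk k))).
move: E P1 P2; rewrite E1 E2 E3 E4 E5; lra.
Qed.

End FreeEnergy.

Unset Implicit Arguments.

Theorem theorem1p1 (R : realType) (G : wgraph R) (Psi : nat -> R)
    (hG : weighted_graph G) (hconn : gconnected G)
    (hfin : locally_unif_finite G) (hsc : stochastically_complete G)
    (hPsi : potential G Psi) :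
  (* (1) *)
  ((forall rho : nat -> R, dens0s G rho ->
      [/\ vsummable (fun i => vmeas G i * Psi i * rho i),
          vsummable (fun i => vmeas G i * rho i * ln (rho i)),
          first_variation G (free_energy G Psi) rho
            (fun i => Psi i + 1 + ln (rho i)) &
          forall i, fp_rhs G Psi rho i =
            - Bop G rho (fun i => Psi i + 1 + ln (rho i)) i]) /\
   (forall (rho0 : nat -> R) (rho drho : R -> nat -> R),
      dens0s G rho0 -> curve_in_dens0s G rho drho -> rho 0 = rho0 ->
      (fp_equation G Psi rho drho <->
       gradient_flow G (free_energy G Psi) rho drho))) /\
  (* (2) *)
  (forall rho0 : nat -> R, dens0s G rho0 ->
    exists2 rho : R -> nat -> R, global_solution G Psi rho0 rho &
      forall rho' : R -> nat -> R, global_solution G Psi rho0 rho' ->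
        forall t, 0 <= t -> rho' t = rho t) /\
  (* (3) *)
  (forall (rho0 : nat -> R) (rho : R -> nat -> R) (r : \bar R),
    dens0s G rho0 -> global_solution G Psi rho0 rho -> (2%:E <= r)%E ->
    lnorm G r (fun i => rho t i - gibbs G Psi i) @[t --> +oo] --> 0%E).
Proof.
have [b hb] := exists_row_bound hfin.
have [C C1 hC] := pot_grad hPsi.
have C0 : 0 <= C by exact: ltW (lt_trans ltr01 C1).
have gd : pdens G (gibbs G Psi) by have [] := (dens0sP hG _).1 (pot_gibbs hPsi).
have hZ := pot_Z hPsi.
split; last split.
- split=> [rho hs|rho0 rho drho _ [hc hs] _].
    have [[r0 _ _] _] := (dens0sP hG rho).1 hs.
    split.
    + exact/vsummableP/(potential_summable hG hconn C0 hC).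
    + exact/vsummableP/(entropy_summable hG hconn C0 hC hZ).
    + exact: (first_variation_free_energy hG hconn C0 hC hZ).
    + by move=> i; exact: (fp_rhs_Bop hG hb).
  split=> [hF t t0|hF t i t0].
    by apply: (fp_gradient_flow_at hG hb hconn C0 hC hZ (hs t t0)) => i; exact: hF.
  exact: (gradient_flow_at_fp hG hb hconn C0 hC hZ (hs t t0) (hF t t0)).
- by move=> rho0; exact: (fp_global hG hb C0 hC hconn).
- move=> rho0 rho r _ [drho [hc hs] [fp _]] r2.
  have hr t : 0 <= t -> pdens G (rho t) by move=> /hs/(dens0sP hG)[].
  (* Any given solution takes backward steps, so convergence is derived for it directly rather than
     for the limit of the schemes. *)
  have hu := solution_uniform_step hG hb C0 hC hc hr fp.
  apply/cvge0_leP => [t|e e0]; first exact: lnorm_ge0.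
  have [d d0 hd] := lnorm_small hG r2 e0.
  have [T T0 hT] := fp_l1_converges hG hb C0 hC gd hr hu hconn d0.
  by near=> t; apply: hd; apply: hT; near: t; apply: nbhs_pinfty_ge; exact: num_real.
Unshelve. all: by end_near. Qed.
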